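(* Let $\ell$ be a prime and let $\rho:\Gamma_{\mathbb{Q}}\to \mathrm{GL}(V_\rho)$ be an $\ell$-adic representation of $\Gamma_{\mathbb{Q}}$ whose restriction to $\Gamma_{\mathbb{Q}^{\mathrm{ab}}}$ is semi-simple. If there exist a prime $p\neq \ell$ and a Frobenius element $F_p\in\Gamma_{\mathbb{Q}}$ at $p$ such that $\rho(F_p)$ is a semi-simple automorphism of $V_\rho$, then $\rho$ is a semi-simple representation of $\Gamma_{\mathbb{Q}}$. In particular, $S(\mathbb{Q}^{\mathrm{ab}})$ implies the following statement: for every prime $\ell$, if an $\ell$-adic representation of $\Gamma_{\mathbb{Q}}$ coming from geometry is semi-simple at some prime $p\neq\ell$ at which it is unramified, then it is semi-simple as a representation of $\Gamma_{\mathbb{Q}}$.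
   Context: $\Gamma_k=\mathrm{Gal}(\bar k/k)$ for a field $k$; $\mathbb{Q}^{\mathrm{ab}}$ is the maximal abelian extension of $\mathbb{Q}$ in $\bar{\mathbb{Q}}$, so $\Gamma_{\mathbb{Q}^{\mathrm{ab}}}\subseteq\Gamma_{\mathbb{Q}}$ is normal. An $\ell$-adic representation of $\Gamma_k$ is a finite-dimensional $\mathbb{Q}_\ell$-vector space with a continuous linear $\Gamma_k$-action. A Frobenius element at $p$ is an element $F_p\in\Gamma_{\mathbb{Q}_p}\subseteq\Gamma_{\mathbb{Q}}$ (the inclusion induced by a field embedding $\bar{\mathbb{Q}}\hookrightarrow\bar{\mathbb{Q}}_p$) lifting the Frobenius of the maximal unramified extension of $\mathbb{Q}_p$. A linear automorphism is semi-simple if it becomes diagonalizable after a finite extension of the base field. An $\ell$-adic representation of $\Gamma_{\mathbb{Q}}$ unramified at $p\neq\ell$ is semi-simple at $p$ if one (equivalently any) Frobenius element at $p$ acts by a semi-simple automorphism. Let $\mathbf{C}(k,\ell)$ be the smallest neutral Tannakian subcategory of $\ell$-adic representations of $\Gamma_k$, closed under subquotients, containing all $H^i_{\mathrm{et}}(X_{\bar k},\mathbb{Q}_\ell)$ for $X$ smooth projective over $k$ and $i\in\mathbb{Z}$; its objects are said to come from geometry. $S(k)$ is the statement: for every prime $\ell$ different from the characteristic of $k$, every $\ell$-adic representation of $\Gamma_k$ coming from geometry is semi-simple. *)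

(* Defs.v *)
From HB Require Import structures.
From mathcomp Require Import all_boot all_order all_algebra all_field.
From mathcomp Require Import boolp.
From mathcomp Require Import mpoly.

Set Implicit Arguments.
Unset Strict Implicit.
Unset Printing Implicit Defensive.
Import GRing.Theory.
Local Open Scope ring_scope.

(* The ring Z_p as the inverse limit of the Z/p^n: [pseq x n] is the residue of
   x modulo p^n, as a natural number smaller than p^n. *)
Record padic_int (p : nat) (hp : prime p) := PadicInt {
  pseq :> nat -> nat;
  pseqP : forall n, (pseq n.+1 %% p ^ n)%N = pseq n
}.

Section PadicInt.
Variables (p : nat) (hp : prime p).
Local Notation Zp := (padic_int hp).
Implicit Types x y z : Zp.

Lemma padic_ext x y : (forall n, x n = y n) -> x = y.
Proof.
case: x y => [f fP] [g gP] /= /funext fg; rewrite fg in fP *.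
by rewrite (Prop_irrelevance fP gP).
Qed.

Lemma padic_mod x n : (x n %% p ^ n)%N = x n.
Proof. by rewrite -[in RHS](pseqP x n) -[in LHS](pseqP x n) modn_mod. Qed.

Fact padic_of_subproof (f : nat -> nat) :
  (forall n, f n.+1 = f n %[mod p ^ n])%N ->
  forall n, ((f n.+1 %% p ^ n.+1) %% p ^ n = f n %% p ^ n)%N.
Proof. by move=> fP n; rewrite modn_dvdm ?fP ?dvdn_exp2l. Qed.

Definition padic_of f fP : Zp := PadicInt hp (@padic_of_subproof f fP).

Lemma padic_S x n : (x n.+1 = x n %[mod p ^ n])%N.
Proof. by rewrite pseqP padic_mod. Qed.

Fact padic0_subproof n : (0 = 0 %[mod p ^ n])%N. Proof. by []. Qed.
Fact padic1_subproof n : (1 = 1 %[mod p ^ n])%N. Proof. by []. Qed.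
Fact padic_add_subproof x y n :
  (x n.+1 + y n.+1 = x n + y n %[mod p ^ n])%N.
Proof. by rewrite -modnDm !padic_S modnDm. Qed.
Fact padic_mul_subproof x y n :
  (x n.+1 * y n.+1 = x n * y n %[mod p ^ n])%N.
Proof. by rewrite -modnMm !padic_S modnMm. Qed.
Lemma padic_lt x n : (x n < p ^ n)%N.
Proof. by rewrite -padic_mod ltn_mod expn_gt0 prime_gt0. Qed.
Fact padic_opp_subproof x n :
  (p ^ n.+1 - x n.+1 = p ^ n - x n %[mod p ^ n])%N.
Proof.
apply/eqP; rewrite -(eqn_modDr (x n.+1)) subnK ?(ltnW (padic_lt _ _)) //.
rewrite -modnDmr padic_S modnDmr subnK ?(ltnW (padic_lt _ _)) //.
by rewrite modnn expnS modnMl.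
Qed.

Definition padic_zero := padic_of padic0_subproof.
Definition padic_one := padic_of padic1_subproof.
Definition padic_add x y := padic_of (padic_add_subproof x y).
Definition padic_mul x y := padic_of (padic_mul_subproof x y).
Definition padic_opp x := padic_of (padic_opp_subproof x).

HB.instance Definition _ := gen_eqMixin Zp.
HB.instance Definition _ := gen_choiceMixin Zp.

Fact padic_addA : associative padic_add.
Proof. by move=> x y z; apply: padic_ext => n /=; rewrite modnDmr modnDml addnA. Qed.
Fact padic_addC : commutative padic_add.
Proof. by move=> x y; apply: padic_ext => n /=; rewrite addnC. Qed.
Fact padic_add0 : left_id padic_zero padic_add.
Proof. by move=> x; apply: padic_ext => n /=; rewrite mod0n padic_mod. Qed.
Fact padic_addN : left_inverse padic_zero padic_opp padic_add.
Proof.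
move=> x; apply: padic_ext => n /=.
by rewrite modnDml subnK ?modnn ?mod0n // ltnW ?padic_lt.
Qed.
HB.instance Definition _ :=
  GRing.isZmodule.Build Zp padic_addA padic_addC padic_add0 padic_addN.

Fact padic_mulA : associative padic_mul.
Proof. by move=> x y z; apply: padic_ext => n /=; rewrite modnMmr modnMml mulnA. Qed.
Fact padic_mulC : commutative padic_mul.
Proof. by move=> x y; apply: padic_ext => n /=; rewrite mulnC. Qed.
Fact padic_mul1 : left_id padic_one padic_mul.
Proof. by move=> x; apply: padic_ext => n /=; rewrite modnMml mul1n padic_mod. Qed.
Fact padic_mulD : left_distributive padic_mul padic_add.
Proof.
by move=> x y z; apply: padic_ext => n /=; rewrite modnMml modnDm mulnDl.
Qed.
Fact padic_1neq0 : padic_one != padic_zero.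
Proof.
apply/eqP => /(congr1 (fun x : Zp => x 1%N)) /=.
by rewrite expn1 mod0n modn_small // prime_gt1.
Qed.
HB.instance Definition _ := GRing.Zmodule_isComNzRing.Build Zp
  padic_mulA padic_mulC padic_mul1 padic_mulD padic_1neq0.

Definition padic_unit : {pred Zp} := fun x => `[< exists y, y * x = 1 >].
Definition padic_inv x : Zp :=
  if pselect (exists y, y * x = 1) is left e then sval (cid e) else x.
Fact padic_mulV : {in padic_unit, left_inverse 1 padic_inv *%R}.
Proof.
move=> x /asboolP xu; rewrite /padic_inv; case: pselect => // e.
exact: (svalP (cid e)).
Qed.
Fact padic_unitPl x y : y * x = 1 -> padic_unit x.
Proof. by move=> yx; apply/asboolP; exists y. Qed.
Fact padic_inv_out : {in [predC padic_unit], padic_inv =1 id}.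
Proof.
move=> x /negP xu; rewrite /padic_inv; case: pselect => // e.
by case: xu; apply/asboolP.
Qed.
HB.instance Definition _ := GRing.ComNzRing_hasMulInverse.Build Zp
  padic_mulV padic_unitPl padic_inv_out.

Lemma padic_low x m n : (m <= n)%N -> (x n = x m %[mod p ^ m])%N.
Proof.
move=> /subnK <-; elim: (n - m)%N => [//|k IH]; rewrite addSn -IH.
have /(modn_dvdm (x (k + m).+1)) <- : (p ^ m %| p ^ (k + m))%N
  by rewrite dvdn_exp2l ?leq_addl.
by rewrite pseqP.
Qed.

Lemma padic_neq0 x : x != 0 -> exists m, (0 < x m)%N.
Proof.
move=> x0; apply: contrapT => H; case/eqP: x0; apply: padic_ext => n.
rewrite /= mod0n; case E: (x n) => [//|k]; case: H; exists n.
by rewrite E.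
Qed.

Fact padic_idomain : GRing.integral_domain_axiom Zp.
Proof.
move=> x y xy0; rewrite -[X in is_true X]negbK negb_or; apply/negP.
case/andP=> /padic_neq0 [a xa] /padic_neq0 [b yb].
have nz z m n : (m <= n)%N -> (0 < z m)%N -> ~~ (p ^ m %| z n)%N.
  move=> mn zm; rewrite /dvdn padic_low // padic_mod.
  by rewrite -lt0n.
have nd z m n : (m <= n)%N -> (0 < z m)%N ->
    (0 < z n)%N /\ (logn p (z n) < m)%N.
  move=> mn zm; have := nz z m n mn zm; case: (posnP (z n)) => [->|zn].
    by rewrite dvdn0.
  by rewrite pfactor_dvdn // -ltnNge.
have [x0 xl] := nd x a (a + b)%N (leq_addr _ _) xa.
have [y0 yl] := nd y b (a + b)%N (leq_addl _ _) yb.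
have := congr1 (fun z : Zp => z (a + b)%N) xy0; rewrite /= mod0n.
move=> /eqP; rewrite -/(dvdn _ _) pfactor_dvdn ?muln_gt0 ?x0 //.
by rewrite lognM // leqNgt -addSn leq_add // ltnW.
Qed.
HB.instance Definition _ := GRing.ComUnitRing_isIntegral.Build Zp padic_idomain.

End PadicInt.

Definition padic (p : nat) (hp : prime p) := {fraction padic_int hp}.
HB.instance Definition _ (p : nat) (hp : prime p) := GRing.Field.on (padic hp).
Definition Zp_Qp (p : nat) (hp : prime p) :
  {rmorphism padic_int hp -> padic hp} := @tofrac (padic_int hp).

Record alg_closure (k : fieldType) := AlgClosure {
  ac_field :> closedFieldType;
  ac_emb : {rmorphism k -> ac_field};
  ac_algebraic : forall x, algebraicOver ac_emb x
}.

Record gal_group (k : fieldType) (C : alg_closure k) := Galois {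
  gal_fun :> {rmorphism C -> C};
  gal_inv : {rmorphism C -> C};
  gal_funK : cancel gal_fun gal_inv;
  gal_invK : cancel gal_inv gal_fun;
  gal_fix : forall a, gal_fun (ac_emb C a) = ac_emb C a
}.

Section GaloisGroup.
Variables (k : fieldType) (C : alg_closure k).
Implicit Types s t : gal_group C.

Definition gal_one : gal_group C :=
  @Galois k C idfun idfun (fun=> erefl) (fun=> erefl) (fun=> erefl).

Fact gal_mul_fix s t a : (s \o t) (ac_emb C a) = ac_emb C a.
Proof. by rewrite /= !gal_fix. Qed.

Definition gal_mul s t : gal_group C :=
  @Galois k C (s \o t) (gal_inv t \o gal_inv s)
    (can_comp (gal_funK s) (gal_funK t)) (can_comp (gal_invK t) (gal_invK s))
    (gal_mul_fix s t).

Lemma gal_inv_fix s a : gal_inv s (ac_emb C a) = ac_emb C a.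
Proof. by rewrite -[in LHS](gal_fix s a) gal_funK. Qed.

End GaloisGroup.

Definition end_mx (K : fieldType) (V : vectType K) (f : 'End(V)) :
    'M[K]_(\dim {:V}) :=
  passmx.mxof (vbasis {:V}) (vbasis {:V}) f.

Definition semisimple_auto (K : fieldType) (V : vectType K) (f : 'End(V)) :=
  exists L : fieldExtType K,
    diagonalizable (map_mx (GRing.in_alg L) (end_mx f)).

(* Continuity for the l-adic topology on End(V) and the Krull topology on the
   Galois group, whose basic neighbourhoods of s are the sets of automorphisms
   that agree with s on a finite set. *)
Definition rep_continuous (k : fieldType) (C : alg_closure k)
    (l : nat) (hl : prime l) (V : vectType (padic hl))
    (r : gal_group C -> 'End(V)) :=
  forall (s : gal_group C) (N : nat), exists E : seq C,
  forall t : gal_group C, {in E, t =1 s} ->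
  forall i j, exists a : padic_int hl,
    end_mx (r t) i j - end_mx (r s) i j = Zp_Qp hl (l%:R ^+ N * a).

Record ladic_rep (k : fieldType) (C : alg_closure k)
    (l : nat) (hl : prime l) := LadicRep {
  rep_space :> vectType (padic hl);
  rep_act : gal_group C -> 'End(rep_space);
  rep_act1 : rep_act (gal_one C) = \1%VF;
  rep_actM : forall s t, rep_act (gal_mul s t) = (rep_act s \o rep_act t)%VF;
  rep_cont : rep_continuous rep_act
}.

Section Semisimple.
Variables (k : fieldType) (C : alg_closure k) (l : nat) (hl : prime l).
Variable V : ladic_rep C hl.

Definition stable_sub (W : {vspace V}) :=
  forall (s : gal_group C) (v : V), v \in W -> rep_act V s v \in W.

Definition irreducible_sub (W : {vspace V}) :=
  [/\ stable_sub W, W <> 0%VS &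
      forall W' : {vspace V}, stable_sub W' -> (W' <= W)%VS -> W' = 0%VS \/ W' = W].

Definition semisimple_rep :=
  exists (n : nat) (W : 'I_n -> {vspace V}),
    [/\ forall i, irreducible_sub (W i), directv (\sum_i W i)%VS &
        (\sum_i W i)%VS = fullv].

End Semisimple.

Fact algC_algebraic (x : algC) :
  algebraicOver (ratr : {rmorphism rat -> algC}) x.
Proof.
have [p [Dp pmon] _] := minCpolyP x; exists p; first exact: monic_neq0.
by rewrite -Dp root_minCpoly.
Qed.

Definition Qbar : alg_closure rat := @AlgClosure rat algC ratr algC_algebraic.

(* Every automorphism of a normal extension L of Q extends to Qbar, hence
   Gal(L/Q) is abelian if and only if the automorphisms of Qbar commute on L. *)
Definition abelian_ext (L : {pred algC}) :=
  [/\ divring_closed L, forall (s : gal_group Qbar) x, x \in L -> s x \in L &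
      forall (s t : gal_group Qbar) x, x \in L -> s (t x) = t (s x)].

Definition in_Qab : {pred algC} :=
  fun x => `[< exists2 L, abelian_ext L & x \in L >].

Lemma in_QabP x :
  reflect (forall s t : gal_group Qbar, s (t x) = t (s x)) (x \in in_Qab).
Proof.
apply: (iffP (asboolP _)) => [[L [_ _ Lab] xL] s t|xab]; first exact: Lab.
pose L : {pred algC} := fun y =>
  `[< forall s t : gal_group Qbar, s (t y) = t (s y) >].
have LP y : reflect (forall s t : gal_group Qbar, s (t y) = t (s y)) (y \in L).
  exact: asboolP.
exists L; last exact/LP.
split=> [|s y /LP yL|s t y /LP //].
  split=> [|y z /LP yL /LP zL|y z /LP yL /LP zL]; apply/LP => s t.
  - by rewrite !rmorph1.
  - by rewrite !rmorphB yL zL.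
  - by rewrite !fmorph_div yL zL.
by apply/LP => t u; rewrite (yL u s); apply: (yL (gal_mul t s) u).
Qed.

Fact in_Qab_divring : divring_closed in_Qab.
Proof.
split=> [|y z /in_QabP yL /in_QabP zL|y z /in_QabP yL /in_QabP zL].
- by apply/in_QabP => s t; rewrite !rmorph1.
- by apply/in_QabP => s t; rewrite !rmorphB yL zL.
- by apply/in_QabP => s t; rewrite !fmorph_div yL zL.
Qed.
HB.instance Definition _ :=
  GRing.isDivringClosed.Build algC in_Qab in_Qab_divring.

Record Qab := { Qab_val :> algC; Qab_valP : Qab_val \in in_Qab }.
HB.instance Definition _ := [isSub for Qab_val].
HB.instance Definition _ := [Choice of Qab by <:].
HB.instance Definition _ := [SubChoice_isSubIntegralDomain of Qab by <:].
HB.instance Definition _ := [SubIntegralDomain_isSubField of Qab by <:].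

Fact Qab_rat_subproof (q : rat) : (ratr q : algC) \in in_Qab.
Proof. by apply/in_QabP => s t; rewrite !fmorph_rat. Qed.
Definition Qab_rat q := Build_Qab (Qab_rat_subproof q).

Fact Qab_algebraic (x : algC) :
  algebraicOver (val : {rmorphism Qab -> algC}) x.
Proof.
have [p p0 px] := algC_algebraic x.
have q0 : Qab_rat 0 = 0 by apply: val_inj; rewrite /= rmorph0.
have Dp : map_poly val (map_poly Qab_rat p) = map_poly ratr p.
  by apply/polyP => i; rewrite !coef_map_id0 ?rmorph0.
exists (map_poly Qab_rat p); last by rewrite Dp.
by rewrite -(map_poly_eq0 (val : {rmorphism Qab -> algC})) Dp map_poly_eq0.
Qed.

Definition Qab_closure : alg_closure Qab :=
  @AlgClosure Qab algC val Qab_algebraic.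

Definition Qab_gal (s : gal_group Qab_closure) : gal_group Qbar :=
  @Galois rat Qbar (gal_fun s) (gal_inv s) (gal_funK s) (gal_invK s)
    (fmorph_rat (gal_fun s)).

Lemma Qab_gal1 : Qab_gal (gal_one Qab_closure) = gal_one Qbar.
Proof. by rewrite /Qab_gal /gal_one /=; congr Galois; apply: Prop_irrelevance. Qed.

Lemma Qab_galM s t : Qab_gal (gal_mul s t) = gal_mul (Qab_gal s) (Qab_gal t).
Proof. by rewrite /Qab_gal /gal_mul /=; congr Galois; apply: Prop_irrelevance. Qed.

Section RestrictQab.
Variables (l : nat) (hl : prime l) (V : ladic_rep Qbar hl).

Let act (s : gal_group Qab_closure) : 'End(V) := rep_act V (Qab_gal s).

Fact restrict_Qab_act1 : act (gal_one Qab_closure) = \1%VF.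
Proof. by rewrite /act Qab_gal1 rep_act1. Qed.

Fact restrict_Qab_actM s t : act (gal_mul s t) = (act s \o act t)%VF.
Proof. by rewrite /act Qab_galM rep_actM. Qed.

Fact restrict_Qab_cont : rep_continuous act.
Proof.
move=> s N; have [E EP] := rep_cont V (Qab_gal s) N.
by exists E => t st; apply: EP.
Qed.

Definition restrict_Qab : ladic_rep Qab_closure hl :=
  LadicRep restrict_Qab_act1 restrict_Qab_actM restrict_Qab_cont.

End RestrictQab.

Section Frobenius.
Variables (p : nat) (hp : prime p) (O : alg_closure (padic hp)).

Definition Zp_emb (a : padic_int hp) : O := ac_emb O (Zp_Qp hp a).

(* The valuation ring of O is the integral closure of Z_p. *)
Definition val_int (x : O) := integralOver Zp_emb x.

Definition val_unit (x : O) := [/\ x != 0, val_int x & val_int x^-1].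

(* Q_p(x) is unramified over Q_p: p is still a uniformizer of Q_p(x) (the
   residue field extension is automatically separable). *)
Definition unramified_elt (x : O) :=
  forall P : {poly padic hp}, let y := (map_poly (ac_emb O) P).[x] in
    y != 0 -> exists m : int, val_unit (y * p%:R ^ m).

(* The Frobenius of the maximal unramified extension of Q_p is the automorphism
   that induces x |-> x^p on the residue field. *)
Definition lifts_frobenius (s : gal_group O) :=
  forall x : O, unramified_elt x -> val_int x ->
    exists2 y : O, val_int y & s x - x ^+ p = p%:R * y.

Definition in_inertia (s : gal_group O) := forall x : O, unramified_elt x -> s x = x.

End Frobenius.

(* s : Gal(Qbar/Q) is the image of some element of Gal(Qbar_p/Q_p) satisfying P
   under the inclusion induced by some embedding of Qbar into some algebraic
   closure Qbar_p of Q_p. *)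
Definition from_local (p : nat) (hp : prime p)
    (P : forall O : alg_closure (padic hp), gal_group O -> Prop)
    (s : gal_group Qbar) :=
  exists (O : alg_closure (padic hp)) (j : {rmorphism algC -> O}) (t : gal_group O),
    P O t /\ forall x : algC, j (s x) = t (j x).

Definition frobenius_at (p : nat) (hp : prime p) (s : gal_group Qbar) :=
  from_local (@lifts_frobenius p hp) s.

Definition inertia_at (p : nat) (hp : prime p) (s : gal_group Qbar) :=
  from_local (@in_inertia p hp) s.

Definition unramified_at (p : nat) (hp : prime p) (l : nat) (hl : prime l)
    (V : ladic_rep Qbar hl) :=
  forall s, inertia_at hp s -> rep_act V s = \1%VF.

Definition semisimple_at (p : nat) (hp : prime p) (l : nat) (hl : prime l)
    (V : ladic_rep Qbar hl) :=
  exists2 s, frobenius_at hp s & semisimple_auto (rep_act V s).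

(* Projective schemes by their functors of points. For a ring A, the set P^n(A)
   is the set of direct summands of rank 1 of A^(n+1); such a summand is given
   as the image of an idempotent matrix e acting on column vectors, and two
   idempotents give the same point if they have the same image. *)
Definition proj_point (n : nat) (A : comPzRingType) (e : 'M[A]_n.+1) :=
  e *m e = e /\
  forall (K : fieldType) (g : {rmorphism A -> K}), \rank (map_mx g e) = 1%N.

Definition same_point (n : nat) (A : comPzRingType) (e e' : 'M[A]_n.+1) :=
  e *m e' = e' /\ e' *m e = e.

Definition mpoly_eval (k : fieldType) (A : comPzRingType) (i : k -> A) (n : nat)
    (f : {mpoly k[n]}) (v : 'cV[A]_n) : A :=
  \sum_(m <- msupp f) i f@_m * \prod_(j < n) v j 0 ^+ m j.

Record proj_scheme (k : fieldType) := ProjScheme {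
  ps_dim : nat;
  ps_eqs : seq {mpoly k[ps_dim.+1]};
  ps_homog : forall f, f \in ps_eqs -> exists d : nat, f \is d.-homog
}.

(* A subfunctor of P^n on k-algebras; i is the structure map of A. *)
Definition subproj (k : fieldType) (n : nat) :=
  forall (A : comPzRingType) (i : k -> A), 'M[A]_n.+1 -> Prop.

Definition ps_points (k : fieldType) (X : proj_scheme k) : subproj k (ps_dim X) :=
  fun A i e => proj_point e /\
    forall f, f \in ps_eqs X -> forall w : 'cV[A]_((ps_dim X).+1),
      mpoly_eval i f (e *m w) = 0.

Arguments ps_points {k} X A i e.

Definition sqzero_thickening (B B0 : comPzRingType) (q : {rmorphism B -> B0}) :=
  (forall y, exists x, q x = y) /\
  (forall x y, q x = 0 -> q y = 0 -> x * y = 0).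

(* X is of finite presentation, hence smooth if and only if it is formally
   smooth. *)
Definition ps_smooth (k : fieldType) (X : proj_scheme k) :=
  forall (B B0 : comPzRingType) (i : {rmorphism k -> B})
         (q : {rmorphism B -> B0}), sqzero_thickening q ->
  forall e0 : 'M[B0]_((ps_dim X).+1), ps_points X B0 (q \o i) e0 ->
  exists2 e : 'M[B]_((ps_dim X).+1),
    ps_points X B i e & same_point (map_mx q e) e0.

Definition geometric_fibre (k : fieldType) (C : alg_closure k)
    (X : proj_scheme k) : subproj C (ps_dim X) :=
  fun A i e => ps_points X A (i \o ac_emb C) e.

Arguments geometric_fibre {k} C X A i e.

(* The site of affine schemes Spec A etale over a scheme Y of finite type over a
   field K, with the etale topology. *)
Section EtaleSite.
Variables (K : fieldType) (n : nat) (Y : subproj K n).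

Definition finite_type (A : comPzRingType) (i : K -> A) :=
  exists (m : nat) (g : 'I_m -> A), forall P : A -> Prop,
    (forall c, P (i c)) -> (forall j, P (g j)) ->
    (forall a b, P a -> P b -> P (a + b)) ->
    (forall a b, P a -> P b -> P (a * b)) ->
    forall a, P a.

Definition formally_etale (A : comPzRingType) (i : K -> A) (e : 'M[A]_n.+1) :=
  forall (B B0 : comPzRingType) (c : {rmorphism K -> B})
         (q : {rmorphism B -> B0}), sqzero_thickening q ->
  forall b : 'M[B]_n.+1, Y c b ->
  forall f0 : {rmorphism A -> B0},
    f0 \o i =1 q \o c -> same_point (map_mx f0 e) (map_mx q b) ->
  let lift (f : {rmorphism A -> B}) :=
    [/\ f \o i =1 c, q \o f =1 f0 & same_point (map_mx f e) b] in
  exists2 f, lift f & forall f', lift f' -> f' =1 f.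

Record etale := Etale {
  et_ring : comPzRingType;
  et_alg : {rmorphism K -> et_ring};
  et_pt : 'M[et_ring]_n.+1;
  et_ptP : Y et_alg et_pt;
  et_finite : finite_type et_alg;
  et_formal : formally_etale et_alg et_pt
}.

(* A morphism U -> V over Y is a map of rings in the other direction. *)
Record et_hom (U V : etale) := EtHom {
  eh_fun :> {rmorphism et_ring V -> et_ring U};
  eh_alg : eh_fun \o et_alg V =1 et_alg U;
  eh_pt : same_point (map_mx eh_fun (et_pt V)) (et_pt U)
}.

Record et_cover (U : etale) := Cover {
  cov_idx : Type;
  cov_obj : cov_idx -> etale;
  cov_hom : forall j, et_hom (cov_obj j) U;
  cov_surj : forall (L : fieldType) (x : {rmorphism et_ring U -> L}),
    exists (j : cov_idx) (L' : fieldType) (h : {rmorphism L -> L'})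
           (y : {rmorphism et_ring (cov_obj j) -> L'}),
      y \o cov_hom j =1 h \o x
}.

Arguments cov_obj {U} _ j.
Arguments cov_hom {U} _ j.

Record sheaf := Sheaf {
  sec :> etale -> zmodType;
  res : forall U V, et_hom U V -> {additive sec V -> sec U};
  res_id : forall U (f : et_hom U U), f =1 id -> res f =1 id;
  res_comp : forall U V W (f : et_hom U V) (g : et_hom V W) (h : et_hom U W),
    h =1 f \o g -> res h =1 res f \o res g;
  sheaf_glue : forall U (c : et_cover U) (s : forall j, sec (cov_obj c j)),
    (forall i j W (f : et_hom W (cov_obj c i)) (g : et_hom W (cov_obj c j)),
       f \o cov_hom c i =1 g \o cov_hom c j -> res f (s i) = res g (s j)) ->
    exists! t : sec U, forall j, res (cov_hom c j) t = s j
}.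

Record sheaf_hom (F G : sheaf) := SheafHom {
  sh_fun :> forall U, {additive F U -> G U};
  sh_nat : forall U V (f : et_hom U V) (s : F V),
    sh_fun U (res F f s) = res G f (sh_fun V s)
}.

Definition injective_sheaf (I : sheaf) :=
  forall (F G : sheaf) (m : sheaf_hom F G) (f : sheaf_hom F I),
    (forall U, injective (m U)) ->
    exists g : sheaf_hom G I, forall U s, g U (m U s) = f U s.

(* The limit over the site of affines computes the sections over Y, which need
   not itself be affine. *)
Definition global_section (F : sheaf) (z : forall U, F U) :=
  forall U V (f : et_hom U V), res F f (z V) = z U.

(* An injective resolution of the constant sheaf Z/N. The augmentation is given
   by the image cr_one of the section 1 of Z/N; since Z/N is the sheaf
   associated with a constant presheaf and exactness is a local property, the
   conditions below express exactness of 0 -> Z/N -> I^0 -> I^1 -> ... *)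
Record const_resolution (N : nat) := ConstResolution {
  cr_obj : nat -> sheaf;
  cr_diff : forall j, sheaf_hom (cr_obj j) (cr_obj j.+1);
  cr_one : forall U, cr_obj 0 U;
  cr_inj : forall j, injective_sheaf (cr_obj j);
  cr_diff2 : forall j U (s : cr_obj j U), cr_diff j.+1 U (cr_diff j U s) = 0;
  cr_one_global : global_section cr_one;
  cr_one_closed : forall U, cr_diff 0 U (cr_one U) = 0;
  cr_one_tors : forall U, cr_one U *+ N = 0;
  cr_one_mono : forall U a, (1 : et_ring U) <> 0 -> cr_one U *+ a = 0 ->
    (N %| a)%N;
  cr_exact0 : forall U (s : cr_obj 0 U), cr_diff 0 U s = 0 ->
    exists c : et_cover U, forall j, exists a : nat,
      res (cr_obj 0) (cov_hom c j) s = cr_one (cov_obj c j) *+ a;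
  cr_exact : forall i U (s : cr_obj i.+1 U), cr_diff i.+1 U s = 0 ->
    exists c : et_cover U, forall j, exists t,
      res (cr_obj i.+1) (cov_hom c j) s = cr_diff i (cov_obj c j) t
}.

Section Cohomology.
Variables (N : nat) (I : const_resolution N) (i : nat).

Definition cochain (j : nat) := forall U, cr_obj I j U.

Definition cocycle (z : cochain i) :=
  global_section z /\ forall U, cr_diff I i U (z U) = 0.

Definition coboundary : cochain i -> Prop :=
  match i with
  | 0 => fun z => forall U, z U = 0
  | j.+1 => fun z => exists2 y : cochain j,
      global_section y & forall U, z U = cr_diff I j U (y U)
  end.

End Cohomology.

End EtaleSite.

Section LadicCohomology.
Variables (k : fieldType) (C : alg_closure k) (X : proj_scheme k).
Local Notation Xbar := (geometric_fibre C X).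
Local Notation et := (etale Xbar).
Implicit Types s : gal_group C.

Section Twist.
Variables (s : gal_group C) (U : et).

Fact twist_emb (A : comPzRingType) (i : C -> A) :
  (i \o gal_inv s) \o ac_emb C = i \o ac_emb C.
Proof. by apply: funext => a /=; rewrite gal_inv_fix. Qed.

Fact untwist_emb (A : comPzRingType) (i : C -> A) :
  (i \o s) \o ac_emb C = i \o ac_emb C.
Proof. by apply: funext => a /=; rewrite gal_fix. Qed.

Fact twist_ptP : Xbar (et_ring U) (et_alg U \o gal_inv s) (et_pt U).
Proof. by rewrite /geometric_fibre twist_emb; exact: (et_ptP U). Qed.

Fact twist_finite : finite_type (et_alg U \o gal_inv s).
Proof.
have [m [g gP]] := et_finite U; exists m, g => P Pc; apply: gP => c.
by have := Pc (s c); rewrite /= gal_funK.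
Qed.

Fact twist_formal : formally_etale Xbar (et_alg U \o gal_inv s) (et_pt U).
Proof.
move=> B B0 c q qthick b Yb f0 f0c f0b /=.
have Yb' : Xbar B (c \o s) b by rewrite /geometric_fibre untwist_emb.
have f0c' : f0 \o et_alg U =1 q \o (c \o s).
  by move=> a; have := f0c (s a); rewrite /= gal_funK.
have [f [fc qf fb] f_uniq] := et_formal (c := c \o s) qthick Yb' f0c' f0b.
exists f.
  by split=> // a; have := fc (gal_inv s a); rewrite /= gal_invK.
move=> f' [fc' qf' fb']; apply: f_uniq; split=> // a.
by have := fc' (s a); rewrite /= gal_funK.
Qed.

(* The inverse image of U under the automorphism id x Spec(s) of X x Spec(C): same
   scheme as U, same map to X, structure map to Spec(C) twisted by s. *)
Definition twist : et := Etale twist_ptP twist_finite twist_formal.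

End Twist.

Variable l : nat.

(* Injective resolutions I_m of Z/l^m, with maps I_(m+1) -> I_m that extend the
   reductions Z/l^(m+1) -> Z/l^m, and, for every s in the Galois group, maps
   I_m -> g_* I_m with g := id x Spec(s) that extend the canonical map
   Z/l^m -> g_* Z/l^m. *)
Record ladic_system := LadicSystem {
  ls_res : forall m, const_resolution Xbar (l ^ m);
  ls_red : forall m j, sheaf_hom (cr_obj (ls_res m.+1) j) (cr_obj (ls_res m) j);
  ls_gal : forall s m j U,
    {additive cr_obj (ls_res m) j U -> cr_obj (ls_res m) j (twist s U)};
  ls_red_diff : forall m j U z,
    cr_diff (ls_res m) j U (ls_red m j U z)
      = ls_red m j.+1 U (cr_diff (ls_res m.+1) j U z);
  ls_red_one : forall m U,
    ls_red m 0 U (cr_one (ls_res m.+1) U) = cr_one (ls_res m) U;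
  ls_gal_nat : forall s m j U V (f : et_hom U V)
      (f' : et_hom (twist s U) (twist s V)), eh_fun f =1 eh_fun f' ->
    forall z, ls_gal s m j U (res (cr_obj (ls_res m) j) f z)
                = res (cr_obj (ls_res m) j) f' (ls_gal s m j V z);
  ls_gal_diff : forall s m j U z,
    cr_diff (ls_res m) j (twist s U) (ls_gal s m j U z)
      = ls_gal s m j.+1 U (cr_diff (ls_res m) j U z);
  ls_gal_one : forall s m U,
    ls_gal s m 0 U (cr_one (ls_res m) U) = cr_one (ls_res m) (twist s U)
}.

Section InverseLimit.
Variables (L : ladic_system) (i : nat).

Definition ladic_cochain := forall m, cochain (ls_res L m) i.

(* z represents an element of the inverse limit of the H^i(Xbar, Z/l^m). *)
Definition ladic_cocycle (z : ladic_cochain) :=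
  (forall m, cocycle (z m)) /\
  (forall m, coboundary (I := ls_res L m) (i := i)
     (fun U => ls_red L m i U (z m.+1 U) - z m U)).

Definition ladic_gal (s : gal_group C) (z z' : ladic_cochain) :=
  forall m U, z' m (twist s U) = ls_gal L s m i U (z m U).

End InverseLimit.

(* V is H^i(Xbar, Q_l) = (lim_m H^i(Xbar, Z/l^m)) (x)_(Z_l) Q_l: the map psi is
   the localization map, from the inverse limit to the tensor product. *)
Definition is_etale_cohomology (hl : prime l) (i : nat) (V : ladic_rep C hl) :=
  exists (L : ladic_system) (psi : ladic_cochain L i -> V),
  [/\ forall z z', ladic_cocycle z -> ladic_cocycle z' ->
        psi (fun m U => z m U + z' m U) = psi z + psi z',
      forall (a : padic_int hl) z, ladic_cocycle z ->
        psi (fun m U => z m U *+ a m) = Zp_Qp hl a *: psi z,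
      forall z, ladic_cocycle z ->
        (psi z = 0 <->
         exists N, forall m, coboundary (I := ls_res L m) (i := i)
                               (fun U => z m U *+ l ^ N)),
      forall v : V, exists (N : nat) (z : ladic_cochain L i),
        ladic_cocycle z /\ l%:R ^+ N *: v = psi z &
      forall s z z', ladic_cocycle z -> ladic_cocycle z' ->
        ladic_gal s z z' -> psi z' = rep_act V s (psi z)].

End LadicCohomology.

Section Geometry.
Variables (k : fieldType) (C : alg_closure k) (l : nat) (hl : prime l).
Implicit Types V W : ladic_rep C hl.

Definition equivariant V W (f : {linear V -> W}) :=
  forall s v, f (rep_act V s v) = rep_act W s (f v).

Definition is_direct_sum V1 V2 W :=
  exists (f1 : {linear V1 -> W}) (f2 : {linear V2 -> W}),
    [/\ equivariant f1, equivariant f2 &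
        bijective (fun v : V1 * V2 => f1 v.1 + f2 v.2)].

Definition bilinear_map (E1 E2 E : lmodType (padic hl)) (b : E1 -> E2 -> E) :=
  (forall x, linear (b x)) /\ (forall y, linear (b^~ y)).

Definition is_tensor V1 V2 W :=
  exists b : V1 -> V2 -> W,
    [/\ bilinear_map b,
        forall s x y, b (rep_act V1 s x) (rep_act V2 s y) = rep_act W s (b x y) &
        forall (E : vectType (padic hl)) (c : V1 -> V2 -> E), bilinear_map c ->
          exists! f : 'Hom(W, E), forall x y, c x y = f (b x y)].

Definition is_dual V W :=
  exists d : {linear W -> 'Hom(V, (padic hl)^o)},
    bijective d /\
    forall s v w, d (rep_act W s w) (rep_act V s v) = d w v.

(* V is an object of C(k, l). Equivariant bijections are instances of FG_sub, so
   the class is closed under isomorphism and each construction only has to be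
   given up to isomorphism. *)
Inductive from_geometry : ladic_rep C hl -> Prop :=
| FG_cohomology (X : proj_scheme k) i V :
    ps_smooth X -> is_etale_cohomology X i V -> from_geometry V
| FG_unit V :
    \dim {:V} = 1%N -> (forall s, rep_act V s = \1%VF) -> from_geometry V
| FG_sum V1 V2 W :
    from_geometry V1 -> from_geometry V2 -> is_direct_sum V1 V2 W ->
    from_geometry W
| FG_tensor V1 V2 W :
    from_geometry V1 -> from_geometry V2 -> is_tensor V1 V2 W ->
    from_geometry W
| FG_dual V W : from_geometry V -> is_dual V W -> from_geometry W
| FG_sub V W (f : {linear W -> V}) :
    from_geometry V -> equivariant f -> injective f -> from_geometry W
| FG_quotient V W (f : {linear V -> W}) :
    from_geometry V -> equivariant f -> (forall w, exists v, f v = w) ->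
    from_geometry W.

End Geometry.

Definition S_statement (k : fieldType) (C : alg_closure k) :=
  forall (l : nat) (hl : prime l), l \notin [pchar k] ->
  forall V : ladic_rep C hl, from_geometry V -> semisimple_rep V.

(* Main.v *)
(* A subrepresentation W of rho has a complement that is stable under the
   Galois group of Q^ab. The projections onto W with Q^ab-stable kernel are
   permuted by the abelian group Gal(Q^ab/Q), and an obstruction to a fixed one
   yields an endomorphism u such that s |-> s u s^-1 - u is additive in s. Its
   coefficients are continuous homomorphisms c : Gal(Qbar/Q) -> Q_l, and
   semi-simplicity of rho(F) forces c(F) = 0. By the Kronecker-Weber theorem all continuous
   homomorphisms to Z_l are proportional to the logarithm of the l-adic
   cyclotomic character, which does not vanish at F because F acts on roots of
   unity of order prime to p by x |-> x^p; hence c = 0, and W has a complement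
   that is stable under the whole Galois group.

   The case of the Kronecker-Weber theorem needed here, that a Z_l-extension of
   Q has its first layer in Q(zeta_(l^2)) (or in Q(sqrt 2) for l = 2), follows
   from Kummer theory: the Kummer generator of the first layer is an eigenvector
   of Gal(Q(zeta_l)/Q) whose valuations away from l are divisible by l, because
   it extends to arbitrarily high layers; Stickelberger's relation (through
   Jacobi sums) turns it into a unit modulo l-th powers, hence, by Kronecker's
   theorem on algebraic integers of absolute value 1, into a root of unity. *)
From HB Require Import structures.
From mathcomp Require Import all_boot all_order all_algebra all_field.
From mathcomp Require Import cyclic ring zify boolp.
From mathcomp Require Import mpoly.
Require Import Defs.

Set Implicit Arguments.
Unset Strict Implicit.
Unset Printing Implicit Defensive.
Import Order.TTheory GRing.Theory Num.Theory.
Local Open Scope ring_scope.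

(** The group Gal(Q^ab/Q) is infinite and its commuting operators need not be diagonalizable, so a
    fixed projection is not found by averaging. What is used instead is an invariant functional, the
    scalar by which an endomorphism acts on W: on a stable space minimal among those where it is
    nonzero, the group acts unipotently, and the first step above the fixed vectors gives the
    additive characters.

    Ideal classes of Q(zeta_l) never enter: Jacobi sums are explicit elements with known valuations,
    so Stickelberger's relation produces l-th powers of elements. The operators 1 - sigma_d for 1 <
    d < l remove the valuations at l and at the primes not congruent to 1 modulo l; they act on the
    eigenvector by 1 - d, prime to l. An average over all Jacobi sums shows that one of them gives
    an exponent prime to l. The quotient of the resulting unit by its complex conjugate is the
    square of its class, which is harmless for odd l; for l = 2, positivity and the factorization of
    a rational number take the place of all this. *)

Lemma rmorph_ext (R S : nzRingType) (f g : {rmorphism R -> S}) : f =1 g -> f = g.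
Proof.
move=> /funext fg; case: f g fg => [f [[fa] [fm]]] [g [[ga] [gm]]] /= fg.
subst g; congr GRing.RMorphism.Pack; congr GRing.RMorphism.Class.
  by congr GRing.isNmodMorphism.Axioms_; apply: Prop_irrelevance.
by congr GRing.isMonoidMorphism.Axioms_; apply: Prop_irrelevance.
Qed.

(** * The Galois group as a group *)

Section GalGroup.
Variables (k : fieldType) (C : alg_closure k).
Implicit Types s t u : gal_group C.

Lemma gal_ext s t : s =1 t -> s = t.
Proof.
case: s t => [f f' fK f'K ff] [g g' gK g'K gf] /= fg.
have fg' : f' =1 g' by move=> x; rewrite -[x in LHS]g'K -fg fK.
have Ef := rmorph_ext fg; have Ef' := rmorph_ext fg'; subst g g'.
by congr Galois; apply: Prop_irrelevance.
Qed.

Definition gal_opp s : gal_group C :=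
  Galois (gal_invK s) (gal_funK s) (gal_inv_fix s).

Lemma gal_mulV s : gal_mul s (gal_opp s) = gal_one C.
Proof. by apply: gal_ext => x /=; rewrite gal_invK. Qed.

Lemma gal_mulVl s : gal_mul (gal_opp s) s = gal_one C.
Proof. by apply: gal_ext => x /=; rewrite gal_funK. Qed.

Lemma gal_mulA s t u : gal_mul s (gal_mul t u) = gal_mul (gal_mul s t) u.
Proof. exact: gal_ext. Qed.

Lemma gal_mul1 s : gal_mul s (gal_one C) = s.
Proof. exact: gal_ext. Qed.

Lemma gal_1mul s : gal_mul (gal_one C) s = s.
Proof. exact: gal_ext. Qed.

Definition gal_pow s n := iter n (gal_mul s) (gal_one C).

End GalGroup.

Definition gal_of_aut (nu : {rmorphism algC -> algC}) : gal_group Qbar :=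
  @Galois rat Qbar nu (algC_invaut nu) (algC_autK nu) (algC_invautK nu)
    (fmorph_rat nu).

(** * Galois theory and Kummer theory inside [algC] *)

Local Notation pQtoC := (map_poly (ratr : rat -> algC)).

(** Galois automorphisms of [Qn] over Q(w) extend to [algC], so [y] lies in their fixed field, which
    is Q(w) by the Galois correspondence. *)
Lemma fixed_adjoin_normal (Qn : splittingFieldType rat)
    (QnC : {rmorphism Qn -> algC}) (w y : Qn) :
  (forall nu : {rmorphism algC -> algC},
     nu (QnC w) = QnC w -> nu (QnC y) = QnC y) ->
  exists p : {poly rat}, QnC y = (pQtoC p).[QnC w].
Proof.
move=> fix_y.
have : y \in fixedField 'Gal({:Qn} / <<1; w>>)%g.
  apply/fixedFieldP; first exact: memvf.
  move=> g Gg; apply: (fmorph_inj QnC).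
  have [nu Dnu] := extend_algC_subfield_aut QnC (gal_repr g).
  rewrite Dnu fix_y // -Dnu; congr (QnC _).
  apply: (fixed_gal _ Gg); first exact: subvf.
  exact: memv_adjoin.
have /galois_fixedField -> : galois <<1; w>> {:Qn}.
  rewrite /galois subvf normalFieldf andbT /=; apply/separableP => u _.
  by apply: pcharf0_separable => c; rewrite -(fmorph_pchar QnC) pchar_num.
case/Fadjoin_polyP=> r r1 Dy.
have a_ i := sig_eqW (vlineP _ _ (polyOverP r1 i)).
exists (\poly_(i < size r) sval (a_ i)).
have -> : pQtoC (\poly_(i < size r) sval (a_ i)) = map_poly QnC r.
  apply/polyP=> i; rewrite !coef_map coef_poly /=.
  case: ltnP => [_|/(nth_default 0) ->]; last by rewrite !rmorph0.
  by case: (a_ i) => a /= ->; rewrite alg_num_field fmorph_rat.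
by rewrite horner_map -Dy.
Qed.

Lemma fixed_adjoin (z x : algC) :
  (forall nu : {rmorphism algC -> algC}, nu z = z -> nu x = x) ->
  exists p : {poly rat}, x = (pQtoC p).[z].
Proof.
move=> fix_x.
have [p [Dp p_mon] dv_p] := minCpolyP x.
have [q [Dq q_mon] dv_q] := minCpolyP z.
have [rs Drs] := closed_field_poly_normal (pQtoC (p * q)).
have pq_mon : pQtoC (p * q) \is monic by rewrite map_monic monicMl.
rewrite (monicP pq_mon) scale1r in Drs.
have x_rs : x \in rs.
  by rewrite -root_prod_XsubC -Drs dv_p dvdp_mulr.
have z_rs : z \in rs.
  by rewrite -root_prod_XsubC -Drs dv_q dvdp_mull.
have [Qs [QsC [s1 Ds1 genQs]]] := num_field_exists rs.
(* All roots of both minimal polynomials have been adjoined, so [Qs] is normal over Q. *)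
have splitQs : splitting_field_axiom Qs.
  exists (map_poly (in_alg Qs) (p * q)).
    by apply/polyOverP=> i; rewrite coef_map /= rpredZ // mem1v.
  exists s1; last exact: genQs.
  suff -> : map_poly (in_alg Qs) (p * q) = \prod_(z <- s1) ('X - z%:P).
    exact: eqpxx.
  apply: (map_poly_inj QsC); rewrite -map_poly_comp.
  rewrite (@eq_map_poly _ _ _ ratr) => [|a]; last first.
    by rewrite /= alg_num_field fmorph_rat.
  rewrite Drs -Ds1 big_map rmorph_prod /=.
  by apply: eq_bigr => i _; rewrite map_polyXsubC.
pose mQ := FieldExt_isSplittingField.Build rat Qs splitQs.
pose Qn : splittingFieldType rat := HB.pack (FieldExt.sort Qs) mQ.
move: x_rs z_rs fix_x; rewrite -Ds1 => /mapP[y _ ->] /mapP[w _ ->].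
exact: (@fixed_adjoin_normal Qn QsC).
Qed.

Lemma prim_root_neq0 (K : fieldType) (n : nat) (z : K) :
  n.-primitive_root z -> z != 0.
Proof.
move=> prim_z; apply: contra_eq_neq (prim_expr_order prim_z) => ->.
by rewrite expr0n gtn_eqF ?(prim_order_gt0 prim_z) // eq_sym oner_eq0.
Qed.

(* Kummer theory: the Lagrange resolvent runs over the conjugates of a
   primitive element t of a field through which f factors. *)
Lemma kummer_generator (N : nat) (z : algC) (f : gal_group Qbar -> nat)
    (E : seq algC) :
  N.-primitive_root z ->
  (forall s t, f (gal_mul s t) = f s + f t %[mod N])%N ->
  (forall s : gal_group Qbar, {in E, s =1 id} -> (f s = 0 %[mod N])%N) ->
  exists2 t : algC, t != 0 &
    forall s : gal_group Qbar, s z = z -> s t = z ^+ f s * t.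
Proof.
move=> prim_z fM fE; have [th _ [ps Dps]] := algC_PET E.
have zf s t : (f s = f t %[mod N])%N -> z ^+ f s = z ^+ f t.
  by move=> st; rewrite -(prim_expr_mod prim_z) st prim_expr_mod.
have z0 := prim_root_neq0 prim_z.
(* These are the conjugates of [th] over Q(z). [T x] chooses an automorphism over Q(z) that sends
   [th] to [x]; by [fT] the choice does not affect the power of [z]. *)
pose good x := exists s : gal_group Qbar, s z = z /\ s th = x.
pose T x := if pselect (good x) is left e then sval (cid e) else gal_one Qbar.
have TP x : good x -> T x z = z /\ T x th = x.
  by move=> gx; rewrite /T; case: pselect => // e; case: (cid e).
have fT (s t : gal_group Qbar) : s th = t th -> z ^+ f s = z ^+ f t.
  move=> st; apply: zf.
  have -> : s = gal_mul t (gal_mul (gal_opp t) s).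
    by rewrite gal_mulA gal_mulV gal_1mul.
  rewrite fM -modnDmr fE ?modnDmr ?mod0n ?addn0 // => x.
  rewrite Dps => /mapP[p _ ->]; rewrite /= -!horner_map /= st gal_funK.
  rewrite -!map_poly_comp; congr (_.[_]).
  by apply: eq_map_poly => a; rewrite /= !fmorph_rat.
have [rs Drs] := closed_field_poly_normal (minCpoly th).
rewrite (monicP (minCpoly_monic th)) scale1r in Drs.
pose O := undup [seq x <- rs | `[< good x >]].
have OP x : reflect (good x) (x \in O).
  rewrite mem_undup mem_filter; apply: (iffP andP) => [[/asboolP] //|gx].
  split; first exact/asboolP.
  have [_ <-] := TP x gx; rewrite -root_prod_XsubC -Drs.
  by rewrite -(minCpoly_aut (T x)) root_minCpoly.
pose c x := (z ^+ f (T x))^-1.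
pose R k := \sum_(x <- O) c x * x ^+ k.
have sR (s : gal_group Qbar) k : s z = z -> s (R k) = z ^+ f s * R k.
  move=> sz; have sO : perm_eq (map s O) O.
    have Us : uniq (map s O) by rewrite map_inj_uniq ?undup_uniq //; exact: fmorph_inj.
    apply: uniq_perm; rewrite ?undup_uniq //.
    suff sub : {subset map s O <= O}.
      by have [|_ eqO] := uniq_min_size Us sub; rewrite ?size_map.
    move=> _ /mapP[x /OP gx ->]; apply/OP; have [Tz Tth] := TP x gx.
    by exists (gal_mul s (T x)); rewrite /= Tz Tth.
  rewrite rmorph_sum /= /R -[in RHS](perm_big _ sO) big_map big_distrr /=.
  apply: eq_big_seq => x xO; rewrite rmorphM rmorphXn mulrA; congr (_ * _).
  have /TP[Tz Tth] : good x by apply/OP.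
  have /TP[Tz' Tth'] : good (s x).
    by apply/OP; rewrite -(perm_mem sO) map_f.
  rewrite /c fmorphV rmorphXn /= sz.
  have <- : z ^+ f (gal_mul s (T x)) = z ^+ f (T (s x)).
    by apply: fT; rewrite /= Tth Tth'.
  rewrite -(prim_expr_mod prim_z (f (gal_mul _ _))) fM prim_expr_mod // exprD.
  by rewrite invfM mulrA divff ?mul1r // expf_neq0.
(* If all resolvents vanished, so would every sum weighted by P(x); a polynomial P vanishing at all
   conjugates except [th] isolates one nonzero term. *)
have [k Rk] : exists k, R k != 0.
  apply: contrapT => R0.
  have {}R0 k : R k = 0.
    by apply/eqP; apply: contrapT => /negP Rk; apply: R0; exists k.
  have RP (P : {poly algC}) : \sum_(x <- O) c x * P.[x] = 0.
    transitivity (\sum_(i < size P) P`_i * R i).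
      rewrite /R; under [RHS]eq_bigr do rewrite big_distrr /=.
      rewrite exchange_big /=; apply: eq_bigr => x _.
      rewrite horner_coef big_distrr; apply: eq_bigr => i _ /=.
      by rewrite mulrCA.
    by rewrite big1 // => i _; rewrite R0 mulr0.
  have thO : th \in O by apply/OP; exists (gal_one Qbar).
  pose P := \prod_(y <- rem th O) ('X - y%:P).
  have := RP P; rewrite (big_rem th) //= big1_seq ?addr0 => [|x /andP[_ xO]]; last first.
    by rewrite (rootP _) ?mulr0 // root_prod_XsubC.
  move/eqP; rewrite mulf_eq0 invr_eq0 expf_eq0 (negPf z0) andbF /=.
  apply/negP; rewrite -/(root _ _) root_prod_XsubC.
  by rewrite mem_rem_uniqF ?undup_uniq.
by exists (R k) => // s; apply: sR.
Qed.

(** * Evaluation of integer polynomials, and the field Q(z) *)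

Definition ev (R : comNzRingType) (x : R) : {poly int} -> R :=
  horner_eval x \o map_poly intr.
HB.instance Definition _ (R : comNzRingType) (x : R) :=
  GRing.RMorphism.copy (ev x) (horner_eval x \o map_poly intr).

Section Evaluation.
Variables (R : comNzRingType) (x : R).

Lemma evX : ev x 'X = x.
Proof. by rewrite /ev /= map_polyX /horner_eval hornerX. Qed.

Lemma evC c : ev x c%:P = c%:~R.
Proof. by rewrite /ev /= map_polyC /horner_eval hornerC. Qed.

Lemma ev_comp p q : ev x (p \Po q) = ev (ev x q) p.
Proof. by rewrite /ev /= /horner_eval map_comp_poly horner_comp. Qed.

Lemma ev_compXn p n : ev x (p \Po 'X^n) = ev (x ^+ n) p.
Proof. by rewrite ev_comp rmorphXn /= evX. Qed.

Lemma ev_rmorph (S : comNzRingType) (f : {rmorphism R -> S}) p :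
  f (ev x p) = ev (f x) p.
Proof.
rewrite /ev /= /horner_eval -horner_map -map_poly_comp; congr (_.[_]).
by apply: eq_map_poly => c; rewrite /= rmorph_int.
Qed.

Lemma ev_coef p : ev x p = \sum_(i < size p) (p`_i)%:~R * x ^+ i.
Proof.
rewrite /ev /= /horner_eval (@horner_coef_wide _ (size p)) ?size_poly //.
by apply: eq_bigr => i _; rewrite coef_map.
Qed.

End Evaluation.

(** The constant coefficient of an integral multiple of the minimal polynomial is a multiple of [y]
    in Z[y]; it serves as a substitute for the norm. *)
Lemma algC_int_norm (y : algC) : y != 0 ->
  exists (g : {poly int}) (c : int), c != 0 /\ y * ev y g = c%:~R.
Proof.
move=> y0; have [p [Dp p_mon] dv_p] := minCpolyP y.
have p00 : p`_0 != 0.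
  apply/eqP => p0; have /factor_theorem[p' Dp'] : root p 0.
    by apply/rootP; rewrite horner_coef0.
  rewrite subr0 in Dp'; have p'0 : p' != 0.
    by apply: contraTneq (monic_neq0 p_mon) => p'0; rewrite Dp' p'0 mul0r eqxx.
  have : root (map_poly (ratr : rat -> algC) p') y.
    have : root (map_poly (ratr : rat -> algC) p) y by rewrite dv_p dvdpp.
    by rewrite Dp' rmorphM rootM /= map_polyX rootX (negPf y0) orbF.
  by rewrite dv_p => /(dvdp_leq p'0); rewrite Dp' size_mulX // ltnn.
have [P [a a0 DP]] := rat_poly_scale p.
have Py : ev y P = 0.
  have : (map_poly ratr p).[y] = 0 :> algC by apply/rootP; rewrite -Dp root_minCpoly.
  rewrite DP linearZ /= hornerZ => /eqP; rewrite mulf_eq0 fmorph_eq0 invr_eq0.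
  rewrite intr_eq0 (negPf a0) /= => /eqP <-; rewrite /ev /= /horner_eval.
  rewrite -map_poly_comp; congr (_.[_]); apply: eq_map_poly => c.
  by rewrite /= rmorph_int.
exists (- drop_poly 1 P), P`_0; split.
  apply: contraNneq p00 => P0; rewrite DP coefZ coef_map P0 mulr0 //.
have /esym := poly_take_drop 1 P; move=> /(congr1 (ev y)).
rewrite Py rmorphD rmorphM rmorphXn /= evX expr1 => /esym/eqP; rewrite addrC addr_eq0.
move=> /eqP yd; rewrite rmorphN mulrN mulrC yd opprK.
suff -> : take_poly 1 P = (P`_0)%:P by rewrite evC.
by apply/polyP => i; rewrite coef_take_poly coefC; case: i.
Qed.

(** By [fixed_adjoin] this is membership of [x] in Q(z); with automorphisms, stability under the
    field operations is immediate. *)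
Definition fixF (z x : algC) :=
  forall nu : {rmorphism algC -> algC}, nu z = z -> nu x = x.

Section FixF.
Variable z : algC.
Implicit Types x y : algC.

Lemma fixF1 : fixF z 1. Proof. by move=> nu _; rewrite rmorph1. Qed.
Lemma fixF_nat n : fixF z n%:R. Proof. by move=> nu _; rewrite rmorph_nat. Qed.

Lemma fixFM x y : fixF z x -> fixF z y -> fixF z (x * y).
Proof. by move=> Fx Fy nu nuz; rewrite rmorphM Fx ?Fy. Qed.
Lemma fixFV x : fixF z x -> fixF z x^-1.
Proof. by move=> Fx nu nuz; rewrite fmorphV Fx. Qed.
Lemma fixFX x n : fixF z x -> fixF z (x ^+ n).
Proof. by move=> Fx nu nuz; rewrite rmorphXn Fx. Qed.
Lemma fixF_div x y : fixF z x -> fixF z y -> fixF z (x / y).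
Proof. by move=> Fx Fy; apply/fixFM/fixFV. Qed.
Lemma fixFXz x (n : int) : fixF z x -> fixF z (x ^ n).
Proof. by move=> Fx nu nuz; rewrite fmorphXz Fx. Qed.
Lemma fixF_ev P : fixF z (ev z P).
Proof. by move=> nu nuz; rewrite ev_rmorph nuz. Qed.
Lemma fixF_prod (I : Type) (s : seq I) (P : pred I) (F : I -> algC) :
  (forall i, P i -> fixF z (F i)) -> fixF z (\prod_(i <- s | P i) F i).
Proof. by move=> FF; apply: big_ind => //; [exact: fixF1 | exact: fixFM]. Qed.

Lemma fixF_frac x : fixF z x ->
  exists (P : {poly int}) (N : nat), (0 < N)%N /\ x = ev z P / N%:R.
Proof.
move=> /fixed_adjoin[p ->]; have [P [a a0 ->]] := rat_poly_scale p.
exists (sgz a *: P), `|a|%N; split; first by rewrite absz_gt0.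
rewrite -[sgz a *: P]mul_polyC rmorphM /= evC linearZ /= hornerZ fmorphV rmorph_int.
have -> : (map_poly ratr (map_poly intr P)).[z] = ev z P.
  rewrite /ev /= /horner_eval -map_poly_comp; congr (_.[_]).
  by apply: eq_map_poly => c; rewrite /= rmorph_int.
rewrite mulrAC; congr (_ * _); rewrite {1}[a]intEsg intrM invfM.
congr (_ * _); have [||] := sgzP a => //; rewrite ?invr1 ?invrN1 //.
by move=> a0'; rewrite a0' eqxx in a0.
Qed.

End FixF.

Lemma fixF_aut (z x : algC) n (nu : {rmorphism algC -> algC}) :
  nu z = z ^+ n -> fixF z x -> fixF z (nu x).
Proof.
move=> nuz Fx; have [P [N [_ ->]]] := fixF_frac Fx.
rewrite fmorph_div ev_rmorph rmorph_nat nuz -ev_compXn.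
by apply: fixF_div; [exact: fixF_ev | exact: fixF_nat].
Qed.

(* A prime of Z[z] given by its residue map z |-> pl_r, together with an element
   pl_w of Z[z] that generates its localization; pl_e is the ramification
   index. *)
Record place (z : algC) := Place {
  pl_field : fieldType;
  pl_r : pl_field;
  pl_q : nat;
  pl_w : {poly int};
  pl_e : nat;
  pl_u : {poly int};
  pl_prime : prime pl_q;
  pl_char : pl_q \in [pchar pl_field];
  pl_compat : forall P, ev z P = 0 -> ev pl_r P = 0;
  pl_wr : ev pl_r pl_w = 0;
  pl_ur : ev pl_r pl_u != 0;
  pl_wq : ev z pl_w ^+ pl_e * ev z pl_u = pl_q%:R;
  pl_div : forall P, ev pl_r P = 0 -> exists Z P',
    ev pl_r Z != 0 /\ ev z Z * ev z P = ev z pl_w * ev z P'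
}.

(** * The valuation attached to a place of Z[z] *)

Section Place.
Variables (z : algC) (p : place z).
Local Notation r := (pl_r p).
Local Notation w := (ev z (pl_w p)).
Implicit Types (x y : algC) (n : int).

(** The units of the localization of Z[z] at the place. *)
Definition unitp x := exists P Q,
  [/\ ev r P != 0, ev r Q != 0 & x * ev z Q = ev z P].

Lemma pl_neq0 P : ev r P != 0 -> ev z P != 0.
Proof. by apply: contra_neq => /(@pl_compat _ p _). Qed.

Lemma pl_w_neq0 : w != 0.
Proof.
apply/eqP => w0; have := pl_wq p; rewrite w0 expr0n.
case E: (pl_e p) => [|e] /=; last first.
  by move/eqP; rewrite mul0r eq_sym pnatr_eq0 eqn0Ngt (prime_gt0 (pl_prime p)).
rewrite mul1r => uq; have /eqP := pl_ur p; apply.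
have : ev z (pl_u p - (pl_q p)%:R) = 0 by rewrite rmorphB /= rmorph_nat uq subrr.
move/(@pl_compat _ p _); rewrite rmorphB /= rmorph_nat.
by rewrite (pcharf0 (pl_char p)) subr0.
Qed.

Lemma unitp_neq0 x : unitp x -> x != 0.
Proof.
move=> [P [Q [Pr Qr xQ]]]; apply: contraTneq (pl_neq0 Pr) => x0.
by rewrite -xQ x0 mul0r eqxx.
Qed.

Lemma unitp_ev P : ev r P != 0 -> unitp (ev z P).
Proof. by move=> Pr; exists P, 1; rewrite !rmorph1 oner_eq0 mulr1. Qed.

Lemma unitp1 : unitp 1.
Proof. by rewrite -(rmorph1 (ev z)); apply: unitp_ev; rewrite rmorph1 oner_eq0. Qed.

Lemma unitpM x y : unitp x -> unitp y -> unitp (x * y).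
Proof.
move=> [P [Q [Pr Qr xQ]]] [P' [Q' [Pr' Qr' yQ]]]; exists (P * P'), (Q * Q').
by rewrite !rmorphM !mulf_neq0 //= mulrACA xQ yQ.
Qed.

Lemma unitpV x : unitp x -> unitp x^-1.
Proof.
move=> ux; have x0 := unitp_neq0 ux; case: ux => [P [Q [Pr Qr xQ]]].
by exists Q, P; split=> //; rewrite -xQ mulKf.
Qed.

Lemma unitpXz x n : unitp x -> unitp (x ^ n).
Proof.
move=> ux; have uX m : unitp (x ^+ m).
  by elim: m => [|m IH]; rewrite ?expr0 ?exprS; [exact: unitp1 | exact: unitpM].
by case: n => m; [exact: uX | apply/unitpV/uX].
Qed.

Definition isval n x := unitp (x * w ^ (- n)).

Lemma isval_neq0 n x : isval n x -> x != 0.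
Proof. by move/unitp_neq0; rewrite mulf_eq0 negb_or => /andP[]. Qed.

Lemma isvalM n m x y : isval n x -> isval m y -> isval (n + m) (x * y).
Proof.
move=> nx my; rewrite /isval opprD expfzDr ?pl_w_neq0 // mulrACA.
exact: unitpM.
Qed.

Lemma isvalV n x : isval n x -> isval (- n) x^-1.
Proof.
by move/unitpV; rewrite invfM invr_expz.
Qed.

Lemma isval0 x : isval 0 x <-> unitp x.
Proof. by rewrite /isval oppr0 expr0z mulr1. Qed.

Lemma isvalw : isval 1 w.
Proof. by rewrite /isval exprN1 divff ?pl_w_neq0 //; exact: unitp1. Qed.

Lemma isval_w_le0 n : unitp (w ^ n) -> n <= 0.
Proof.
case: n => [[|n]|n] //; rewrite -exprnP => -[P [Q [Pr Qr wQ]]].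
have /(@pl_compat _ p _) : ev z (P - pl_w p ^+ n.+1 * Q) = 0.
  by rewrite rmorphB rmorphM rmorphXn /= wQ subrr.
rewrite rmorphB rmorphM rmorphXn /= pl_wr expr0n mul0r subr0 => P0.
by rewrite P0 eqxx in Pr.
Qed.

Lemma isval_inj n m x : isval n x -> isval m x -> n = m.
Proof.
move=> nx mx; have x0 := isval_neq0 nx; have w0 := pl_w_neq0.
have key i j : isval i x -> isval j x -> i - j <= 0.
  move=> /unitpV ix jx; apply: isval_w_le0.
  have -> : w ^ (i - j) = (x * w ^ (- i))^-1 * (x * w ^ (- j)).
    by rewrite expfzDr // invfM invr_expz opprK mulrACA mulVf // mul1r.
  exact: unitpM.
apply: le_anti; apply/andP; split; rewrite -subr_le0; exact: key.
Qed.

Lemma pl_int_val (c : int) : c != 0 -> exists (a : nat) (V : {poly int}),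
  ev r V != 0 /\ c%:~R = w ^+ a * ev z V.
Proof.
move=> c0; have qp := pl_prime p.
have [m qm] := pfactor_coprime qp (etrans (absz_gt0 c) c0).
set a := logn _ _ => Dm; exists (pl_e p * a)%N.
exists ((sgz c * m%:Z)%:P * pl_u p ^+ a); split.
  rewrite rmorphM rmorphXn /= evC mulf_neq0 ?expf_neq0 ?pl_ur // intrM.
  rewrite mulf_neq0 //.
    by case: sgzP c0 => //; rewrite ?rmorphN ?rmorph1 ?oppr_eq0 oner_eq0.
  rewrite -[m%:~R]/(m%:R : pl_field p) -(dvdn_pcharf (pl_char p)).
  by rewrite -prime_coprime.
rewrite rmorphM rmorphXn /= evC mulrCA exprM -exprMn pl_wq -natrX.
by rewrite -[(_ ^ a)%:R]/((Posz (pl_q p ^ a))%:~R) -intrM -mulrA -PoszM -Dm -intEsg.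
Qed.

(** [ev z P] divides a nonzero integer in Z[z], which is [w ^+ a] times a unit at the place; hence
    at most [a] divisions by the uniformizer are possible. *)
Lemma isval_ev P : ev z P != 0 -> exists n : nat, isval n (ev z P).
Proof.
move=> P0; have [g [c [c0 Dc]]] := algC_int_norm P0.
have [a [V [Vr DV]]] := pl_int_val c0.
have step j : (exists n : nat, isval n (ev z P)) \/
    (exists Z P', ev r Z != 0 /\ ev z Z * ev z P = w ^+ j * ev z P').
  elim: j => [|j [IH|[Z [P' [Zr DZ]]]]]; [right|by left|].
    by exists 1, P; rewrite !rmorph1 oner_eq0 !mul1r.
  have [Pr|Pr] := eqVneq (ev r P') 0; last first.
    left; exists j; exists P', Z; split=> //.
    rewrite mulrAC [_ * ev z Z]mulrC DZ mulrC mulrA exprnP -expfzDr ?pl_w_neq0 //.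
    by rewrite addNr expr0z mul1r.
  have [Z' [P'' [Zr' DZ']]] := pl_div Pr; right; exists (Z' * Z), P''.
  rewrite !rmorphM mulf_neq0 //=; split=> //.
  by rewrite -mulrA DZ mulrCA DZ' mulrA -exprSr.
have [//|[Z [P' [Zr DZ]]]] := step a.+1.
have : ev z (Z * V - pl_w p * P' * (g \Po P)) = 0.
  rewrite rmorphB !rmorphM /= ev_comp; apply: (mulfI (expf_neq0 a pl_w_neq0)).
  by rewrite mulr0 mulrBr [X in X - _]mulrCA -DV -Dc mulrA DZ exprSr !mulrA subrr.
move/(@pl_compat _ p _); rewrite rmorphB !rmorphM /= pl_wr !mul0r subr0.
by move/eqP; rewrite mulf_eq0 (negPf Zr) (negPf Vr).
Qed.

Lemma isval_exists x : fixF z x -> x != 0 -> exists n, isval n x.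
Proof.
move=> /fixF_frac[P [N [N0 ->]]].
have N0' : ev z (N%:R) != 0 by rewrite rmorph_nat pnatr_eq0 -lt0n.
rewrite mulf_eq0 negb_or => /andP[/isval_ev[n nP] _].
have [m mN] := isval_ev N0'; exists (n%:Z - m%:Z).
by apply: isvalM nP _; rewrite rmorph_nat in mN; apply: isvalV.
Qed.

Definition pval x : int :=
  if pselect (exists n, isval n x) is left e then sval (cid e) else 0.

Lemma pvalE n x : isval n x -> pval x = n.
Proof.
move=> nx; rewrite /pval; case: pselect => [e|]; last by case; exists n.
by case: (cid e) => m /= mx; apply: isval_inj mx nx.
Qed.

Lemma pvalP x : fixF z x -> x != 0 -> isval (pval x) x.
Proof. by move=> Fx /(isval_exists Fx)[n nx]; rewrite (pvalE nx). Qed.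

Lemma pvalM x y : fixF z x -> fixF z y -> x != 0 -> y != 0 ->
  pval (x * y) = pval x + pval y.
Proof. by move=> Fx Fy x0 y0; apply/pvalE/isvalM; apply: pvalP. Qed.

Lemma pvalV x : fixF z x -> x != 0 -> pval x^-1 = - pval x.
Proof. by move=> Fx x0; apply/pvalE/isvalV/pvalP. Qed.

Lemma pval_unit x : unitp x -> pval x = 0.
Proof. by move=> ux; apply/pvalE/isval0. Qed.

Lemma pval1 : pval 1 = 0. Proof. exact/pval_unit/unitp1. Qed.

Lemma pvalX x (n : nat) : fixF z x -> x != 0 -> pval (x ^+ n) = pval x *+ n.
Proof.
move=> Fx x0; elim: n => [|n IH]; first by rewrite expr0 pval1.
by rewrite exprS pvalM ?expf_neq0 ?IH ?mulrS //; exact: fixFX.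
Qed.

Lemma pvalXz x n : fixF z x -> x != 0 -> pval (x ^ n) = pval x *~ n.
Proof.
move=> Fx x0; case: n => n; first exact: pvalX.
by rewrite NegzE -exprnN pvalV ?pvalX ?expf_neq0 //; exact: fixFX.
Qed.

Lemma pval_prod (I : Type) (s : seq I) (Q : pred I) (F : I -> algC) :
  (forall i, Q i -> fixF z (F i)) -> (forall i, Q i -> F i != 0) ->
  pval (\prod_(i <- s | Q i) F i) = \sum_(i <- s | Q i) pval (F i).
Proof.
move=> FF F0; elim: s => [|i s IH]; first by rewrite !big_nil pval1.
rewrite !big_cons; case: ifP => // Qi; rewrite pvalM ?IH //.
- exact: FF.
- exact: fixF_prod.
- exact: F0.
apply: (big_ind (fun x : algC => x != 0)) => //; first exact: oner_neq0.
exact: mulf_neq0.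
Qed.

Lemma pval_ev_ge0 P : ev z P != 0 -> 0 <= pval (ev z P).
Proof. by move/isval_ev => [n /pvalE->]. Qed.

Lemma pval_ev_gt0 P : ev z P != 0 -> (0 < pval (ev z P)) = (ev r P == 0).
Proof.
move=> P0; have [Pr|Pr] := eqVneq (ev r P) 0; last first.
  by rewrite pval_unit //; exact: unitp_ev.
have := pvalP (fixF_ev P) P0; rewrite lt_def pval_ev_ge0 // andbT.
move=> H; apply/eqP => v0; move: H; rewrite v0 => /isval0[P' [Q [Pr' Qr]]].
move=> DP; have /(@pl_compat _ p _) : ev z (P * Q - P') = 0.
  by rewrite rmorphB rmorphM /= DP subrr.
rewrite rmorphB rmorphM /= Pr mul0r sub0r => /eqP.
by rewrite oppr_eq0 (negPf Pr').
Qed.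

End Place.

(** Every nonzero element of Q(z) is a unit times a power of the uniformizer, so it is enough that
    [nu] respects units, which is read off on residues, and sends the uniformizer to a
    uniformizer. *)
Lemma pval_transfer (z z' : algC) (p : place z) (p' : place z')
    (nu : {rmorphism algC -> algC}) (a : nat) (x : algC) :
  nu z = z' ^+ a ->
  (forall P, ev (pl_r p) P != 0 -> ev (pl_r p' ^+ a) P != 0) ->
  isval p' 1 (nu (ev z (pl_w p))) ->
  fixF z x -> x != 0 -> pval p' (nu x) = pval p x.
Proof.
move=> nuz nur nuw Fx x0; apply: pvalE.
have unu y : unitp p y -> unitp p' (nu y).
  move=> [P [Q [Pr Qr yQ]]]; exists (P \Po 'X^a), (Q \Po 'X^a).
  by rewrite !ev_compXn !nur // -nuz -!ev_rmorph -yQ rmorphM.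
have := unu _ (pvalP p Fx x0); rewrite rmorphM fmorphXz => ux.
have w0 : nu (ev z (pl_w p)) != 0 by rewrite fmorph_eq0 pl_w_neq0.
have /(unitpXz (pval p x)) := nuw; rewrite exprN1 expfzMl exprz_inv.
move=> /(unitpM ux); rewrite mulrA -(mulrA (nu x)) -expfzDr //.
by rewrite addNr expr0z mulr1.
Qed.

(** * Places of Q(zeta_N) above a prime q not dividing N *)

Lemma int_poly_mod0 (q : nat) (K : fieldType) (P : {poly int}) :
  q \in [pchar K] -> map_poly (intr : int -> K) P = 0 ->
  exists Q, P = q%:R * Q.
Proof.
move=> qK P0; exists (map_poly (fun c => (c %/ q)%Z) P).
apply/polyP => i; rewrite -polyC_natr coefCM coef_map_id0 ?div0z //.
have /eqP : (map_poly (intr : int -> K) P)`_i = 0 by rewrite P0 coef0.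
by rewrite coef_map /= -(dvdz_pcharf qK) natz mulrC => /divzK.
Qed.

Lemma Fp_poly_frobenius (q : nat) (p : {poly 'F_q}) e : prime q ->
  p ^+ (q ^ e) = p \Po 'X^(q ^ e).
Proof.
move=> q_pr; have qF : q \in [pchar {poly 'F_q}].
  by rewrite (rmorph_pchar polyC) ?pchar_Fp.
have p1 (h : {poly 'F_q}) : h ^+ q = h \Po 'X^q.
  elim/poly_ind: h => [|h c IH]; first by rewrite comp_poly0 expr0n gtn_eqF ?prime_gt0.
  rewrite comp_poly_MXaddC exprDn_pchar ?pnatE // exprMn IH -polyC_exp.
  by rewrite -[q in c ^+ q](card_Fp q_pr) expf_card.
elim: e => [|e IH]; first by rewrite expn0 expr1 comp_polyXr.
rewrite expnSr exprM IH p1 -comp_polyA.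
by rewrite comp_Xn_poly -exprM mulnC.
Qed.

Lemma int_poly_frobenius (q : nat) (P : {poly int}) e : prime q ->
  exists Q, P ^+ (q ^ e) = (P \Po 'X^(q ^ e)) + q%:R * Q.
Proof.
move=> q_pr; have [|Q DQ] := @int_poly_mod0 q 'F_q
    (P ^+ (q ^ e) - (P \Po 'X^(q ^ e))) (pchar_Fp q_pr).
  rewrite rmorphB rmorphXn /= map_comp_poly map_polyXn.
  by rewrite Fp_poly_frobenius // subrr.
by exists Q; rewrite -DQ addrC subrK.
Qed.

(** Division by a monic polynomial keeps integer coefficients, and the remainder is of smaller
    degree than the minimal polynomial of [z]. *)
Lemma Cyclotomic_dvd (N : nat) (z : algC) (P : {poly int}) :
  N.-primitive_root z -> ev z P = 0 -> exists Q, P = Q * 'Phi_N.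
Proof.
move=> prim_z Pz; have mPhi := Cyclotomic_monic N.
have Phiz : ev z 'Phi_N = 0.
  rewrite /ev /= (Cintr_Cyclotomic prim_z); apply/rootP.
  by rewrite root_cyclotomic.
have DP := Pdiv.RingMonic.rdivp_eq mPhi P.
set Q := Pdiv.Ring.rdivp _ _ in DP; set S := Pdiv.Ring.rmodp _ _ in DP.
have szS : (size S < size 'Phi_N)%N.
  by rewrite Pdiv.Ring.ltn_rmodp monic_neq0.
have Sz : ev z S = 0.
  by move: Pz; rewrite DP rmorphD rmorphM /= Phiz mulr0 add0r.
exists Q; rewrite {1}DP; suff -> : S = 0 by rewrite addr0.
apply/eqP; apply: contraLR szS => S0; rewrite -leqNgt.
pose T : {poly rat} := map_poly intr S.
have T0 : T != 0.
  by rewrite map_poly_eq0_id0 // intr_eq0 lead_coef_eq0.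
have [p [Dp _] dv_p] := minCpolyP z.
have : p %| T.
  rewrite -dv_p; apply/rootP; rewrite -Sz /ev /= /horner_eval -map_poly_comp.
  by congr (_.[_]); apply: eq_map_poly => c; rewrite /= rmorph_int.
move/(dvdp_leq T0); rewrite size_map_inj_poly //; last exact: intr_inj.
rewrite -(size_map_poly (ratr : {rmorphism rat -> algC})) -Dp.
by rewrite (minCpoly_cyclotomic prim_z) size_cyclotomic size_Cyclotomic.
Qed.

Lemma ev_Cyclotomic (N : nat) (K : fieldType) (r : K) :
  N.-primitive_root r -> ev r 'Phi_N = 0.
Proof.
move=> prim_r; have N0 := prim_order_gt0 prim_r.
have := congr1 (ev r) (prod_Cyclotomic N0).
rewrite rmorph_prod rmorphB rmorphXn /= evX prim_expr_order // rmorph1 subrr.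
move/eqP; rewrite prodf_seq_eq0 => /hasP[d /=]; rewrite -dvdn_divisors // => dN /eqP d0.
have d_gt0 := dvdn_gt0 N0 dN.
suff rd : r ^+ d = 1.
  have /prim_order_dvd /= := prim_r; move=> /(_ d); rewrite rd eqxx => Nd.
  by have /eqP <- : d == N by rewrite eqn_dvd dN Nd.
have := congr1 (ev r) (prod_Cyclotomic d_gt0).
rewrite (big_rem d) /=; last by rewrite -dvdn_divisors.
rewrite rmorphM /= d0 mul0r rmorphB rmorphXn /= evX rmorph1 => /esym/eqP.
by rewrite subr_eq0 => /eqP.
Qed.

Section UnramifiedPlace.
Variables (N : nat) (z : algC) (prim_z : N.-primitive_root z).
Variables (q : nat) (q_pr : prime q) (qN : coprime q N).
Variables (K : fieldType) (qK : q \in [pchar K]).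
Variables (r : K) (prim_r : N.-primitive_root r).

Lemma uplace_compat P : ev z P = 0 -> ev r P = 0.
Proof.
by move=> /(Cyclotomic_dvd prim_z)[Q ->]; rewrite rmorphM /= ev_Cyclotomic ?mulr0.
Qed.

Lemma uplace_wr : ev r (q%:R : {poly int}) = 0.
Proof. by rewrite rmorph_nat (pcharf0 qK). Qed.

Lemma uplace_ur : ev r (1 : {poly int}) != 0.
Proof. by rewrite rmorph1 oner_eq0. Qed.

Lemma uplace_wq : ev z (q%:R : {poly int}) ^+ 1 * ev z (1 : {poly int}) = q%:R.
Proof. by rewrite rmorph1 rmorph_nat mulr1. Qed.

(* The residue ring Z[z]/q is a reduced ring in which every element satisfies
   x^(q^f) = x, so that 1 - x^(q^f - 1) is an idempotent that annihilates x. *)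
Lemma uplace_div P : ev r P = 0 -> exists Z P',
  ev r Z != 0 /\ ev z Z * ev z P = ev z (q%:R : {poly int}) * ev z P'.
Proof.
move=> Pr; pose f := totient N; have f0 : (0 < f)%N.
  by rewrite totient_gt0 (prim_order_gt0 prim_z).
have qf1 : (1 < q ^ f)%N by rewrite -{1}(expn0 q) ltn_exp2l ?prime_gt1.
have [Q DQ] := int_poly_frobenius P f q_pr.
exists (1 - P ^+ (q ^ f).-1), (- Q); split.
  rewrite rmorphB rmorphXn /= Pr expr0n -subn1 subn_eq0 leqNgt qf1 subr0.
  exact: uplace_ur.
rewrite rmorphB rmorphXn /= rmorph1 mulrBl mul1r -exprSr prednK ?(ltnW qf1) //.
have := congr1 (ev z) DQ; rewrite rmorphXn rmorphD rmorphM /= ev_compXn => ->.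
rewrite -(prim_expr_mod prim_z) Euler_exp_totient // (prim_expr_mod prim_z) expr1.
by rewrite rmorphN mulrN opprD addNKr.
Qed.

Definition uplace : place z :=
  Place q_pr qK uplace_compat uplace_wr uplace_ur uplace_wq uplace_div.

Lemma uplace_isvalw (z' : algC) (p : place z') : pl_w p = q%:R ->
  isval p 1 q%:R.
Proof. by move=> wq; have := isvalw p; rewrite wq rmorph_nat. Qed.

(** The value of [P] at [r ^+ q] is the Frobenius image of its value at [r], so z |-> z^q belongs to
    the decomposition group of the place. *)
Lemma pval_uplace_frob (nu : {rmorphism algC -> algC}) x :
  nu z = z ^+ q -> fixF z x -> x != 0 -> pval uplace (nu x) = pval uplace x.
Proof.
move=> nuz; apply: (pval_transfer nuz) => [P|] /=.
  apply: contraNneq => Pr; have := ev_rmorph r (pFrobenius_aut qK) P.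
  by rewrite /= !pFrobenius_autE Pr => /eqP; rewrite expf_eq0 => /andP[_].
by rewrite ev_rmorph rmorph_nat; apply: uplace_isvalw.
Qed.

End UnramifiedPlace.

Arguments uplace [N z] prim_z [q] q_pr qN [K] qK [r] prim_r.

Lemma pval_uplace_sub (N N' : nat) (z z' : algC) (prim_z : N.-primitive_root z)
    (prim_z' : N'.-primitive_root z') q (q_pr : prime q) (qN : coprime q N)
    (qN' : coprime q N') (K : fieldType) (qK : q \in [pchar K]) (r r' : K)
    (prim_r : N.-primitive_root r) (prim_r' : N'.-primitive_root r')
    (nu : {rmorphism algC -> algC}) a x :
  nu z = z' ^+ a -> r = r' ^+ a -> fixF z x -> x != 0 ->
  pval (uplace prim_z' q_pr qN' qK prim_r') (nu x)
    = pval (uplace prim_z q_pr qN qK prim_r) x.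
Proof.
move=> nuz ra; apply: (pval_transfer nuz) => [P|] /=; first by rewrite ra.
by rewrite ev_rmorph rmorph_nat; apply: uplace_isvalw.
Qed.

(** * Primitive roots of unity in closed fields *)

Lemma closed_field_of_char (q : nat) : prime q ->
  exists (K : closedFieldType) (f : {rmorphism 'F_q -> K}), q \in [pchar K].
Proof.
move=> q_pr; have [K [f _]] := countable_algebraic_closure 'F_q.
by exists K, f; rewrite (fmorph_pchar f) pchar_Fp.
Qed.

Lemma closed_prim_root (K : closedFieldType) n : (0 < n)%N -> n%:R != 0 :> K ->
  exists z : K, n.-primitive_root z.
Proof.
move=> n_gt0 nK; pose p : {poly K} := 'X^n - 1.
have [r Dp] := closed_field_poly_normal p.
rewrite (monicP _) ?monicXnsubC // scale1r in Dp.
have rn1: all n.-unity_root r by apply/allP=> z; rewrite -root_prod_XsubC -Dp.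
have sz_r: (n < (size r).+1)%N.
  by rewrite -(size_prod_XsubC r id) -Dp size_XnsubC.
have [|z] := hasP (has_prim_root n_gt0 rn1 _ sz_r); last by exists z.
by rewrite -separable_prod_XsubC -Dp separable_Xn_sub_1.
Qed.

Lemma prim_root_lift (K : closedFieldType) (l n : nat) (x : K) : prime l ->
  l.-primitive_root x ->
  exists2 y : K, (l ^ n.+1).-primitive_root y & y ^+ (l ^ n) = x.
Proof.
move=> l_pr prim_x; have l0 := prime_gt0 l_pr.
have ln0 : (0 < l ^ n)%N by rewrite expn_gt0 l0.
have [|y] := closed_rootP ('X^(l ^ n) - x%:P) _.
  by rewrite size_XnsubC // -lt0n; case: (l ^ n)%N ln0.
rewrite rootE !hornerE subr_eq0 => /eqP Dy; exists y => //.
have yl : y ^+ (l ^ n.+1) = 1 by rewrite expnSr exprM Dy prim_expr_order.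
have [|m prim_y ml] := prim_order_exists _ yl; first by rewrite expn_gt0 l0.
have /(dvdn_pfactor _ _ l_pr)[k kn Dm] := ml.
move: kn; rewrite leq_eqVlt => /predU1P[<-|kn]; first by rewrite -Dm.
have /dvdnP[c Dc] : (m %| l ^ n)%N by rewrite Dm dvdn_exp2l.
have := prim_order_dvd prim_x 1; rewrite expr1 -Dy Dc mulnC exprM.
rewrite (prim_expr_order prim_y) expr1n eqxx dvdn1 => /eqP l1.
by rewrite l1 in l_pr.
Qed.

Lemma prod_1subXn (K : fieldType) (n : nat) (z : K) : n.-primitive_root z ->
  \prod_(1 <= i < n) (1 - z ^+ i) = n%:R.
Proof.
move=> prim_z; have n0 := prim_order_gt0 prim_z.
have := factor_Xn_sub_1 prim_z; rewrite big_ltn // expr0 subrX1.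
have X10 : 'X - 1%:P != 0 :> {poly K} by rewrite polyXsubC_eq0.
move/(mulfI X10)/(congr1 (fun p => p.[1])); rewrite horner_prod horner_sum.
under eq_bigr do rewrite hornerXsubC.
by move=> ->; under eq_bigr do rewrite hornerXn expr1n; rewrite sumr_const card_ord.
Qed.

(** * The place of Q(zeta_l) above l *)

Section RamifiedPlace.
Variables (l : nat) (l_pr : prime l) (z : algC) (prim_z : l.-primitive_root z).
Local Notation w := (1 - 'X : {poly int}).

Let geom a : {poly int} := \sum_(i < a) 'X^i.

Lemma ev_geom (R : comNzRingType) (x : R) a : ev x (geom a) = \sum_(i < a) x ^+ i.
Proof. by rewrite rmorph_sum /=; apply: eq_bigr => i _; rewrite rmorphXn /= evX. Qed.

Lemma ev_w (R : comNzRingType) (x : R) : ev x w = 1 - x.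
Proof. by rewrite rmorphB /= rmorph1 evX. Qed.

Lemma geom_mul (R : comNzRingType) (x : R) a : (1 - x) * ev x (geom a) = 1 - x ^+ a.
Proof. by rewrite ev_geom -[1 - x]opprB mulNr -subrX1 opprB. Qed.

Lemma Cyclotomic_prime : 'Phi_l = geom l.
Proof.
have X10 : 'X - 1%:P != 0 :> {poly int} by rewrite polyXsubC_eq0.
have Phi1 : 'Phi_1 = 'X - 1 by rewrite -[RHS](@prod_Cyclotomic 1) // big_seq1.
have Dl : perm_eq (divisors l) [:: 1%N; l].
  apply: uniq_perm; rewrite ?divisors_uniq //=.
    by rewrite inE neq_ltn prime_gt1.
  move=> d; rewrite -dvdn_divisors ?prime_gt0 // !inE.
  apply/idP/idP => [/(primeP l_pr).2 //|/orP[]/eqP-> //]; exact: dvd1n.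
have := prod_Cyclotomic (prime_gt0 l_pr); rewrite (perm_big _ Dl) /=.
by rewrite !big_cons big_nil mulr1 Phi1 subrX1 => /(mulfI X10).
Qed.

Let one_r : 'F_l := 1.
(** At [z] this is the product of the cyclotomic units (1 - z^a) / (1 - z), that is, the unit
    relating l to (1 - z)^(l - 1). *)
Let u : {poly int} := \prod_(1 <= a < l) geom a.

Lemma lplace_compat P : ev z P = 0 -> ev one_r P = 0.
Proof.
move=> /(Cyclotomic_dvd prim_z)[Q ->]; rewrite rmorphM /= Cyclotomic_prime.
rewrite ev_geom; under eq_bigr do rewrite expr1n.
by rewrite sumr_const card_ord (pcharf0 (pchar_Fp l_pr)) mulr0.
Qed.

Lemma lplace_wr : ev one_r w = 0. Proof. by rewrite ev_w subrr. Qed.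

Lemma ev1_geom a : ev one_r (geom a) = a%:R.
Proof.
by rewrite ev_geom; under eq_bigr do rewrite expr1n; rewrite sumr_const card_ord.
Qed.

Lemma Fl_nat_neq0 a : (a%:R != 0 :> 'F_l) = ~~ (l %| a)%N.
Proof. by rewrite -(dvdn_pcharf (pchar_Fp l_pr)). Qed.

Lemma lplace_ur : ev one_r u != 0.
Proof.
rewrite rmorph_prod /= prodf_seq_neq0; apply/allP => a.
rewrite mem_index_iota /= => /andP[a0 al]; rewrite ev1_geom Fl_nat_neq0.
by rewrite gtnNdvd.
Qed.

Lemma lplace_wq : ev z w ^+ l.-1 * ev z u = l%:R.
Proof.
rewrite -(prod_1subXn prim_z) rmorph_prod /= ev_w.
have -> : (1 - z) ^+ l.-1 = \prod_(1 <= a < l) (1 - z).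
  by rewrite prodr_const_nat subn1.
by rewrite -big_split; apply: eq_bigr => a _ /=; rewrite geom_mul.
Qed.

(** [P] differs from the constant P(1) by a multiple of 1 - X, and P(1) is divisible by l, whose
    value is itself a multiple of 1 - z. *)
Lemma lplace_div1 P : ev one_r P = 0 -> exists P', ev z P = ev z w * ev z P'.
Proof.
move=> Pr; pose c := P.[1].
have /dvdzP[c' Dc] : (l %| c)%Z.
  rewrite (dvdz_pcharf (pchar_Fp l_pr)); apply/eqP; rewrite -Pr /c /ev /=.
  by rewrite /horner_eval -[one_r]/(1%:~R) horner_map.
have /factor_theorem[Q DQ] : root (P - c%:P) 1.
  by apply/rootP; rewrite hornerD hornerN hornerC subrr.
have l1 : l.-1 = l.-2.+1 by rewrite prednK // -subn1 subn_gt0 prime_gt1.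
exists (c'%:P * w ^+ l.-2 * u - Q).
have -> : P = c%:P - Q * w by rewrite -[1 - 'X]opprB mulrN opprK -DQ addrC subrK.
have evB p p' : ev z (p - p') = ev z p - ev z p' by rewrite rmorphB.
have evM p p' : ev z (p * p') = ev z p * ev z p' by rewrite rmorphM.
have evwX n : ev z (w ^+ n) = ev z w ^+ n by rewrite rmorphXn.
rewrite [LHS]evB [ev z (_ - Q)]evB !evM evwX !evC Dc intrM mulrBr.
rewrite -[(l%:Z)%:~R]/(l%:R : algC) -lplace_wq l1 exprS [ev z Q * _]mulrC.
by congr (_ - _); rewrite mulrCA !mulrA; congr (_ * _); rewrite mulrAC mulrC !mulrA.
Qed.

Lemma lplace_div P : ev one_r P = 0 -> exists Z P',
  ev one_r Z != 0 /\ ev z Z * ev z P = ev z w * ev z P'.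
Proof.
move=> /lplace_div1[P' DP]; exists 1, P'.
by rewrite !rmorph1 oner_eq0 mul1r.
Qed.

Definition lplace : place z :=
  Place l_pr (pchar_Fp l_pr) lplace_compat lplace_wr lplace_ur lplace_wq
    lplace_div.

Lemma geom_unit a : ~~ (l %| a)%N -> exists g, ev z (geom a) * ev z g = 1.
Proof.
(* By Fermat [b] is inverse to [a] modulo l, so the inverse of (1 - z^a) / (1 - z) is (1 - z^(ab)) /
   (1 - z^a). *)
move=> la; pose b := (a ^ l.-2)%N; exists (geom b \Po 'X^a).
have z1 : 1 - z != 0.
  rewrite subr_eq0 eq_sym -[z]expr1 -(prim_order_dvd prim_z) dvdn1.
  by rewrite neq_ltn prime_gt1 ?orbT.
apply: (mulfI z1); rewrite mulrA geom_mul ev_compXn geom_mul -exprM mulr1.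
have l2 : l.-1 = l.-2.+1 by rewrite prednK // -subn1 subn_gt0 prime_gt1.
rewrite /b -expnS -l2 -(prim_expr_mod prim_z) -totient_prime //.
by rewrite Euler_exp_totient ?(prim_expr_mod prim_z) ?expr1 // coprime_sym prime_coprime.
Qed.

Lemma u_unit : exists g, ev z u * ev z g = 1.
Proof.
rewrite /u big_seq_cond; elim/big_ind: _.
- by exists 1; rewrite rmorph1 mulr1.
- move=> p p' [g Dg] [g' Dg']; exists (g * g').
  by rewrite !rmorphM /= mulrACA Dg Dg' mulr1.
move=> a; rewrite mem_index_iota andbT => /andP[a0 al]; apply: geom_unit.
by rewrite gtnNdvd.
Qed.

Lemma pval_lplace_aut (nu : {rmorphism algC -> algC}) a x :
  nu z = z ^+ a -> ~~ (l %| a)%N -> fixF z x -> x != 0 ->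
  pval lplace (nu x) = pval lplace x.
Proof.
move=> nuz la; apply: (pval_transfer nuz) => [P|] /=; first by rewrite expr1n.
rewrite ev_w rmorphB rmorph1 nuz -geom_mul -ev_w -[X in isval _ X]addr0.
rewrite addr0 -[1]addr0; apply: isvalM; first exact: (isvalw lplace).
by apply/isval0/unitp_ev; rewrite /= ev1_geom Fl_nat_neq0.
Qed.

Lemma lplace_divX P j : ev z P != 0 -> j%:Z <= pval lplace (ev z P) ->
  exists T, ev z P = ev z w ^+ j * ev z T.
Proof.
move=> P0; elim: j => [|j IH] jP; first by exists P; rewrite mul1r.
have [|T DT] := IH; first by apply: le_trans jP; rewrite lez_nat.
have := P0; rewrite DT mulf_eq0 negb_or => /andP[wj T0].
have w0 := pl_w_neq0 lplace.
have /lplace_div1[T' DT'] : ev one_r T = 0.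
  apply/eqP; rewrite -[_ == 0](pval_ev_gt0 lplace T0).
  move: jP; rewrite DT pvalM ?pvalX //; try exact: fixF_ev.
    by rewrite (pvalE (isvalw lplace)) -[1 *+ j]/(j%:R) natz -lerBlDl -addn1 PoszD addrC addKr.
  exact/fixFX/fixF_ev.
by exists T'; rewrite DT' mulrA exprSr.
Qed.

Lemma pval_lplace_l : pval lplace l%:R = l.-1%:Z.
Proof.
have w0 := pl_w_neq0 lplace; have u0 := pl_neq0 lplace_ur (p := lplace).
rewrite -lplace_wq pvalM ?expf_neq0 //; last exact: fixF_ev.
  rewrite pvalX // ?(pvalE (isvalw lplace)); last exact: fixF_ev.
  by rewrite pval_unit ?addr0 ?natz //; apply/unitp_ev/lplace_ur.
exact/fixFX/fixF_ev.
Qed.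

End RamifiedPlace.

(** * Integrality in Q(zeta_l) from valuations *)

Section Integrality.
Variables (l : nat) (l_pr : prime l) (z : algC) (prim_z : l.-primitive_root z).

Lemma ev_reduce P : exists S : {poly int}, (size S < l)%N /\ ev z P = ev z S.
Proof.
have mPhi := Cyclotomic_monic l.
exists (Pdiv.Ring.rmodp P 'Phi_l); split.
  rewrite (leq_trans (Pdiv.Ring.ltn_rmodpN0 _ _)) ?monic_neq0 //.
  by rewrite size_Cyclotomic totient_prime // prednK ?prime_gt0.
rewrite {1}(Pdiv.RingMonic.rdivp_eq mPhi P) rmorphD rmorphM /=.
by rewrite (ev_Cyclotomic prim_z) mulr0 add0r.
Qed.

(** A representative of degree less than l - 1 vanishes modulo q at the l - 1 distinct roots r^a,
    hence all its coefficients are divisible by q. *)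
Lemma ev_dvd_unramified q (q_pr : prime q) (ql : coprime q l) (K : fieldType)
    (qK : q \in [pchar K]) (r : K) P N :
  l.-primitive_root r -> (0 < N)%N -> (q %| N)%N -> ev z P != 0 ->
  (forall a (prim_ra : l.-primitive_root (r ^+ a)),
     0 <= pval (uplace prim_z q_pr ql qK prim_ra) (ev z P / N%:R)) ->
  exists P', ev z P = q%:R * ev z P'.
Proof.
move=> prim_r N0 qN P0 vP; have [S [szS DS]] := ev_reduce P.
suff /(int_poly_mod0 qK)[Q DQ] : map_poly (intr : int -> K) S = 0.
  by exists Q; rewrite DS DQ rmorphM /= rmorph_nat.
apply/eqP; apply: contraLR szS => S0; rewrite -leqNgt.
pose rs := [seq r ^+ a | a <- iota 1 l.-1].
have szr : size rs = l.-1 by rewrite size_map size_iota.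
have lE : l.-1.+1 = l := prednK (prime_gt0 l_pr).
have Urs : uniq rs.
  rewrite map_inj_in_uniq ?iota_uniq // => a b.
  rewrite !mem_iota !add1n lE => /andP[_ al] /andP[_ bl] /eqP.
  by rewrite (eq_prim_root_expr prim_r) !modn_small // => /eqP.
have Rrs : all (root (map_poly intr S)) rs.
  apply/allP => _ /mapP[a + ->]; rewrite mem_iota add1n lE.
  move=> /andP[a0 al]; have prim_ra : l.-primitive_root (r ^+ a).
    by rewrite prim_root_exp_coprime // coprime_sym prime_coprime // gtnNdvd.
  pose pl := uplace prim_z q_pr ql qK prim_ra.
  have S0z : ev z S != 0 by rewrite -DS.
  have N0z : ev z N%:R != 0 by rewrite rmorph_nat pnatr_eq0 -lt0n.
  have := vP a prim_ra; rewrite DS -/pl pvalM ?pvalV //.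
  - rewrite -(rmorph_nat (ev z) N) subr_ge0 => vN.
    have : 0 < pval pl (ev z S).
      apply: lt_le_trans vN; rewrite pval_ev_gt0 //= rmorph_nat.
      by rewrite -(dvdn_pcharf qK).
    by rewrite pval_ev_gt0.
  - exact: fixF_nat.
  - by rewrite -(rmorph_nat (ev z) N).
  - exact: fixF_ev.
  - exact/fixFV/fixF_nat.
  - by rewrite invr_eq0 -(rmorph_nat (ev z) N).
have := max_poly_roots S0 Rrs Urs; rewrite szr lE => H.
by apply: leq_trans H (size_poly _ _).
Qed.

Lemma ev_dvd_ramified P N : (0 < N)%N -> (l %| N)%N -> ev z P != 0 ->
  0 <= pval (lplace l_pr prim_z) (ev z P / N%:R) ->
  exists P', ev z P = l%:R * ev z P'.
Proof.
move=> N0 /dvdnP[M DN] P0; have M0 : (0 < M)%N by move: N0; rewrite DN; case: (M).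
set pl := lplace l_pr prim_z => vP.
have MC : M%:R != 0 :> algC by rewrite pnatr_eq0 -lt0n.
have lC : l%:R != 0 :> algC by rewrite pnatr_eq0 -lt0n prime_gt0.
have /lplace_divX[//|T DT] : l.-1%:Z <= pval pl (ev z P).
  have MCz : ev z M%:R != 0 by rewrite rmorph_nat.
  move: vP; rewrite pvalM; first last.
  - by rewrite invr_eq0 pnatr_eq0 -lt0n.
  - by [].
  - exact/fixFV/fixF_nat.
  - exact: fixF_ev.
  rewrite pvalV; first last.
  - by rewrite pnatr_eq0 -lt0n.
  - exact: fixF_nat.
  rewrite subr_ge0; apply: le_trans; rewrite DN natrM pvalM //; try exact: fixF_nat.
  rewrite pval_lplace_l lerDr -(rmorph_nat (ev z) M) //.
  exact: pval_ev_ge0.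
have [g Dg] := u_unit l_pr prim_z.
exists (g * T); rewrite DT rmorphM /= -(lplace_wq prim_z) -!mulrA.
by congr (_ * _); rewrite mulrA Dg mul1r.
Qed.

(** Induction on the denominator: by the hypotheses at the places above it, a prime dividing the
    denominator also divides the numerator and can be cancelled. *)
Lemma integral_criterion x : fixF z x -> x != 0 ->
  (forall q (q_pr : prime q) (ql : coprime q l),
     exists (K : fieldType) (qK : q \in [pchar K]) (r : K),
     l.-primitive_root r /\ forall a (prim_ra : l.-primitive_root (r ^+ a)),
       0 <= pval (uplace prim_z q_pr ql qK prim_ra) x) ->
  0 <= pval (lplace l_pr prim_z) x -> exists P, x = ev z P.
Proof.
move=> Fx x0 vq vl; have [P [N [N0 Dx]]] := fixF_frac Fx.
elim/ltn_ind: N => N IH in P N0 Dx *.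
have [N1|N1] := leqP N 1.
  by exists P; rewrite Dx (_ : N = 1%N) ?divr1 //; apply/eqP; rewrite eqn_leq N1.
have P0 : ev z P != 0 by apply: contraNneq x0 => P0; rewrite Dx P0 mul0r.
have [q q_pr qN] := pdivP N1.
have [P' DP'] : exists P', ev z P = q%:R * ev z P'.
  have [ql|ql] := boolP (coprime q l).
    have [K [qK [r [prim_r vr]]]] := vq q q_pr ql.
    apply: (ev_dvd_unramified (q_pr := q_pr) (ql := ql) (qK := qK) prim_r N0) => //.
    by move=> a prim_ra; rewrite -Dx.
  have ql' : q = l.
    by apply/eqP; move: ql; rewrite prime_coprime // negbK dvdn_prime2.
  by rewrite ql' in qN *; apply: (ev_dvd_ramified N0) => //; rewrite -Dx.
have /dvdnP[M DN] := qN.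
have M0 : (0 < M)%N by move: N0; rewrite DN; case: (M).
apply: (IH M _ P') => //; first by rewrite DN ltn_Pmulr // prime_gt1.
rewrite Dx DP' DN natrM [M%:R * _]mulrC invfM mulrA; congr (_ / _).
by rewrite mulrAC divff ?mul1r // pnatr_eq0 -lt0n prime_gt0.
Qed.

End Integrality.

(** * Kummer generators: the eigenvector property and tame ramification *)

Section Kummer.
Variables (N : nat) (z : algC) (prim_z : N.-primitive_root z).
Variable f : gal_group Qbar -> nat.
Hypothesis fM : forall s t, (f (gal_mul s t) = f s + f t %[mod N])%N.
Variable tau : algC.
Hypothesis tauP : forall s : gal_group Qbar, s z = z -> s tau = z ^+ f s * tau.

Lemma kummer_eigen (nu : {rmorphism algC -> algC}) a :
  nu z = z ^+ a -> fixF z (nu tau / tau ^+ a).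
Proof.
move=> nuz s sz; pose g := gal_of_aut nu; pose t := gal_of_aut s.
pose c := gal_mul (gal_opp g) (gal_mul t g).
have cz : c z = z.
  apply: (fmorph_inj nu); rewrite /= algC_invautK.
  by rewrite nuz rmorphXn /= sz.
have fc : (f c = f t %[mod N])%N.
  have : gal_mul g c = gal_mul t g by rewrite gal_mulA gal_mulV gal_1mul.
  move/(congr1 f) => E; have := fM g c; rewrite E fM addnC => /eqP.
  by rewrite eqn_modDl => /eqP ->.
have snu : s (nu tau) = z ^+ (a * f t) * nu tau.
  have := tauP cz => /(congr1 nu); rewrite /= algC_invautK => ->.
  rewrite rmorphM rmorphXn /= nuz -exprM; congr (_ * _).
  by rewrite -(prim_expr_mod prim_z) -modnMmr fc modnMmr prim_expr_mod.
have stau : s tau = z ^+ f t * tau by apply: (tauP (s := t)).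
rewrite fmorph_div rmorphXn /= snu stau exprMn -exprM mulnC invfM.
by rewrite mulrACA divff ?mul1r // expf_neq0 // (prim_root_neq0 prim_z).
Qed.

Lemma kummer_pow : fixF z (tau ^+ N).
Proof.
move=> s sz; rewrite rmorphXn /= (tauP (s := gal_of_aut s)) // exprMn -exprM mulnC.
by rewrite exprM (prim_expr_order prim_z) expr1n mul1r.
Qed.

End Kummer.

Section Tame.
Variables (l : nat) (l_pr : prime l) (n : nat).
Variables (z : algC) (prim_z : l.-primitive_root z).
Variable f : gal_group Qbar -> nat.
Hypothesis fM : forall s t, (f (gal_mul s t) = f s + f t %[mod l ^ n.+1])%N.
Variable E : seq algC.
Hypothesis fE :
  forall s : gal_group Qbar, {in E, s =1 id} -> (f s = 0 %[mod l ^ n.+1])%N.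
Variable tau : algC.
Hypothesis tau0 : tau != 0.
Hypothesis tauP : forall s : gal_group Qbar, s z = z -> s tau = z ^+ f s * tau.

(** Let mu' be the l^(n+1)-th power of a Kummer generator at level n + 1. A Frobenius nu at q
    preserves the valuation v and satisfies nu(mu') = mu'^q eta^(l^(n+1)), so l^(n+1) divides (q -
    1) v(mu'). As it does not divide q - 1, l divides v(mu'). *)
Lemma tame_dvd q (q_pr : prime q) (ql : coprime q l) (K : closedFieldType)
    (qK : q \in [pchar K]) (r : K) (prim_r : l.-primitive_root r) :
  ~~ (l ^ n.+1 %| q.-1)%N ->
  (l %| pval (uplace prim_z q_pr ql qK prim_r) (tau ^+ l))%Z.
Proof.
move=> nq; have [z' prim_z' Dz] := @prim_root_lift algC l n z l_pr prim_z.
have [r' prim_r' Dr] := prim_root_lift n l_pr prim_r.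
have ql' : coprime q (l ^ n.+1) by rewrite coprimeXr.
pose p := uplace prim_z q_pr ql qK prim_r.
pose p' := uplace prim_z' q_pr ql' qK prim_r'.
have [t t0 tP] := kummer_generator prim_z' fM fE.
have Fmu : fixF z (tau ^+ l) by apply: (kummer_pow prim_z tauP).
have mu0 : tau ^+ l != 0 by rewrite expf_neq0.
have -> : pval p (tau ^+ l) = pval p' (tau ^+ l).
  by apply/esym/(@pval_uplace_sub _ _ _ _ _ _ _ _ _ _ _ _ _ _ _ _ idfun (l ^ n)).
(* Both are Kummer generators of the first layer, so the quotient lies in Q(z'), and [tau ^+ l] and
   [mu'] agree up to an l-th power. *)
pose xi := t ^+ (l ^ n) / tau.
have Fxi : fixF z' xi.
  move=> s sz; have sz0 : s z = z by rewrite -Dz rmorphXn /= sz.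
  rewrite fmorph_div rmorphXn /= (tP (gal_of_aut s)) // (tauP (s := gal_of_aut s)) //.
  rewrite exprMn -exprM mulnC exprM Dz invfM mulrACA divff ?mul1r //.
  by rewrite expf_neq0 // (prim_root_neq0 prim_z).
have xi0 : xi != 0 by rewrite mulf_neq0 ?invr_eq0 ?expf_neq0.
pose mu' := t ^+ (l ^ n.+1).
have Fmu' : fixF z' mu' by apply: (kummer_pow prim_z' tP).
have mu'0 : mu' != 0 by rewrite expf_neq0.
have Dmu : tau ^+ l = mu' * (xi ^+ l)^-1.
  rewrite /xi expr_div_n -exprM -expnSr invf_div mulrCA divff ?mulr1 //.
have [nu nuP] := Qn_aut_exists ql'.
have nuz : nu z' = z' ^+ q by apply/nuP/prim_expr_order.
pose eta := nu t / t ^+ q.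
have Feta : fixF z' eta by apply: (kummer_eigen prim_z' fM tP).
have eta0 : eta != 0 by rewrite mulf_neq0 ?invr_eq0 ?expf_neq0 ?fmorph_eq0.
have Dnu : nu mu' = mu' ^+ q * eta ^+ (l ^ n.+1).
  rewrite /mu' rmorphXn /= /eta expr_div_n -!exprM mulnC mulrCA divff ?mulr1 //.
  by rewrite expf_neq0.
clearbody mu' xi eta.
have vmu : (l %| pval p' mu')%Z.
  have := pval_uplace_frob prim_z' q_pr ql' qK prim_r' nuz Fmu' mu'0.
  rewrite -/p' Dnu pvalM ?expf_neq0 ?pvalX //; try by apply: fixFX.
  rewrite -{1}(prednK (prime_gt0 q_pr)) mulrSr addrAC => /eqP.
  rewrite -subr_eq0 addrK addr_eq0 -[_ *+ q.-1]mulr_natr -[_ *+ (l ^ _)]mulr_natr.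
  rewrite !natz => /eqP E1.
  have : (l ^ n.+1 %| `|pval p' mu'| * q.-1)%N.
    by rewrite -[q.-1]/`|q.-1%:Z|%N -abszM E1 abszN abszM dvdn_mull.
  rewrite dvdzE /=; apply: contraTT => lv.
  by rewrite Gauss_dvdr // coprimeXl // prime_coprime.
rewrite Dmu pvalM ?invr_eq0 ?expf_neq0 ?pvalV ?pvalX //; try (by apply: fixFX); last first.
  exact/fixFV/fixFX.
  by rewrite expf_neq0.
by rewrite rpredB // -mulr_natr natz dvdz_mull.
Qed.

(** The valuation is unchanged by enlarging the residue field; [tame_dvd] works over a closure of
    F_q, which contains roots of unity of order l^(n+1). *)
Lemma tame_dvd_Fp q (q_pr : prime q) (ql : coprime q l) (r : 'F_q)
    (prim_r : l.-primitive_root r) : ~~ (l ^ n.+1 %| q.-1)%N ->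
  (l %| pval (uplace prim_z q_pr ql (pchar_Fp q_pr) prim_r) (tau ^+ l))%Z.
Proof.
move=> nq; have [K [g qK]] := closed_field_of_char q_pr.
have prim_gr : l.-primitive_root (g r) by rewrite fmorph_primitive_root.
have := tame_dvd q_pr ql qK prim_gr nq; set v := pval _ _; set v' := pval _ _.
suff -> : v = v' by [].
have Fmu : fixF z (tau ^+ l) by apply: (kummer_pow prim_z tauP).
have mu0 : tau ^+ l != 0 by rewrite expf_neq0.
apply: (@pval_transfer z z _ _ idfun 1) => //= [P|].
  by rewrite expr1 -ev_rmorph fmorph_eq0.
by rewrite rmorph_nat; apply: uplace_isvalw.
Qed.

End Tame.

Lemma prime_dvd_fact q n : prime q -> (q %| n`!)%N -> (q <= n)%N.
Proof.
move=> q_pr; elim: n => [|n IH]; first by rewrite dvdn1 => /eqP q1; rewrite q1 in q_pr.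
by rewrite factS Euclid_dvdM // => /orP[/dvdn_leq-> //|/IH/leqW].
Qed.

(** * Character sums and Jacobi sums over finite fields *)

Section CharacterSums.
Variables (F : finFieldType) (C : fieldType).

Lemma char_sum0 (chi : F -> C) g : (forall x y, chi (x * y) = chi x * chi y) ->
  g != 0 -> chi g != 1 -> \sum_x chi x = 0.
Proof.
move=> chiM g0 chig; have : \sum_x chi x = chi g * \sum_x chi x.
  rewrite [LHS](reindex_inj (mulfI g0)) big_distrr /=.
  by apply: eq_bigr => x _; rewrite chiM.
move/eqP; rewrite -subr_eq0 -{1}[\sum_x _]mul1r -mulrBl mulf_eq0 subr_eq0 eq_sym.
by rewrite (negPf chig) => /eqP.
Qed.

Variables chi psi : F -> C.
Hypothesis chiM : forall x y, chi (x * y) = chi x * chi y.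
Hypothesis psiM : forall x y, psi (x * y) = psi x * psi y.
Hypothesis chi0 : chi 0 = 0.
Hypothesis psi0 : psi 0 = 0.
Hypothesis chi1 : chi 1 = 1.
Hypothesis psi1 : psi 1 = 1.
Hypothesis sum_chi : \sum_x chi x = 0.
Hypothesis sum_psi : \sum_x psi x = 0.
Hypothesis sum_chipsi : \sum_x chi x * psi x = 0.

Let psi_neq0 x : x != 0 -> psi x != 0.
Proof.
move=> x0; apply/eqP => px0; have := psiM x x^-1.
by rewrite divff // psi1 px0 mul0r => /eqP; rewrite oner_eq0.
Qed.

Let chi_neq0 x : x != 0 -> chi x != 0.
Proof.
move=> x0; apply/eqP => px0; have := chiM x x^-1.
by rewrite divff // chi1 px0 mul0r => /eqP; rewrite oner_eq0.
Qed.

(** The coefficient of chi(u) in the product of the two Jacobi sums, after the substitution x =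
    uy. *)
Let T u := \sum_(y | y != 0) psi (1 - u * y) / psi (1 - y).

Let T1 : T 1 = #|F|%:R - 2%:R.
Proof.
rewrite /T (bigD1 1) ?oner_eq0 //= mul1r subrr psi0 mul0r add0r.
rewrite (eq_bigr (fun=> 1)) => [|y /andP[_ y1]]; last first.
  by rewrite mul1r divff // psi_neq0 // subr_eq0 eq_sym.
have : \sum_(y : F) (1 : C) = #|F|%:R by rewrite sumr_const.
rewrite (bigD1 0) // (bigD1 1) /=; last by rewrite oner_eq0.
by move=> <-; ring.
Qed.

Let T_neq1 u : u != 1 -> T u = - 1 - psi u.
Proof.
move=> u1; have u10 : 1 - u != 0 by rewrite subr_eq0 eq_sym.
have -> : T u = \sum_(w | (w != 1) && (w != u)) psi w.
  (* The Moebius map y |-> (1 - uy) / (1 - y) sends 0, infinity and 1 to 1, u and infinity, so it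
     maps the complement of 0 and 1 onto that of 1 and u. *)
  rewrite (reindex_onto (fun y => (1 - u * y) / (1 - y))
                        (fun w => (w - 1) / (w - u))) /=; last first.
    move=> w /andP[w1 wu]; have wu0 : w - u != 0 by rewrite subr_eq0.
    have E1 : 1 - (w - 1) / (w - u) = (1 - u) / (w - u) by field.
    have E0 : 1 - (w - 1) / (w - u) != 0 by rewrite E1 mulf_neq0 ?invr_eq0.
    by apply: (mulIf E0); rewrite divfK //; field.
  rewrite /T (bigID (fun y => y == 1)) /= big1 ?add0r; last first.
    by move=> y /andP[_ /eqP->]; rewrite subrr psi0 invr0 mulr0.
  apply: eq_big => y; last first.
    move=> /andP[y0 y1]; have y10 : 1 - y != 0 by rewrite subr_eq0 eq_sym.
    apply/esym; rewrite psiM; congr (_ * _).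
    apply: (mulfI (psi_neq0 y10)); rewrite -psiM divff // psi1 divff //.
    exact: psi_neq0.
  have [->|y0] := eqVneq y 0.
    by rewrite mulr0 subr0 divr1 eqxx.
  have [->|y1] := eqVneq y 1 => /=.
    rewrite subrr invr0 mulr0 !sub0r eq_sym oner_eq0 /=.
    have [//|u0] := eqVneq 0 u; rewrite /=; apply/esym/negbTE.
    rewrite invrN mulN1r opprK; apply: contra_neq u1 => u1.
    by rewrite -[u]invrK u1 invr1.
  have y10 : 1 - y != 0 by rewrite subr_eq0 eq_sym.
  have D1 : (1 - u * y) / (1 - y) - 1 = y * (1 - u) / (1 - y).
    by field.
  have Du : (1 - u * y) / (1 - y) - u = (1 - u) / (1 - y).
    by field.
  rewrite -[_ == 1]subr_eq0 -[_ == u]subr_eq0 D1 Du !mulf_eq0 !invr_eq0.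
  rewrite (negPf y0) (negPf u10) (negPf y10) /=; apply/esym/eqP.
  by field; rewrite y10.
have := sum_psi; rewrite (bigD1 1) //= (bigD1 u) //= psi1 => /eqP.
by rewrite addrA addrC addr_eq0 => /eqP ->; ring.
Qed.

(** The second factor plays the role of the complex conjugate; with inverses of the characters the
    identity makes sense in any field. All three vanishing character sums enter through the values
    of [T]. *)
Lemma jacobi_norm :
  (\sum_x chi x * psi (1 - x)) * (\sum_y (chi y)^-1 * (psi (1 - y))^-1) = #|F|%:R.
Proof.
transitivity (\sum_u chi u * T u).
  rewrite big_distrr /= (bigD1 0) //= chi0 invr0 mul0r mulr0 add0r.
  rewrite (eq_bigr (fun y => \sum_u chi u * (psi (1 - u * y) / psi (1 - y)))).
    by rewrite exchange_big /=; apply: eq_bigr => u _; rewrite big_distrr.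
  move=> y y0; rewrite (reindex_inj (mulIf y0)) big_distrl /=.
  apply: eq_bigr => u _; rewrite chiM mulrACA mulrA.
  by rewrite -(mulrA (chi u)) divff ?mulr1 ?mulrA // chi_neq0.
rewrite (bigD1 1) //= chi1 mul1r T1.
rewrite (eq_bigr (fun u => - chi u - chi u * psi u)) => [|u u1]; last first.
  by rewrite T_neq1 // mulrBr mulrN1.
rewrite big_split /= !sumrN.
have := sum_chi; rewrite (bigD1 1) //= chi1 => /eqP; rewrite addr_eq0 => /eqP c1.
have := sum_chipsi; rewrite (bigD1 1) //= chi1 psi1 mulr1 => /eqP.
rewrite addr_eq0 => /eqP c2; rewrite -c1 -c2.
by ring.
Qed.

End CharacterSums.

Section PowerSums.
Variables (q : nat) (q_pr : prime q).
Implicit Types x y : 'F_q.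

Lemma Fp_exp_predp x : x != 0 -> x ^+ q.-1 = 1.
Proof.
move=> x0; apply: (mulfI x0); rewrite mulr1 -exprS prednK ?prime_gt0 //.
by rewrite -[q in _ ^+ q](card_Fp q_pr) expf_card.
Qed.

Lemma Fp_exp_neq1 k : (0 < k < q.-1)%N -> exists2 g : 'F_q, g != 0 & g ^+ k != 1.
Proof.
case/andP=> k0 kq; apply: contrapT => H.
have /(max_poly_roots (monic_neq0 (monicXnsubC 1 k0))) :
    all (root ('X^k - 1 : {poly 'F_q})) (enum [pred x : 'F_q | x != 0]).
  apply/allP => x; rewrite mem_enum inE => x0.
  rewrite rootE !hornerE subr_eq0; apply/negPn/negP => xk.
  by apply: H; exists x.
move=> /(_ (enum_uniq _)); rewrite size_XnsubC // -cardE ltnS.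
have -> : #|[pred x : 'F_q | x != 0]| = q.-1.
  by have := cardC1 (0 : 'F_q); rewrite card_Fp.
by rewrite leqNgt kq.
Qed.

Lemma power_sum_small k : (0 < k < q.-1)%N -> \sum_(x : 'F_q) x ^+ k = 0.
Proof.
move=> kq; have [g g0 gk] := Fp_exp_neq1 kq.
by apply: (char_sum0 (g := g)) => // x y; rewrite exprMn.
Qed.

Lemma power_sum k : (0 < k < 2 * q.-1)%N ->
  \sum_(x : 'F_q) x ^+ k = if k == q.-1 then -1 else 0.
Proof.
case/andP=> k0 k2; have q10 : (0 < q.-1)%N by move: k2; case: (q.-1).
have [->|kq] := eqVneq k q.-1.
  rewrite (bigD1 0) //= expr0n gtn_eqF // add0r.
  rewrite (eq_bigr (fun=> 1)) => [|x x0]; last exact: Fp_exp_predp.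
  have : \sum_(x : 'F_q) (1 : 'F_q) = 0.
    by rewrite sumr_const card_Fp // (pcharf0 (pchar_Fp q_pr)).
  by rewrite (bigD1 0) //= => /eqP; rewrite addrC addr_eq0 => /eqP.
have [lt_kq|lt_qk|/eqP] := ltngtP k q.-1; last by rewrite (negPf kq).
  by apply: power_sum_small; rewrite k0.
rewrite -(subnK (ltnW lt_qk)) in k2 *; rewrite (eq_bigr (fun x => x ^+ (k - q.-1))).
  apply: power_sum_small; rewrite subn_gt0 lt_qk /=.
  by move: k2; rewrite mul2n -addnn ltn_add2r.
move=> x _; have [->|x0] := eqVneq x 0.
  by rewrite !expr0n addn_eq0 !gtn_eqF ?subn_gt0.
by rewrite exprD Fp_exp_predp // mulr1.
Qed.

(** In the binomial expansion only the exponent q - 1 contributes. It occurs when q - 1 <= A + B,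
    with the coefficient C(B, q - 1 - A) up to sign, prime to q since B < q. *)
Lemma beta_sum A B : (0 < A < q.-1)%N -> (0 < B < q.-1)%N ->
  (\sum_(x : 'F_q) x ^+ A * (1 - x) ^+ B == 0) = (A + B < q.-1)%N.
Proof.
case/andP=> A0 Aq /andP[B0 Bq].
have -> : \sum_(x : 'F_q) x ^+ A * (1 - x) ^+ B =
    \sum_(j < B.+1) (-1) ^+ j *+ 'C(B, j) * \sum_(x : 'F_q) x ^+ (A + j).
  under [RHS]eq_bigr do rewrite big_distrr /=.
  rewrite exchange_big /=; apply: eq_bigr => x _.
  rewrite exprDn big_distrr; apply: eq_bigr => j _ /=.
  rewrite expr1n mul1r (exprNn x) exprD mulrnAr mulrnAl; congr (_ *+ _).
  by rewrite mulrCA.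
have Ps (j : 'I_B.+1) : \sum_(x : 'F_q) x ^+ (A + j)
    = if (A + j)%N == q.-1 then -1 else 0.
  by apply: power_sum; have := ltn_ord j; lia.
under eq_bigr do rewrite Ps.
have [ABq|qAB] := ltnP.
  apply/eqP/big1 => j _; rewrite ltn_eqF ?mulr0 //.
  by rewrite (leq_ltn_trans _ ABq) // leq_add2l -ltnS ltn_ord.
have jB : (q.-1 - A < B.+1)%N by rewrite ltnS leq_subLR.
rewrite (bigD1 (Ordinal jB)) //= subnKC ?(ltnW Aq) // eqxx.
rewrite big1 => [|j /eqP jn]; last first.
  case: eqP => [Aj|]; last by rewrite mulr0.
  by case: jn; apply: val_inj; rewrite /= -Aj addKn.
rewrite addr0 mulrN1 oppr_eq0 -mulr_natl mulf_eq0 expf_eq0 oppr_eq0 oner_eq0 andbF.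
rewrite orbF -(dvdn_pcharf (pchar_Fp q_pr)); apply/negP => qC.
have : (q %| B`!)%N by rewrite -(bin_fact (_ : q.-1 - A <= B)%N) // dvdn_mulr.
by move/(prime_dvd_fact q_pr); rewrite leqNgt => /negP; apply; lia.
Qed.

End PowerSums.

(** * Stickelberger's relation for Jacobi sums *)

Section JacobiElement.
Variables (l : nat) (l_pr : prime l) (z : algC) (prim_z : l.-primitive_root z).
Variables (q : nat) (q_pr : prime q) (ql : coprime q l) (lq : (l %| q.-1)%N).
Variables (r : 'F_q) (prim_r : l.-primitive_root r).
Variables (i : nat) (i_gt0 : (0 < i)%N) (i_lt : (i < l.-1)%N).

Let t := (q.-1 %/ l)%N.

Let tl : (t * l)%N = q.-1. Proof. exact: divnK. Qed.

Let q1_gt0 : (0 < q.-1)%N. Proof. by have := prime_gt1 q_pr; lia. Qed.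

Let t_gt0 : (0 < t)%N. Proof. by have := q1_gt0; rewrite -tl; case: (t). Qed.

(** The discrete logarithm of x^t to the base r; at x = 0 it takes a default value, masked in
    [chi]. *)
Let dl (x : 'F_q) : nat := odflt (Ordinal (prime_gt0 l_pr)) [pick j : 'I_l | x ^+ t == r ^+ j].

Let dlP x : x != 0 -> r ^+ dl x = x ^+ t.
Proof.
move=> x0; rewrite /dl; case: pickP => [j /eqP-> //|H].
have xt1 : (x ^+ t) ^+ l = 1 by rewrite -exprM tl Fp_exp_predp.
by have [j Dj] := prim_rootP prim_r xt1; have := H j; rewrite Dj eqxx.
Qed.

Let chi (x : 'F_q) : algC := if x == 0 then 0 else z ^+ dl x.

Let chi0 : chi 0 = 0. Proof. by rewrite /chi eqxx. Qed.

Let zE a b : r ^+ a = r ^+ b -> z ^+ a = z ^+ b.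
Proof.
by move/eqP; rewrite (eq_prim_root_expr prim_r) -(eq_prim_root_expr prim_z) => /eqP.
Qed.

Let chiM x y : chi (x * y) = chi x * chi y.
Proof.
rewrite /chi mulf_eq0; case: eqVneq => [_|x0] /=; first by rewrite mul0r.
case: eqVneq => [_|y0]; first by rewrite mulr0.
by rewrite -exprD; apply: zE; rewrite exprD !dlP ?mulf_neq0 // exprMn.
Qed.

Let chi1 : chi 1 = 1.
Proof.
rewrite /chi oner_eq0 -(expr0 z); apply: zE.
by rewrite dlP ?oner_eq0 // expr1n expr0.
Qed.

Let chiXM k x y : chi (x * y) ^+ k = chi x ^+ k * chi y ^+ k.
Proof. by rewrite chiM exprMn. Qed.

Let chiX_sum k : ~~ (l %| k)%N -> \sum_x chi x ^+ k = 0.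
Proof.
move=> lk; have [|g g0 gt] := @Fp_exp_neq1 q q_pr t.
  by rewrite t_gt0 -tl ltn_Pmulr // prime_gt1.
apply: (char_sum0 (g := g)) => //; rewrite /chi (negPf g0) -exprM.
rewrite -(prim_order_dvd prim_z) Euclid_dvdM // negb_or lk andbT.
by rewrite (prim_order_dvd prim_r) dlP.
Qed.

(** The Jacobi sum of chi and chi^i, kept as a polynomial so that it can be evaluated both at [z]
    and at the residues r^a. The characters vanish at the omitted terms. *)
Let JP : {poly int} :=
  \sum_(x : 'F_q | (x != 0) && (x != 1)) 'X^(dl x + i * dl (1 - x)).
Let JP' : {poly int} :=
  \sum_(x : 'F_q | (x != 0) && (x != 1)) 'X^(l.-1 * (dl x + i * dl (1 - x))).

Let evJP : ev z JP = \sum_x chi x * chi (1 - x) ^+ i.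
Proof.
rewrite (bigID (fun x : 'F_q => (x != 0) && (x != 1))) /= addrC big1 ?add0r.
  rewrite rmorph_sum; apply: eq_bigr => x /andP[x0 x1] /=.
  rewrite rmorphXn /= evX exprD mulnC exprM /chi (negPf x0) subr_eq0.
  by rewrite eq_sym (negPf x1).
move=> x; rewrite negb_and !negbK => /orP[]/eqP->; first by rewrite chi0 mul0r.
by rewrite subrr chi0 expr0n gtn_eqF // mulr0.
Qed.

Let evJP' : ev z JP' = \sum_x (chi x)^-1 * (chi (1 - x) ^+ i)^-1.
Proof.
rewrite (bigID (fun x : 'F_q => (x != 0) && (x != 1))) /= addrC big1 ?add0r.
  rewrite rmorph_sum; apply: eq_bigr => x /andP[x0 x1] /=.
  rewrite rmorphXn /= evX -invfM /chi (negPf x0) subr_eq0.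
  rewrite eq_sym (negPf x1) -exprM -exprD [(_ * i)%N]mulnC.
  set a := (_ + _)%N; apply: (mulfI (expf_neq0 a (prim_root_neq0 prim_z))).
  rewrite divff ?expf_neq0 ?(prim_root_neq0 prim_z) // -exprD -{1}[a]mul1n -mulnDl.
  by rewrite add1n prednK ?prime_gt0 // exprM (prim_expr_order prim_z) expr1n.
move=> x; rewrite negb_and !negbK => /orP[]/eqP->; first by rewrite chi0 invr0 mul0r.
by rewrite subrr chi0 expr0n gtn_eqF // invr0 mulr0.
Qed.

Let J_norm : ev z JP * ev z JP' = q%:R.
Proof.
rewrite evJP evJP' (jacobi_norm (psi := fun x => chi x ^+ i)) //.
- by rewrite card_Fp.
- by rewrite chi0 expr0n gtn_eqF.
- by rewrite chi1 expr1n.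
- under eq_bigr do rewrite -[chi _]expr1; apply: chiX_sum.
  by rewrite dvdn1 neq_ltn prime_gt1 ?orbT.
- by apply: chiX_sum; rewrite gtnNdvd //; lia.
by under eq_bigr do rewrite -exprS; apply: chiX_sum; rewrite gtnNdvd //; lia.
Qed.

Let JP_neq0 : (ev z JP != 0) && (ev z JP' != 0).
Proof. by rewrite -negb_or -mulf_eq0 J_norm pnatr_eq0 -lt0n prime_gt0. Qed.

(** At the place z |-> r^a the character chi becomes the power x^(at), so the Jacobi sum reduces to
    the sum of [beta_sum]. *)
Let ev_ra a : (0 < a < l)%N ->
  (ev (r ^+ a) JP == 0) = (a + (a * i) %% l < l)%N.
Proof.
move=> /andP[a0 al]; pose b := ((a * i) %% l)%N.
have b0 : (0 < b)%N.
  by rewrite lt0n -/(dvdn _ _) Euclid_dvdM // negb_or !gtnNdvd //; lia.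
have bl : (b < l)%N by rewrite ltn_mod prime_gt0.
have -> : ev (r ^+ a) JP = \sum_(x : 'F_q) x ^+ (a * t) * (1 - x) ^+ (b * t).
  rewrite (bigID (fun x : 'F_q => (x != 0) && (x != 1))) /= addrC big1 ?add0r.
    rewrite rmorph_sum; apply: eq_bigr => x /andP[x0 x1] /=.
    have y0 : 1 - x != 0 by rewrite subr_eq0 eq_sym.
    rewrite rmorphXn /= evX -exprM mulnDr exprD; congr (_ * _).
      by rewrite mulnC exprM dlP // -exprM mulnC.
    rewrite mulnA mulnC exprM dlP // -!exprM.
    rewrite {1}(divn_eq (a * i) l) -/b mulnDr [(_ %/ _ * l)%N]mulnC mulnA tl.
    by rewrite exprD exprM Fp_exp_predp // expr1n mul1r mulnC.
  move=> x; rewrite negb_and !negbK => /orP[]/eqP->.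
    by rewrite expr0n muln_eq0 !gtn_eqF // mul0r.
  by rewrite subrr expr0n muln_eq0 !gtn_eqF // mulr0.
rewrite beta_sum // -tl; last 2 first.
- by rewrite muln_gt0 a0 t_gt0 mulnC ltn_pmul2l.
- by rewrite muln_gt0 b0 t_gt0 mulnC ltn_pmul2l.
by rewrite -mulnDl mulnC ltn_pmul2l.
Qed.

(** The product with the conjugate sum is q, so the valuations are 0 away from q and 0 or 1 above q;
    [ev_ra] decides between the two. *)
Lemma jacobi_element : exists J, [/\ fixF z J, J != 0,
  (forall p : place z, pl_q p != q -> pval p J = 0) &
  (forall a (prim_ra : l.-primitive_root (r ^+ a)), (0 < a < l)%N ->
     pval (uplace prim_z q_pr ql (pchar_Fp q_pr) prim_ra) J
       = (a + (a * i) %% l < l)%N%:Z)].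
Proof.
have /andP[J0 J0'] := JP_neq0.
have vJ (p : place z) : pval p (ev z JP) + pval p (ev z JP') = pval p (q%:R : algC).
  by rewrite -J_norm pvalM //; exact: fixF_ev.
have v0 (p : place z) := (pval_ev_ge0 p J0, pval_ev_ge0 p J0').
exists (ev z JP); split=> // [|p pq|a prim_ra al]; first exact: fixF_ev.
  have : pval p (q%:R : algC) = 0.
    rewrite -(rmorph_nat (ev z)); apply/pval_unit/unitp_ev.
    rewrite rmorph_nat -(dvdn_pcharf (pl_char p)).
    by rewrite dvdn_prime2 // pl_prime.
  by move: (vJ p) (v0 p) => <- [] *; apply/eqP; rewrite eq_le; lia.
set p := uplace _ _ _ _ _; have vq : pval p (q%:R : algC) = 1.
  exact/pvalE/uplace_isvalw.
have := pval_ev_gt0 p J0; rewrite [pl_r _]/= ev_ra // => vJa.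
move: (vJ p) (v0 p) vJa; rewrite vq => + [].
by case: (_ < _)%N => /=; lia.
Qed.

End JacobiElement.

(** * The multiplicative group of Q(zeta_l) modulo l-th powers *)

Section ModPowers.
Variables (l : nat) (l_pr : prime l) (z : algC) (prim_z : l.-primitive_root z).

Definition eqpow (x y : algC) :=
  exists xi, [/\ fixF z xi, xi != 0 & x = y * xi ^+ l].

Lemma eqpow_refl x : eqpow x x.
Proof. by exists 1; rewrite oner_eq0 expr1n mulr1; split=> //; exact: fixF1. Qed.

Lemma eqpow_trans y x w : eqpow x y -> eqpow y w -> eqpow x w.
Proof.
move=> [a [Fa a0 ->]] [b [Fb b0 ->]]; exists (b * a).
by rewrite mulf_neq0 // exprMn mulrA; split=> //; exact: fixFM.
Qed.

Lemma eqpow_sym x y : eqpow x y -> eqpow y x.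
Proof.
move=> [a [Fa a0 ->]]; exists a^-1; rewrite invr_eq0; split=> //.
  exact: fixFV.
by rewrite exprVn mulfK ?expf_neq0.
Qed.

Lemma eqpowM x y x' y' : eqpow x y -> eqpow x' y' -> eqpow (x * x') (y * y').
Proof.
move=> [a [Fa a0 ->]] [b [Fb b0 ->]]; exists (a * b).
by rewrite mulf_neq0 // exprMn mulrACA; split=> //; exact: fixFM.
Qed.

Lemma eqpowV x y : eqpow x y -> eqpow x^-1 y^-1.
Proof.
move=> [a [Fa a0 ->]]; exists a^-1; rewrite invr_eq0; split=> //.
  exact: fixFV.
by rewrite invfM exprVn.
Qed.

Lemma eqpowXz x y (c : int) : eqpow x y -> eqpow (x ^ c) (y ^ c).
Proof.
move=> xy; have H n : eqpow (x ^+ n) (y ^+ n).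
  by elim: n => [|n IH]; [exact: eqpow_refl | rewrite !exprS; exact: eqpowM].
by case: c => n; [exact: H | exact/eqpowV/H].
Qed.

Lemma eqpow_aut (nu : {rmorphism algC -> algC}) a x y : nu z = z ^+ a -> eqpow x y -> eqpow (nu x) (nu y).
Proof.
move=> nuz [xi [Fxi xi0 ->]]; exists (nu xi).
by rewrite fmorph_eq0 rmorphM rmorphXn; split=> //; exact: fixF_aut nuz Fxi.
Qed.

Lemma eqpow_prod (I : Type) (s : seq I) (P : pred I) (f g : I -> algC) :
  (forall i, P i -> eqpow (f i) (g i)) ->
  eqpow (\prod_(i <- s | P i) f i) (\prod_(i <- s | P i) g i).
Proof.
by move=> fg; apply: (big_ind2 eqpow) => //; [exact: eqpow_refl|exact: eqpowM].
Qed.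

Lemma eqpow_lpow x : fixF z x -> x != 0 -> eqpow (x ^+ l) 1.
Proof. by move=> Fx x0; exists x; rewrite mul1r. Qed.

(** Some automorphism with z |-> z^a, determined only on Q(z); the identity is a default value when
    [a] is not prime to l. *)
Definition sg (a : nat) : {rmorphism algC -> algC} :=
  if pselect (coprime a l) is left co then sval (Qn_aut_exists co) else idfun.

Lemma sgE a : coprime a l -> sg a z = z ^+ a.
Proof.
rewrite /sg; case: pselect => // co _; case: (Qn_aut_exists co) => nu /= -> //.
exact: prim_expr_order.
Qed.

Lemma sg_fixF a x : fixF z x -> fixF z (sg a x).
Proof.
move=> Fx; have [co|nco] := boolP (coprime a l).
  exact: fixF_aut (sgE co) Fx.
by rewrite /sg; case: pselect => // co; rewrite co in nco.
Qed.

Lemma coprime_l a : coprime a l = ~~ (l %| a)%N.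
Proof. by rewrite coprime_sym prime_coprime. Qed.

Section Vu.
Variables (q : nat) (q_pr : prime q) (ql : coprime q l).
Variables (K : fieldType) (qK : q \in [pchar K]).
Implicit Types (r : K) (x y : algC).

(* The valuation at the place z |-> r, or 0 if this is not a place. *)
Definition vu r x : int :=
  if pselect (l.-primitive_root r) is left pr
  then pval (uplace prim_z q_pr ql qK pr) x else 0.

Lemma vuE r (pr : l.-primitive_root r) x :
  vu r x = pval (uplace prim_z q_pr ql qK pr) x.
Proof.
rewrite /vu; case: pselect => [pr'|//].
by rewrite (bool_irrelevance pr' pr).
Qed.

Lemma vuM r x y : fixF z x -> fixF z y -> x != 0 -> y != 0 ->
  vu r (x * y) = vu r x + vu r y.
Proof. by rewrite /vu; case: pselect => // pr; apply: pvalM. Qed.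

Lemma vuV r x : fixF z x -> x != 0 -> vu r x^-1 = - vu r x.
Proof. by rewrite /vu; case: pselect => // pr; apply: pvalV. Qed.

Lemma vu_div r x y : fixF z x -> fixF z y -> x != 0 -> y != 0 ->
  vu r (x / y) = vu r x - vu r y.
Proof.
by move=> Fx Fy x0 y0; rewrite vuM ?vuV ?invr_eq0 //; exact: fixFV.
Qed.

Lemma vuX r x n : fixF z x -> x != 0 -> vu r (x ^+ n) = vu r x *+ n.
Proof. by rewrite /vu; case: pselect => [pr|]; [apply: pvalX|rewrite mul0rn]. Qed.

Lemma vuXz r x n : fixF z x -> x != 0 -> vu r (x ^ n) = vu r x *~ n.
Proof. by rewrite /vu; case: pselect => [pr|]; [apply: pvalXz|rewrite mul0rz]. Qed.

Lemma vu_prod r (I : Type) (s : seq I) (Q : pred I) (F : I -> algC) :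
  (forall i, Q i -> fixF z (F i)) -> (forall i, Q i -> F i != 0) ->
  vu r (\prod_(i <- s | Q i) F i) = \sum_(i <- s | Q i) vu r (F i).
Proof.
by rewrite /vu; case: pselect => [pr|]; [apply: pval_prod|rewrite big1].
Qed.

Lemma vu_aut r (nu : {rmorphism algC -> algC}) a x :
  l.-primitive_root r -> nu z = z ^+ a -> coprime a l -> fixF z x -> x != 0 ->
  vu r (nu x) = vu (r ^+ a) x.
Proof.
move=> pr nuz co Fx x0.
have pr' : l.-primitive_root (r ^+ a) by rewrite prim_root_exp_coprime.
by rewrite (vuE pr) (vuE pr'); apply: pval_uplace_sub nuz _ Fx x0.
Qed.

Lemma vu_frob r (nu : {rmorphism algC -> algC}) x :
  nu z = z ^+ q -> fixF z x -> x != 0 -> vu r (nu x) = vu r x.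
Proof.
by move=> nuz; rewrite /vu; case: pselect => // pr; apply: pval_uplace_frob.
Qed.

End Vu.

End ModPowers.

(** The numerator divides a nonzero integer c and the denominator is N, so only residue
    characteristics up to |c| + N can occur. *)
Lemma pval_bound (z x : algC) : fixF z x -> x != 0 ->
  exists B, forall p : place z, (B <= pl_q p)%N -> pval p x = 0.
Proof.
move=> /fixF_frac[P [N [N0 ->]]]; rewrite mulf_eq0 negb_or => /andP[P0 _].
have [g [c [c0 Dc]]] := algC_int_norm P0.
exists (`|c| + N).+1%N => p Bp.
have nat0 n : (0 < n < pl_q p)%N -> pval p n%:R = 0.
  move=> /andP[n0 np]; rewrite -(rmorph_nat (ev z)); apply/pval_unit/unitp_ev.
  by rewrite rmorph_nat -(dvdn_pcharf (pl_char p)) gtnNdvd.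
have N0C : N%:R != 0 :> algC by rewrite pnatr_eq0 -lt0n.
rewrite pvalM ?invr_eq0 ?pvalV //; [|exact: fixF_nat|exact: fixF_ev|exact/fixFV/fixF_nat].
rewrite (nat0 N) ?subr0; last by lia.
have c1 : pval p (c%:~R : algC) = 0.
  rewrite -(evC z); apply/pval_unit/unitp_ev; rewrite evC.
  rewrite -(dvdz_pcharf (pl_char p)) dvdzE gtnNdvd //; lia.
have gP0 : ev z (g \Po P) != 0.
  rewrite ev_comp; apply: contra_eq_neq Dc => ->.
  by rewrite mulr0 eq_sym intr_eq0.
have := c1; rewrite -Dc -ev_comp pvalM //; try exact: fixF_ev.
by have := pval_ev_ge0 p P0; have := pval_ev_ge0 p gP0; lia.
Qed.

(** * Nonvanishing of a Stickelberger exponent modulo l *)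

Section FlIndex.
Variables (l : nat) (l_pr : prime l).
Implicit Types x y i : 'F_l.

Lemma Fl_valM x y : (x * y : 'F_l) = ((x * y)%N %% l)%N :> nat.
Proof. by rewrite /=; congr (_ %% _)%N; exact: Fp_cast. Qed.

Lemma Fl_lt x : (x < l)%N.
Proof. by apply: leq_trans (ltn_ord x) _; rewrite Fp_cast. Qed.

Lemma Fl_gt0 x : x != 0 -> (0 < x < l)%N.
Proof. by move=> x0; rewrite Fl_lt lt0n andbT. Qed.

Lemma Fl_coprime x : x != 0 -> coprime x l.
Proof. by move=> /Fl_gt0/andP[x0 xl]; rewrite coprime_sym prime_coprime // gtnNdvd. Qed.

Lemma Fl_natE x : (x : nat)%:R = x :> 'F_l.
Proof. exact: natr_Zp. Qed.

(** The exponents x for which the Jacobi sum of chi and chi^i has valuation 1 at z |-> r^x. *)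
Definition Hset i x := (x + nat_of_ord (x * i)%R < l)%N.

(** The exponent by which the Stickelberger element, the sum of sigma_x^(-1) over [Hset i], acts on
    the class of an eigenvector. *)
Definition Hsum i : 'F_l := \sum_(x | (x != 0) && Hset i x) x^-1.

(** With y = xi the condition reads 1 <= y < l - x; the excluded index i = -1 corresponds to y = l -
    x, just outside the range. *)
Lemma Hset_count x : x != 0 ->
  \sum_(i | (i != 0) && (i != -1) && Hset i x) (1 : 'F_l) = - 1 - x.
Proof.
move=> x0; have /andP[xg0 xl] := Fl_gt0 x0.
rewrite (reindex_inj (mulfI (invr_neq0 x0))) /=.
have vN : (x + nat_of_ord (- x)%R)%N = l.
  have : (x + nat_of_ord (- x)%R)%N%:R = 0 :> 'F_l.
    by rewrite natrD !Fl_natE subrr.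
  move/eqP; rewrite -(dvdn_pcharf (pchar_Fp l_pr)) => /dvdnP[k Dk].
  have := Fl_lt (- x); case: k Dk => [|[|k]] Dk; rewrite Dk ?mul1n //; first lia.
  by move: Dk; rewrite mulSn mulSn; lia.
rewrite (eq_bigl (fun y : 'F_l => (1 <= y < l - x)%N)) => [|y]; last first.
  rewrite /Hset mulrA divff // mul1r mulf_eq0 invr_eq0 (negPf x0) /= ltn_subRL.
  rewrite -[y != 0]lt0n; case: ltnP => //= y0.
  have [|_//] := eqVneq (x^-1 * y) (-1) => /= /(congr1 (fun u => x * u)).
  by rewrite mulrA divff // mul1r mulrN1 => ->; rewrite vN ltnn.
have cnt n (a : nat) : n = l ->
    \sum_(y : 'I_n | (1 <= y < l - a)%N) (1 : 'F_l) = (l - a - 1)%:R.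
  move=> ->; rewrite -(big_mkord (fun k => (1 <= k < l - a)%N) (fun=> 1)).
  rewrite -(@big_nat_widen _ _ _ 0 (l - a) l) ?leq_subr //.
  by rewrite -(@big_nat_widenl _ _ _ 1 0 _ xpredT) // sumr_const_nat.
rewrite (cnt _ x (Fp_cast l_pr)) -subnDA natrB ?addn1 // -(addn1 x) natrD Fl_natE.
by rewrite (pcharf0 (pchar_Fp l_pr)) sub0r opprD addrC.
Qed.

(** By [Hset_count] the sum of all the [Hsum i] is that of -1/x - 1 over nonzero x. For l > 2 the
    inverses add up to 0, so the total is 1. *)
Lemma Hsum_neq0 : (2 < l)%N -> exists i, [/\ i != 0, i != -1 & Hsum i != 0].
Proof.
move=> l2; apply: contrapT => H.
have : \sum_(i | (i != 0) && (i != -1)) Hsum i = 0.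
  apply: big1 => i /andP[i0 i1]; apply/eqP/negPn/negP => Hi.
  by apply: H; exists i.
under eq_bigr do rewrite /Hsum big_mkcondr /=.
rewrite exchange_big /= (eq_bigr (fun x => - x^-1 - 1)).
  rewrite sumrB sumrN (reindex_inj invr_inj) /=.
  under eq_bigl do rewrite invr_eq0.
  under eq_bigr do rewrite invrK.
  have := @power_sum_small l l_pr 1; rewrite (bigD1 0) //= add0r => ->; last by lia.
  have : \sum_(x : 'F_l) (1 : 'F_l) = 0.
    by rewrite sumr_const card_Fp // (pcharf0 (pchar_Fp l_pr)).
  rewrite (bigD1 0) //= => /eqP; rewrite addrC addr_eq0 => /eqP ->.
  by move/eqP; rewrite oppr0 sub0r opprK oner_eq0.
move=> x x0; rewrite -big_mkcondr /=.
rewrite (eq_bigr (fun=> x^-1 * 1)) => [|i _]; last by rewrite mulr1.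
rewrite -big_distrr /= Hset_count // mulrBr mulrN1 mulVf //.
Qed.

End FlIndex.

(** * The operators 1 - sigma_d *)

Section Theta.
Variables (l : nat) (l_pr : prime l) (z : algC) (prim_z : l.-primitive_root z).
Variable mu : algC.
Hypotheses (Fmu : fixF z mu) (mu0 : mu != 0).
Hypothesis mu_eigen :
  forall a, coprime a l -> eqpow l z (sg l a mu) (mu ^+ a).

Lemma eigen_eqpow a x (c : int) : coprime a l -> eqpow l z x (mu ^ c) ->
  eqpow l z (sg l a x) (mu ^ (c * a)).
Proof.
move=> co xc; apply: eqpow_trans (eqpow_aut (sgE prim_z co) xc) _.
rewrite fmorphXz mulrC -exprz_exp -exprnP.
exact/eqpowXz/mu_eigen.
Qed.

(** The product of the group ring elements 1 - sigma_d, written multiplicatively: it kills every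
    valuation fixed by one of the sigma_d. *)
Definition theta (s : seq nat) (x : algC) := foldr (fun d y => y / sg l d y) x s.

Lemma theta_fixF s x : fixF z x -> fixF z (theta s x).
Proof.
by move=> Fx; elim: s => //= d s IH; apply: fixF_div => //; exact: (sg_fixF prim_z).
Qed.

Lemma theta_neq0 s x : x != 0 -> theta s x != 0.
Proof.
by move=> x0; elim: s => //= d s IH; rewrite mulf_neq0 ?invr_eq0 ?fmorph_eq0.
Qed.

Lemma theta_eqpow s x (c : int) : all (fun d => coprime d l) s ->
  eqpow l z x (mu ^ c) ->
  eqpow l z (theta s x) (mu ^ (c * \prod_(d <- s) (1 - d%:Z))).
Proof.
move=> /[swap] xc; elim: s => [|d s IH] /=; first by rewrite big_nil mulr1.
case/andP=> co /IH{}IH; rewrite big_cons mulrCA mulrBl mul1r expfzDr //.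
apply: eqpowM => //; rewrite mulrC -invr_expz; apply: eqpowV.
exact: eigen_eqpow.
Qed.

Section ThetaVu.
Variables (q : nat) (q_pr : prime q) (ql : coprime q l).
Variables (K : fieldType) (qK : q \in [pchar K]) (r : K).
Hypothesis prim_r : l.-primitive_root r.
Local Notation v := (vu prim_z q_pr ql qK).

Let prim_ra a : coprime a l -> l.-primitive_root (r ^+ a).
Proof. by move=> co; rewrite prim_root_exp_coprime. Qed.

(* For m = 0 divisibility by m means vanishing. *)
Lemma theta_vu_dvd (m : nat) s x : all (fun d => coprime d l) s ->
  fixF z x -> x != 0 ->
  (forall a, coprime a l -> (m %| v (r ^+ a) x)%Z) ->
  forall a, coprime a l -> (m %| v (r ^+ a) (theta s x))%Z.
Proof.
move=> + Fx x0 vx; elim: s => //= d s IH /andP[co /IH{}IH] a coa.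
have Fy := @theta_fixF s x Fx; have y0 := @theta_neq0 s x x0.
rewrite vu_div ?fmorph_eq0 //; last exact: (sg_fixF prim_z).
rewrite rpredB ?IH // (vu_aut prim_z q_pr ql qK (prim_ra coa) (sgE prim_z co)) //.
by rewrite -exprM IH // coprimeMl coa.
Qed.

(** Frobenius at q, which is sigma_d with d the residue of q, fixes the places above q; the factor 1
    - sigma_d therefore kills these valuations, and the later factors preserve their vanishing. *)
Lemma theta_vu0 s x : all (fun d => coprime d l) s -> fixF z x -> x != 0 ->
  (q %% l)%N \in s ->
  forall a, coprime a l -> v (r ^+ a) (theta s x) = 0.
Proof.
move=> + Fx x0; elim: s => //= d s IH /andP[co cos]; rewrite inE.
have Fy := @theta_fixF s x Fx; have y0 := @theta_neq0 s x x0.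
case/predU1P=> [Dd|qs] a coa; last first.
  apply/eqP; rewrite -dvd0z.
  have cods : all (fun d => coprime d l) [:: d] by rewrite /= co.
  apply: (@theta_vu_dvd 0 [:: d] (theta s x)) => // b cob.
  by rewrite dvd0z IH.
rewrite vu_div ?fmorph_eq0 //; last exact: (sg_fixF prim_z).
rewrite vu_frob ?subrr //.
by rewrite sgE // -Dd prim_expr_mod.
Qed.

End ThetaVu.

Lemma theta_lplace0 s x : all (fun d => coprime d l) s -> s != [::] ->
  fixF z x -> x != 0 -> pval (lplace l_pr prim_z) (theta s x) = 0.
Proof.
case: s => //= d s /andP[co cos] _ Fx x0.
have Fy := @theta_fixF s x Fx; have y0 := @theta_neq0 s x x0.
have Fsy : fixF z (sg l d (theta s x)) by exact: (sg_fixF prim_z).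
rewrite pvalM ?pvalV ?invr_eq0 ?fmorph_eq0 //; last exact: fixFV.
by rewrite (pval_lplace_aut l_pr prim_z (sgE prim_z co)) ?subrr // -coprime_l.
Qed.

End Theta.

Lemma Fp_prim_root (l q : nat) : prime l -> prime q -> (l %| q.-1)%N ->
  exists r : 'F_q, l.-primitive_root r.
Proof.
move=> l_pr q_pr lq; pose t := (q.-1 %/ l)%N; have tl : (t * l)%N = q.-1 by exact: divnK.
have q1 : (0 < q.-1)%N by have := prime_gt1 q_pr; lia.
have t0 : (0 < t)%N by move: q1; rewrite -tl; case: (t).
have [|g g0 gt] := @Fp_exp_neq1 q q_pr t.
  by rewrite t0 -tl ltn_Pmulr // prime_gt1.
exists (g ^+ t); have gl : (g ^+ t) ^+ l = 1 by rewrite -exprM tl Fp_exp_predp.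
have [m prim_m ml] := prim_order_exists (prime_gt0 l_pr) gl.
move/primeP: l_pr => [_ /(_ m ml)] /orP[]/eqP Dm; rewrite Dm in prim_m => //.
by have := prim_expr_order prim_m; rewrite expr1 => /eqP; rewrite (negPf gt).
Qed.

(** * From the eigenvector to a unit *)

Section UnitExists.
Variables (l : nat) (l_pr : prime l) (l_gt2 : (2 < l)%N).
Variables (z : algC) (prim_z : l.-primitive_root z).
Variable mu : algC.
Hypotheses (Fmu : fixF z mu) (mu0 : mu != 0).
Hypothesis mu_eigen :
  forall a, coprime a l -> eqpow l z (sg l a mu) (mu ^+ a).
Hypothesis mu_dvd : forall q (q_pr : prime q) (ql : coprime q l) (r : 'F_q),
  (l %| q.-1)%N -> l.-primitive_root r ->
  (l %| vu prim_z q_pr ql (pchar_Fp q_pr) r mu)%Z.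

(** All nonzero residues other than 1: they cover every prime q prime to l and not congruent to 1
    modulo l, while the product of the 1 - d stays prime to l. *)
Let S := iota 2 (l - 2).

Let coS : all (fun d => coprime d l) S.
Proof.
apply/allP => d; rewrite mem_iota => dl.
by rewrite coprime_l // gtnNdvd //; lia.
Qed.

Let mu1 := theta l S mu.
Let Fmu1 : fixF z mu1. Proof. exact: theta_fixF. Qed.
Let mu10 : mu1 != 0. Proof. exact: theta_neq0. Qed.
Let c1 : int := \prod_(d <- S) (1 - d%:Z).

Let mu1_eqpow : eqpow l z mu1 (mu ^ c1).
Proof.
rewrite -[c1]mul1r; apply: (theta_eqpow prim_z) => //; exact: eqpow_refl.
Qed.

Let c1_neq0 : (c1%:~R : 'F_l) != 0.
Proof.
rewrite rmorph_prod /= prodf_seq_neq0; apply/allP => d; rewrite mem_iota => dl /=.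
rewrite rmorphB /= subr_eq0 rmorph1 -[d%:~R]/(d%:R) -[1]/(1%:R).
rewrite -subr_eq0 -opprB oppr_eq0 -natrB; last by lia.
by rewrite -(dvdn_pcharf (pchar_Fp l_pr)) gtnNdvd //; lia.
Qed.

Variables (i : 'F_l) (i0 : i != 0) (i1 : i != -1) (Hi : Hsum i != 0).

(** The conditions on q are premises, so that [rr] and [JJ] can be chosen simultaneously for all
    q. *)
Let jac_spec q (rJ : 'F_q * algC) :=
  forall (q_pr : prime q) (ql : coprime q l), (l %| q.-1)%N ->
  [/\ l.-primitive_root rJ.1, fixF z rJ.2, rJ.2 != 0,
      (forall p : place z, pl_q p != q -> pval p rJ.2 = 0) &
      (forall x : 'F_l, x != 0 ->
         vu prim_z q_pr ql (pchar_Fp q_pr) (rJ.1 ^+ x) rJ.2 = (Hset i x)%:Z)].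

Let jac_exists q : exists rJ : 'F_q * algC, jac_spec rJ.
Proof.
have [/and3P[q_pr ql lq]|H] := boolP [&& prime q, coprime q l & (l %| q.-1)%N]; last first.
  by exists (0, 0) => q_pr ql lq; rewrite q_pr ql lq in H.
have [r prim_r] := Fp_prim_root l_pr q_pr lq.
have ig0 : (0 < i)%N by have /andP[] := Fl_gt0 l_pr i0.
have il : (i < l.-1)%N.
  have [//|le] := ltnP i l.-1; have Di : i = l.-1 :> nat.
    by apply/eqP; rewrite eqn_leq le andbT -ltnS prednK ?prime_gt0 // Fl_lt.
  case/eqP: i1; rewrite -(Fl_natE i) Di.
  by rewrite -subn1 natrB ?prime_gt0 // (pcharf0 (pchar_Fp l_pr)) sub0r.
have [J [FJ J0 Jp Jv]] := jacobi_element l_pr prim_z q_pr ql lq prim_r ig0 il.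
exists (r, J) => q_pr' ql' _; split=> // x x0 /=.
have prim_rx : l.-primitive_root (r ^+ x).
  by rewrite prim_root_exp_coprime // Fl_coprime.
rewrite (vuE _ _ _ _ prim_rx) (bool_irrelevance q_pr' q_pr).
by rewrite (bool_irrelevance ql' ql) Jv ?Fl_gt0 // /Hset Fl_valM.
Qed.

Let rr q : 'F_q := (sval (cid (jac_exists q))).1.
Let JJ q : algC := (sval (cid (jac_exists q))).2.
Let jacP q (q_pr : prime q) (ql : coprime q l) := svalP (cid (jac_exists q)) q_pr ql.

Let ok q := [&& prime q, coprime q l & (l %| q.-1)%N].

Let V q (x : 'F_l) : int :=
  if pselect (prime q /\ coprime q l) is left h
  then vu prim_z h.1 h.2 (pchar_Fp h.1) (rr q ^+ x) mu1 else 0.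

Let VE q (q_pr : prime q) (ql : coprime q l) x :
  V q x = vu prim_z q_pr ql (pchar_Fp q_pr) (rr q ^+ x) mu1.
Proof.
rewrite /V; case: pselect => [[a b]|[]//] /=.
by rewrite (bool_irrelevance a q_pr) (bool_irrelevance b ql).
Qed.

Let V_dvd q x : ok q -> x != 0 -> (l %| V q x)%Z.
Proof.
move=> /and3P[q_pr ql lq] x0; rewrite (VE q_pr ql).
have [prim_r _ _ _ _] := jacP q_pr ql lq.
apply: theta_vu_dvd => //; last exact: Fl_coprime.
move=> a coa; apply: mu_dvd => //.
by rewrite prim_root_exp_coprime.
Qed.

(** Since l divides the valuations [V q x], the exponents are integers. The l-th power of this
    product has above q the valuations that the Stickelberger element produces from [mu1]. *)
Let Gq q := \prod_(x : 'F_l | x != 0) sg l (x^-1 : 'F_l) (JJ q) ^ (V q x %/ l)%Z.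

Let okJ q : ok q -> fixF z (JJ q) /\ JJ q != 0.
Proof. by move=> /and3P[q_pr ql lq]; have [_ FJ J0 _ _] := jacP q_pr ql lq. Qed.

Let FsJ q (x : 'F_l) : ok q -> fixF z (sg l (x^-1 : 'F_l) (JJ q)).
Proof. by move=> /okJ[FJ _]; exact: (sg_fixF prim_z). Qed.

Let FGq q : ok q -> fixF z (Gq q).
Proof. by move=> okq; apply: fixF_prod => x _; apply/fixFXz/FsJ. Qed.

Let Gq0 q : ok q -> Gq q != 0.
Proof.
move=> okq; apply/prodf_neq0 => x _; apply: expfz_neq0.
by rewrite fmorph_eq0; have [] := okJ okq.
Qed.

Variable B : nat.
Hypothesis B_bound : forall p : place z, (B <= pl_q p)%N -> pval p mu1 = 0.

Let Gam := \prod_(q <- iota 0 B | ok q) Gq q.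
Let FGam : fixF z Gam. Proof. exact: fixF_prod. Qed.
Let Gam0 : Gam != 0.
Proof. by rewrite prodf_seq_neq0; apply/allP => q _; apply/implyP/Gq0. Qed.

Let mu2 := \prod_(x : 'F_l | (x != 0) && Hset i x) sg l (x^-1 : 'F_l) mu1.
Let Fsmu x : fixF z (sg l x mu1). Proof. exact: (sg_fixF prim_z). Qed.
Let smu0 x : sg l x mu1 != 0. Proof. by rewrite fmorph_eq0. Qed.
Let Fmu2 : fixF z mu2. Proof. exact: fixF_prod. Qed.
Let mu20 : mu2 != 0. Proof. by apply/prodf_neq0. Qed.

(** The Stickelberger element applied to [mu1], divided by the l-th power of Jacobi elements with
    the same valuations: what remains is a unit. *)
Let eps := mu2 / Gam ^+ l.
Let Feps : fixF z eps. Proof. by apply: fixF_div => //; apply: fixFX. Qed.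
Let eps0 : eps != 0. Proof. by rewrite mulf_neq0 ?invr_eq0 ?expf_neq0. Qed.

Let c2 : int := c1 * \sum_(x : 'F_l | (x != 0) && Hset i x) ((x^-1 : 'F_l) : nat)%:Z.

Let c2_ndvd : ~~ (l %| c2)%Z.
Proof.
rewrite (dvdz_pcharf (pchar_Fp l_pr)) rmorphM rmorph_sum /= mulf_neq0 //.
suff -> : \sum_(x : 'F_l | (x != 0) && Hset i x) ((x^-1 : 'F_l) : nat)%:Z%:~R
  = Hsum i :> 'F_l by [].
by apply: eq_bigr => x _; rewrite -[RHS]Fl_natE.
Qed.

Let eps_eqpow : eqpow l z eps (mu ^ c2).
Proof.
apply: (@eqpow_trans _ _ mu2).
  exists Gam^-1; rewrite invr_eq0 exprVn; split=> //; exact: fixFV.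
have -> : mu ^ c2 = \prod_(x : 'F_l | (x != 0) && Hset i x)
    mu ^ (c1 * ((x^-1 : 'F_l) : nat)).
  rewrite /c2; elim: (index_enum _) => [|x s IH].
    by rewrite !big_nil mulr0 expr0z.
  rewrite !big_cons; case: ifP => // _.
  by rewrite mulrDr expfzDr // IH.
apply: eqpow_prod => x /andP[x0 _]; apply: eigen_eqpow => //.
by rewrite Fl_coprime // invr_eq0.
Qed.

Let coV (x : 'F_l) : x != 0 -> coprime (x^-1 : 'F_l) l.
Proof. by move=> x0; rewrite Fl_coprime // invr_eq0. Qed.

Let eps_lplace : pval (lplace l_pr prim_z) eps = 0.
Proof.
have vs x y : x != 0 -> fixF z y -> y != 0 ->
    pval (lplace l_pr prim_z) (sg l (x^-1 : 'F_l) y) = pval (lplace l_pr prim_z) y.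
  move=> x0; apply: (pval_lplace_aut l_pr prim_z (sgE prim_z (coV x0))).
  by rewrite -coprime_l // coV.
have S0 : S != [::] by rewrite /S; case: (l - 2)%N (subn_gt0 2 l) l_gt2 => // <-.
rewrite pvalM ?pvalV ?invr_eq0 ?expf_neq0 //; try (by apply: fixFX); last first.
  by apply/fixFV/fixFX.
rewrite pvalX // pval_prod // big1 => [|x /andP[x0 _]]; last first.
  by rewrite vs // (theta_lplace0 l_pr prim_z).
rewrite pval_prod // big1 ?mul0rn ?subr0 // => q okq.
have [FJ J0] := okJ okq; have /and3P[q_pr ql lq] := okq.
rewrite pval_prod => [|x _|x _]; first last.
- by rewrite expfz_neq0 // fmorph_eq0.
- exact/fixFXz/FsJ.
apply: big1 => x x0; rewrite pvalXz ?fmorph_eq0 ?vs //; last exact: FsJ.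
have [_ _ _ -> //] := jacP q_pr ql lq; first by rewrite mul0rz.
by apply: contraTneq ql => /= <-; rewrite prime_coprime // dvdnn.
Qed.

Section AtQ.
Variables (q : nat) (q_pr : prime q) (ql : coprime q l).

Let vu_Gq (K : fieldType) (qK : q \in [pchar K]) (r : K) a q' : ok q' -> q' != q ->
  l.-primitive_root r -> coprime a l ->
  vu prim_z q_pr ql qK (r ^+ a) (Gq q') = 0.
Proof.
move=> okq' qq' prim_r coa; have [FJ J0] := okJ okq'.
have /and3P[q_pr' ql' lq'] := okq'; have [_ _ _ Jp _] := jacP q_pr' ql' lq'.
have pra : l.-primitive_root (r ^+ a) by rewrite prim_root_exp_coprime.
rewrite vu_prod => [|x _|x _]; first last.
- by rewrite expfz_neq0 // fmorph_eq0.
- exact/fixFXz/FsJ.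
apply: big1 => x x0; rewrite vuXz ?fmorph_eq0 //; last exact: FsJ.
rewrite (vu_aut prim_z q_pr ql qK pra (sgE prim_z (coV x0))) ?coV //.
have prb : l.-primitive_root ((r ^+ a) ^+ (x^-1 : 'F_l)).
  by rewrite prim_root_exp_coprime // coV.
by rewrite (vuE _ _ _ _ prb) Jp ?mul0rz //= eq_sym.
Qed.

Let vu_eps (K : fieldType) (qK : q \in [pchar K]) (r : K) a :
  l.-primitive_root r -> coprime a l ->
  vu prim_z q_pr ql qK (r ^+ a) eps =
    \sum_(x : 'F_l | (x != 0) && Hset i x)
       vu prim_z q_pr ql qK (r ^+ (a * (x^-1 : 'F_l))%N) mu1
    - (if ok q && (q < B)%N then vu prim_z q_pr ql qK (r ^+ a) (Gq q) else 0) *+ l.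
Proof.
move=> prim_r coa.
have pra : l.-primitive_root (r ^+ a) by rewrite prim_root_exp_coprime.
rewrite vu_div ?expf_neq0 //; try (by apply: fixFX).
rewrite vuX // vu_prod //; congr (_ - _ *+ _).
  apply: eq_bigr => x /andP[x0 _].
  by rewrite (vu_aut prim_z q_pr ql qK pra (sgE prim_z (coV x0))) ?coV // exprM.
rewrite vu_prod //; case: ifP => [/andP[okq qB]|nq].
  rewrite big_mkcond (bigD1_seq q) ?iota_uniq ?mem_iota //= okq big1 ?addr0 //.
  by move=> q' qq'; case: ifP => // okq'; exact: vu_Gq.
rewrite big_seq_cond; apply: big1 => q' /andP[]; rewrite mem_iota /= add0n => qB okq'.
by apply: vu_Gq => //; apply: contraFneq nq => <-; rewrite okq' qB.
Qed.

Let eps_vu_split : (l %| q.-1)%N -> forall a, coprime a l ->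
  vu prim_z q_pr ql (pchar_Fp q_pr) (rr q ^+ a) eps = 0.
Proof.
move=> lq a coa; have okq : ok q by rewrite /ok q_pr ql lq.
have [] := jacP q_pr ql lq; rewrite -/(rr q) -/(JJ q) => prim_r FJ J0 Jp Jv.
have rE m n : m = n %[mod l] -> rr q ^+ m = rr q ^+ n.
  by move=> mn; rewrite -(prim_expr_mod prim_r) mn prim_expr_mod.
pose b : 'F_l := a%:R.
have b0 : b != 0 by rewrite /b -(dvdn_pcharf (pchar_Fp l_pr)) -coprime_l.
have ab : rr q ^+ a = rr q ^+ b.
  by apply: rE; rewrite /b val_Fp_nat // modn_mod.
have rbx (x : 'F_l) : rr q ^+ (a * x)%N = rr q ^+ (b * x : 'F_l)%R.
  by rewrite exprM ab -exprM; apply: rE; rewrite (Fl_valM l_pr b x) modn_mod.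
rewrite (vu_eps (pchar_Fp q_pr) prim_r coa) okq /=.
under eq_bigr do rewrite rbx -VE.
have V0 : (B <= q)%N -> forall x : 'F_l, x != 0 -> V q x = 0.
  move=> Bq x x0; rewrite (VE q_pr ql).
  have prx : l.-primitive_root (rr q ^+ x) by rewrite prim_root_exp_coprime // Fl_coprime.
  by rewrite (vuE _ _ _ _ prx) B_bound.
case: ltnP => [qB|Bq]; last first.
  by rewrite mul0rn subr0 big1 // => x /andP[x0 _]; rewrite V0 // mulf_neq0 ?invr_eq0.
apply/eqP; rewrite subr_eq0; apply/eqP.
rewrite vu_prod => [|x _|x _]; first last.
- by rewrite expfz_neq0 // fmorph_eq0.
- exact/fixFXz/FsJ.
have pra : l.-primitive_root (rr q ^+ a) by rewrite prim_root_exp_coprime.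
rewrite [RHS](_ : _ = \sum_(x : 'F_l | (x != 0) && Hset i (b / x)) V q x); last first.
  rewrite -sumrMnl big_mkcondr /=; apply: eq_bigr => x x0.
  rewrite vuXz ?fmorph_eq0 //; last exact: FsJ.
  rewrite (vu_aut prim_z q_pr ql _ pra (sgE prim_z (coV x0))) ?coV //.
  rewrite -exprM rbx Jv ?mulf_neq0 ?invr_eq0 //.
  case: (Hset _ _); last by rewrite mul0rz mul0rn.
  by rewrite intz -mulr_natr natz divzK ?V_dvd.
(* The involution x |-> b / x matches the conjugates of [mu1] in [mu2] with the places where the
   conjugates of the Jacobi element have valuation 1. *)
rewrite (reindex_onto (fun x => b / x) (fun x => b / x)) /=; last first.
  by move=> x /andP[x0 _]; rewrite invf_div mulrCA divff // mulr1.
apply: eq_big => [x|x _].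
  rewrite mulf_eq0 invr_eq0 (negPf b0) /=; case: eqVneq => //= x0.
  by rewrite invf_div mulrCA divff // mulr1 eqxx andbT.
have [->|x0] := eqVneq x 0; first by rewrite invr0 mulr0 invr0 mulr0.
by rewrite invf_div mulrCA divff // mulr1.
Qed.

Lemma eps_vu : exists (K : fieldType) (qK : q \in [pchar K]) (r : K),
  l.-primitive_root r /\
  forall a, coprime a l -> vu prim_z q_pr ql qK (r ^+ a) eps = 0.
Proof.
have [lq|nlq] := boolP (l %| q.-1)%N.
  exists 'F_q, (pchar_Fp q_pr), (rr q); split; last exact: eps_vu_split.
  by have [] := jacP q_pr ql lq.
(* Here F_q has no primitive l-th root of unity, so the residue field is taken closed; the
   valuations of [mu1] already vanish by [theta_vu0]. *)
have [K [_ qK]] := closed_field_of_char q_pr.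
have lK : l%:R != 0 :> K by rewrite -(dvdn_pcharf qK) -prime_coprime.
have [r prim_r] := closed_prim_root (prime_gt0 l_pr) lK.
exists K, qK, r; split=> // a coa; rewrite vu_eps // /ok (negPf nlq) !andbF mul0rn subr0.
apply: big1 => x /andP[x0 _]; apply: theta_vu0 => //; last first.
  by rewrite coprimeMl coa coV.
have q0 := prime_gt0 q_pr; rewrite mem_iota.
have ml : (q %% l < l)%N by rewrite ltn_mod prime_gt0.
have m0 : (q %% l != 0)%N by rewrite -/(dvdn _ _) -coprime_l.
suff m1 : (q %% l != 1)%N.
  rewrite subnKC ?(ltnW l_gt2) // ml andbT.
  by move: m0 m1; case: (q %% l)%N => [|[|m]].
apply: contra nlq => /eqP m1; rewrite (divn_eq q l) m1 addn1 /=.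
exact: dvdn_mull.
Qed.

End AtQ.

Lemma unit_exists_aux : exists (e : algC) (c : int),
  [/\ fixF z e, e != 0, ~~ (l %| c)%Z, eqpow l z e (mu ^ c) &
      pval (lplace l_pr prim_z) e = 0 /\
      forall q (q_pr : prime q) (ql : coprime q l),
      exists (K : fieldType) (qK : q \in [pchar K]) (r : K), l.-primitive_root r /\
      forall a, coprime a l -> vu prim_z q_pr ql qK (r ^+ a) e = 0].
Proof.
by exists eps, c2; split=> //; split=> // q q_pr ql; exact: eps_vu.
Qed.

End UnitExists.

(** * Kronecker's theorem and the roots of unity of Q(zeta_l) *)

Section RootsOfUnity.
Variables (l : nat) (l_pr : prime l) (z : algC) (prim_z : l.-primitive_root z).

Lemma sum_unity_root (w : algC) : w ^+ l = 1 -> w != 1 -> \sum_(b < l) w ^+ b = 0.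
Proof.
move=> wl w1; have := subrX1 w l; rewrite wl subrr => /esym/eqP.
by rewrite mulf_eq0 subr_eq0 (negPf w1) => /eqP.
Qed.

(** Fourier inversion over the l-th roots of unity. The correction z^b only meets the coefficient of
    degree l - 1, which is 0, and it cancels the term b = 0, where the value S(1) is not
    controlled. *)
Lemma coef_trace (S : {poly int}) j : (size S < l)%N -> (j < l)%N ->
  l%:R * (S`_j)%:~R
    = \sum_(b < l) ev (z ^+ b) S * ((z ^+ (b * j))^-1 - z ^+ b) :> algC.
Proof.
move=> szS jl.
have z0 m : z ^+ m != 0 by rewrite expf_neq0 // (prim_root_neq0 prim_z).
transitivity (\sum_(i < size S) (S`_i)%:~R * (l%:R * (val i == j)%:R : algC)).
  have [jS|Sj] := ltnP j (size S).
    rewrite (bigD1 (Ordinal jS)) //= eqxx big1 ?addr0 ?mulr1 1?mulrC //.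
    by move=> i; rewrite -val_eqE /= => /negPf ->; rewrite !mulr0.
  rewrite nth_default // mulr0 big1 // => i _.
  by rewrite ltn_eqF ?mulr0 // (leq_trans (ltn_ord i)).
under [RHS]eq_bigr do rewrite ev_coef big_distrl /=.
rewrite exchange_big /=; apply: eq_bigr => i _.
under [RHS]eq_bigr do rewrite -mulrA.
rewrite -big_distrr /=; congr (_ * _).
under eq_bigr do rewrite mulrBr.
rewrite sumrB.
have il : (i.+1 < l)%N by apply: leq_ltn_trans szS.
have -> : \sum_(b < l) (z ^+ b) ^+ i * z ^+ b = 0.
  rewrite -[RHS](@sum_unity_root (z ^+ i.+1)).
  - by apply: eq_bigr => b _; rewrite -exprSr -!exprM mulnC.
  - by rewrite exprAC (prim_expr_order prim_z) expr1n.
  by rewrite -(prim_order_dvd prim_z) gtnNdvd.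
rewrite subr0; have [<-|ij] := eqVneq (val i) j.
  rewrite mulr1 (eq_bigr (fun=> 1)) => [|b _]; first by rewrite sumr_const card_ord.
  by rewrite -exprM divff.
rewrite mulr0 -[LHS](@sum_unity_root (z ^+ i / z ^+ j)).
- by apply: eq_bigr => b _; rewrite expr_div_n -!exprM ![(_ * b)%N]mulnC.
- by rewrite expr_div_n !(exprAC _ _ l) (prim_expr_order prim_z) !expr1n divr1.
rewrite -subr_eq0 -(inj_eq (mulIf (z0 j))) mul0r mulrBl divfK // mul1r subr_eq0.
by rewrite (eq_prim_root_expr prim_z) !modn_small // (ltn_trans _ il).
Qed.

(** The l - 1 remaining terms of [coef_trace] have absolute value at most 2, so a coefficient is at
    most 2(l - 1)/l < 2. *)
Lemma coef_bound (S : {poly int}) (y : algC) : (size S < l)%N -> y = ev z S ->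
  (forall b, coprime b l -> `|sg l b y| = 1) -> forall j, `|S`_j| <= 1.
Proof.
move=> szS Dy ny j; have [jl|lj] := ltnP j l; last first.
  by rewrite nth_default // ltnW // (leq_trans szS).
have z1 m : `|z ^+ m| = 1.
  apply/eqP; rewrite normrX -(@pexpr_eq1 _ _ l) ?exprn_ge0 // ?prime_gt0 //.
  by rewrite exprAC -normrX (prim_expr_order prim_z) normr1 expr1n.
suff : `|S`_j| < 2 by rewrite -[2]/(1 + 1)%R ltzD1.
have : `|l%:R * (S`_j)%:~R : algC| <= (2 * l.-1)%:R.
  rewrite coef_trace //; apply: le_trans (ler_norm_sum _ _ _) _.
  rewrite (bigD1 (Ordinal (prime_gt0 l_pr))) //= mul0n expr0 invr1 subrr mulr0 normr0 add0r.
  apply: (@le_trans _ _ (\sum_(b < l | b != Ordinal (prime_gt0 l_pr)) 2%:R)).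
    apply: ler_sum => b; rewrite -val_eqE /= => b0.
    have cob : coprime b l by rewrite coprime_l // gtnNdvd // lt0n.
    rewrite normrM -(sgE prim_z cob) -ev_rmorph -Dy ny // mul1r.
    apply: le_trans (ler_normB _ _) _.
    by rewrite normfV (sgE prim_z cob) !z1 invr1.
  by rewrite sumr_const cardC1 card_ord -[2%:R *+ _]mulr_natr -natrM.
rewrite normrM normr_nat => H.
have : (`|S`_j|%:~R : algC) < 2.
  have l0 : (0 : algC) < l%:R by rewrite ltr0n prime_gt0.
  rewrite intr_norm -(ltr_pM2l l0); apply: le_lt_trans H _.
  rewrite -natrM ltr_nat mulnC ltn_pmul2r //.
  by rewrite prednK // prime_gt0.
by rewrite -[2 : algC]/(2%:~R) ltr_int.
Qed.

(** Every power of [x] is represented by a polynomial with coefficients in {-1, 0, 1}, so two of the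
    first 3^l + 1 powers coincide. *)
Lemma norm1_root_of_unity (x : algC) (P : {poly int}) : x = ev z P ->
  (forall b, coprime b l -> `|sg l b x| = 1) -> exists2 m, (0 < m)%N & x ^+ m = 1.
Proof.
move=> Dx nx.
have Sk k : exists S : {poly int}, (size S < l)%N /\ x ^+ k = ev z S.
  have [S [szS DS]] := ev_reduce l_pr prim_z (P ^+ k); exists S; split=> //.
  by rewrite -DS rmorphXn /= Dx.
pose Sf k := sval (cid (Sk k)).
have SfP k : (size (Sf k) < l)%N /\ x ^+ k = ev z (Sf k) := svalP (cid (Sk k)).
have bnd k j : `|(Sf k)`_j| <= 1.
  have [szS DS] := SfP k; apply: (coef_bound szS DS) => b cob.
  by rewrite rmorphXn normrX nx // expr1n.
pose code (k : 'I_(3 ^ l).+1) : {ffun 'I_l -> 'I_3} :=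
  [ffun j : 'I_l => inord (absz ((Sf k)`_j + 1)%R)].
have [k [k' [kk' Ek]]] : exists k k' : 'I_(3 ^ l).+1, (k < k')%N /\ code k = code k'.
  apply: contrapT => H; have : injective code.
    move=> k k' Ek; apply: val_inj; apply/eqP; rewrite eqn_leq.
    apply/andP; split; rewrite leqNgt; apply/negP => kk'; apply: H.
      by exists k', k.
    by exists k, k'.
  by move/leq_card; rewrite card_ffun !card_ord ltnn.
have ESf : Sf k = Sf k'.
  apply/polyP => j; have [jl|lj] := ltnP j l; last first.
    by rewrite !nth_default // ltnW // (leq_trans (SfP _).1).
  have /ffunP/(_ (Ordinal jl)) := Ek; rewrite !ffunE => /(congr1 val) /=.
  have /andP[a1 a2] : -1 <= (Sf k)`_j <= 1 by rewrite -ler_norml bnd.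
  have /andP[b1 b2] : -1 <= (Sf k')`_j <= 1 by rewrite -ler_norml bnd.
  move: (Sf k)`_j (Sf k')`_j a1 a2 b1 b2 => a b a1 a2 b1 b2.
  by rewrite !inordK; lia.
have x0 : x != 0.
  have := nx 1%N; rewrite /coprime gcd1n => /(_ isT); rewrite -normr_eq0.
  by apply: contra_eq_neq => /eqP; rewrite normr_eq0 => /eqP ->; rewrite rmorph0 normr0 eq_sym oner_eq0.
exists (k' - k)%N; first by rewrite subn_gt0.
apply: (mulfI (expf_neq0 k x0)); rewrite -exprD subnKC ?(ltnW kk') // mulr1.
by rewrite (SfP k).2 (SfP k').2 ESf.
Qed.

Lemma fixF_root_of_unity (x : algC) m : fixF z x -> (0 < m)%N -> x ^+ m = 1 ->
  exists n j, ~~ (l %| n)%N /\ x ^+ n = z ^+ j.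
Proof.
move=> Fx m0 xm; have [n ln Dm] := pfactor_coprime l_pr m0.
pose y := x ^+ n; have yl : y ^+ (l ^ logn l m) = 1 by rewrite -exprM -Dm.
exists n; suff yl1 : y ^+ l = 1.
  have [j Dj] := prim_rootP prim_z yl1; exists j.
  by rewrite -prime_coprime.
have Fy : fixF z y by apply: fixFX.
elim: (logn l m) yl => [|e IH]; first by rewrite expn0 expr1 => ->; rewrite expr1n.
case: e IH => [_|e IH yl]; first by rewrite expn1.
apply: IH; apply/eqP/negPn/negP => yl1.
pose w := y ^+ (l ^ e); have wl2 : w ^+ (l ^ 2) = 1.
  by rewrite -exprM -expnD addn2.
have wl : w ^+ l != 1 by rewrite -exprM -expnSr.
(* Raising to the power 1 + l fixes the l-th roots of unity but no element of order l^2, so [w]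
   cannot lie in Q(z). *)
have co : coprime l.+1 (l ^ 2) by rewrite coprimeXr // coprimeSn.
have [nu nuP] := Qn_aut_exists co.
have nuz : nu z = z.
  rewrite nuP; first by rewrite exprS (prim_expr_order prim_z) mulr1.
  by rewrite expnS exprM (prim_expr_order prim_z) expr1n.
have Fw : fixF z w by apply: fixFX.
have ww : w * w ^+ l = w by rewrite -exprS -(nuP w wl2) Fw.
have w0 : w != 0.
  apply: contra_eq_neq wl2 => ->; rewrite expr0n gtn_eqF ?expn_gt0 ?prime_gt0 //.
  by rewrite eq_sym oner_eq0.
by case/eqP: wl; apply: (mulfI w0); rewrite ww mulr1.
Qed.

End RootsOfUnity.

(** * The eigenvector as a root of unity, for odd l *)

Section KroneckerWeberOdd.
Variables (l : nat) (l_pr : prime l) (l_gt2 : (2 < l)%N).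
Variables (z : algC) (prim_z : l.-primitive_root z).
Variable mu : algC.
Hypotheses (Fmu : fixF z mu) (mu0 : mu != 0).
Hypothesis mu_eigen :
  forall a, coprime a l -> eqpow l z (sg l a mu) (mu ^+ a).
Hypothesis mu_dvd : forall q (q_pr : prime q) (ql : coprime q l) (r : 'F_q),
  (l %| q.-1)%N -> l.-primitive_root r ->
  (l %| vu prim_z q_pr ql (pchar_Fp q_pr) r mu)%Z.

Lemma fixF_aut_eq (nu nu' : {rmorphism algC -> algC}) x :
  nu z = nu' z -> fixF z x -> nu x = nu' x.
Proof.
move=> nuz /fixF_frac[P [N [_ ->]]].
by rewrite !fmorph_div !rmorph_nat !ev_rmorph nuz.
Qed.

(** Complex conjugation acts on the class of [mu] by the exponent -1. The unit divided by its
    conjugate has all conjugates of absolute value 1, so it is a root of unity, and its class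
    mu^(2c) has an exponent prime to l. *)
Lemma eigen_root_of_unity : exists (c : int) (j : nat),
  ~~ (l %| c)%Z /\ eqpow l z (mu ^ c) (z ^+ j).
Proof.
have [i [i0 i1 Hi]] := Hsum_neq0 l_pr l_gt2.
pose mu1 := theta l (iota 2 (l - 2)) mu.
have Fmu1 : fixF z mu1 by apply: theta_fixF.
have mu10 : mu1 != 0 by apply: theta_neq0.
have [B BP] := pval_bound Fmu1 mu10.
have [e [c [Fe e0 lc ec [el eq]]]] := unit_exists_aux l_pr l_gt2 Fmu mu0
  mu_eigen mu_dvd i0 i1 Hi BP.
have lE : l.-1.+1 = l := prednK (prime_gt0 l_pr).
have col : coprime l.-1 l.
  by rewrite coprime_l // gtnNdvd //; have := prime_gt1 l_pr; lia.
pose cj := sg l l.-1; have cjz : cj z = z ^+ l.-1 by apply: sgE.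
have conjz : z^* = z ^+ l.-1.
  have z1 : `|z| = 1.
    apply/eqP; rewrite -(@pexpr_eq1 _ _ l) ?prime_gt0 //.
    by rewrite -normrX (prim_expr_order prim_z) normr1.
  have z0 := prim_root_neq0 prim_z.
  apply: (mulfI z0); rewrite -exprS lE (prim_expr_order prim_z) -normCK z1.
  by rewrite expr1n.
have cjE x : fixF z x -> cj x = x^*.
  move=> Fx; apply: (fixF_aut_eq (nu' := Num.conj)) => //.
  exact: (etrans cjz (esym conjz)).
have Fcj : fixF z (cj e) by apply: sg_fixF.
have cj0 : cj e != 0 by rewrite fmorph_eq0.
pose eta := e / cj e.
have Feta : fixF z eta by apply: fixF_div.
have eta0 : eta != 0 by rewrite mulf_neq0 ?invr_eq0.
have [P DP] : exists P, eta = ev z P.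
  apply: (integral_criterion (l_pr := l_pr) (prim_z := prim_z) Feta eta0).
    move=> q q_pr ql; have [K [qK [r [prim_r vr]]]] := eq q q_pr ql.
    exists K, qK, r; split=> // a prim_ra.
    have coa : coprime a l by rewrite -(prim_root_exp_coprime _ prim_r).
    rewrite -vuE vu_div // vr // sub0r.
    rewrite (vu_aut prim_z q_pr ql qK prim_ra cjz) // -exprM vr ?oppr0 //.
    by rewrite coprimeMl coa.
  rewrite pvalM ?invr_eq0 ?pvalV //; last exact: fixFV.
  rewrite (pval_lplace_aut l_pr prim_z cjz) ?el ?subrr //.
  by rewrite -coprime_l.
have [m m0 etam] : exists2 m, (0 < m)%N & eta ^+ m = 1.
  apply: (norm1_root_of_unity l_pr prim_z DP) => b cob.
  have -> : sg l b eta = sg l b e / (sg l b e)^*.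
    rewrite fmorph_div; congr (_ / _); rewrite cjE //.
    have E1 : sg l b (z^*) = z ^+ (b * l.-1)%N.
      by rewrite conjz rmorphXn /= (sgE prim_z cob) -exprM.
    have E2 : (sg l b z)^* = z ^+ (b * l.-1)%N.
      by rewrite (sgE prim_z cob) rmorphXn /= conjz -exprM mulnC.
    apply: (fixF_aut_eq (nu := sg l b \o Num.conj) (nu' := Num.conj \o sg l b)) => //.
    exact: (etrans E1 (esym E2)).
  by rewrite normrM normfV norm_conjC divff // normr_eq0 fmorph_eq0.
have [n [j [ln Dj]]] := fixF_root_of_unity l_pr prim_z Feta m0 etam.
exists (c * 2 * n%:Z), j; split.
  rewrite (dvdz_pcharf (pchar_Fp l_pr)) !intrM !mulf_eq0 !negb_or.
  rewrite -!(dvdz_pcharf (pchar_Fp l_pr)) lc /=.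
  by rewrite !dvdzE ln andbT gtnNdvd.
apply: eqpow_sym; rewrite -Dj exprnP -exprz_exp; apply: eqpowXz.
(* This is 2c = c - c(l - 1) + cl, where the exponent c(l - 1) is that of the conjugate. *)
have -> : mu ^ (c * 2) = mu ^ c * (mu ^ (c * l.-1))^-1 * (mu ^ c) ^+ l.
  rewrite invr_expz [(_ ^ c) ^+ l]exprnP exprz_exp -!expfzDr //; congr (mu ^ _).
  have lZ : Posz l = l.-1%:Z + 1 by rewrite -PoszD addn1 lE.
  by rewrite lZ; ring.
rewrite -[eta]mulr1; apply: eqpowM.
  apply: eqpowM => //; apply: eqpowV.
  exact: (eigen_eqpow prim_z mu_eigen col ec).
apply/eqpow_sym/eqpow_lpow; first exact: fixFXz.
exact: expfz_neq0.
Qed.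

End KroneckerWeberOdd.

(** * Arithmetic of p-adic integers *)

Lemma frac_numden (R : idomainType) (x : {fraction R}) :
  exists n d : R, d != 0 /\ x * tofrac d = tofrac n.
Proof.
elim/quotW: x => y; exists \n_y, \d_y; split; first exact: denom_ratioP.
unlock tofrac; rewrite -[LHS]FracField.pi_mul; apply/eqmodP.
rewrite /= FracField.equivfE /FracField.mulf /=.
by rewrite !numden_Ratio ?mulf_neq0 ?oner_neq0 ?denom_ratioP // !mulr1 mulrC.
Qed.

Section PadicFacts.
Variables (l : nat) (hl : prime l).
Local Notation Zl := (padic_int hl).
Implicit Types x y u : Zl.

Lemma padicD x y n : (x + y) n = ((x n + y n) %% l ^ n)%N.
Proof. by []. Qed.

Lemma padicM x y n : (x * y) n = ((x n * y n) %% l ^ n)%N.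
Proof. by []. Qed.

Lemma padic0 n : (0 : Zl) n = 0%N.
Proof. by rewrite /= mod0n. Qed.

Lemma padic_nat m n : (m%:R : Zl) n = (m %% l ^ n)%N.
Proof.
elim: m => [|m IH]; first by rewrite padic0 mod0n.
by rewrite -addn1 natrD padicD IH /= modnDm.
Qed.

Lemma padic_at0 x : x 0%N = 0%N.
Proof. by have := padic_lt x 0; rewrite expn0 ltnS leqn0 => /eqP. Qed.

Lemma padic_dvd_l x n : x 1%N = 0%N -> (l %| x n)%N.
Proof.
case: n => [|n] x1; first by rewrite padic_at0.
by have := @padic_low _ _ x 1 n.+1 isT; rewrite expn1 x1 mod0n => /eqP.
Qed.

Lemma padic_div_subproof x : x 1%N = 0%N ->
  forall n, (x n.+2 %/ l = x n.+1 %/ l %[mod l ^ n])%N.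
Proof.
move=> x1 n; have l0 := prime_gt0 hl.
have -> : x n.+2 = (x n.+2 %/ l ^ n.+1 * l ^ n.+1 + x n.+1)%N.
  by rewrite -[in X in (_ + X)%N](pseqP x n.+1) -divn_eq.
rewrite divnDr ?padic_dvd_l // expnS mulnCA mulKn // modnMDl //.
Qed.

Lemma padic_divl x : x 1%N = 0%N -> exists y, x = l%:R * y.
Proof.
move=> x1; exists (padic_of hl (f := fun n => x n.+1 %/ l)%N (padic_div_subproof x1)).
apply: padic_ext => n; rewrite padicM padic_nat /= modnMm mulnC divnK ?padic_dvd_l //.
by rewrite pseqP.
Qed.

Lemma padic_natl_neq0 m : (l%:R ^+ m : Zl) != 0.
Proof.
rewrite -natrX; apply/eqP => /(congr1 (fun x : Zl => x m.+1)).
rewrite padic0 padic_nat modn_small; last by rewrite ltn_exp2l // prime_gt1.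
by move/eqP; rewrite expn_eq0 -leqn0 leqNgt prime_gt0.
Qed.

Lemma padic_decomp x : x != 0 -> exists m u, x = l%:R ^+ m * u /\ u 1%N != 0%N.
Proof.
move=> /padic_neq0[n]; elim: n x => [|n IH] x; first by rewrite padic_at0.
have [x1|x1] := eqVneq (x 1%N) 0%N; last by exists 0%N, x; rewrite mul1r.
have [y Dy] := padic_divl x1 => xn; have [|m [u [Du u1]]] := IH y.
  rewrite lt0n; apply: contraTneq xn => yn; rewrite Dy padicM padic_nat.
  have : (y n.+1 %% l ^ n)%N = 0%N by rewrite pseqP.
  move=> /eqP/dvdnP[k ->]; rewrite modnMml mulnCA -expnS -leqNgt leqn0.
  by rewrite mulnC modnMr.
by exists m.+1, u; rewrite exprS -mulrA -Du.
Qed.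

Lemma padic_coprime u n : u 1%N != 0%N -> coprime (u n) (l ^ n).
Proof.
case: n => [|n] u1; first by rewrite expn0 coprimen1.
rewrite coprimeXr // coprime_sym prime_coprime //; apply: contra u1 => lu.
have := @padic_low _ _ u 1 n.+1 isT; rewrite expn1 (eqP lu) => /esym/eqP.
by rewrite modn_small // -{2}(expn1 l) padic_lt.
Qed.

(** By Euler these powers are the inverses of [u n] modulo l^n, and inverses are unique, hence
    compatible between levels. *)
Lemma padic_inv_subproof u : u 1%N != 0%N -> forall n,
  (u n.+1 ^ (totient (l ^ n.+1)).-1 = u n ^ (totient (l ^ n)).-1 %[mod l ^ n])%N.
Proof.
move=> u1 n.
have inv m : (u m * u m ^ (totient (l ^ m)).-1 = 1 %[mod l ^ m])%N.
  rewrite -expnS prednK ?totient_gt0 ?expn_gt0 ?prime_gt0 //.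
  exact/Euler_exp_totient/padic_coprime.
set a := (_ ^ _)%N; set b := (_ ^ _)%N.
have E1 : (u n * a = 1 %[mod l ^ n])%N.
  rewrite -modnMml -(pseqP u n) modn_mod modnMml.
  have /(modn_dvdm (u n.+1 * a)) <- : (l ^ n %| l ^ n.+1)%N by rewrite dvdn_exp2l.
  by rewrite inv modn_dvdm // dvdn_exp2l.
rewrite -[a]mul1n -modnMml -(inv n) modnMml -/b mulnAC -modnMml E1 modnMml.
by rewrite mul1n.
Qed.

Lemma padic_unit_inv u : u 1%N != 0%N -> exists v, u * v = 1.
Proof.
move=> u1; exists (padic_of hl (f := fun n => u n ^ (totient (l ^ n)).-1)%N (padic_inv_subproof u1)).
apply: padic_ext => n; rewrite padicM /= modnMmr -expnS.
rewrite prednK ?totient_gt0 ?expn_gt0 ?prime_gt0 //.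
exact/Euler_exp_totient/padic_coprime.
Qed.

Lemma padic_divX x m : x m = 0%N -> exists y, x = l%:R ^+ m * y.
Proof.
have [->|x0] := eqVneq x 0; first by exists 0; rewrite mulr0.
have [k [u [Du u1]]] := padic_decomp x0 => xm.
have [mk|km] := leqP m k.
  by exists (l%:R ^+ (k - m) * u); rewrite mulrA -exprD subnKC.
have : (l ^ m %| l ^ k * u m)%N.
  move: xm; rewrite Du padicM -natrX padic_nat modnMml => /eqP; exact.
rewrite -(subnKC (ltnW km)) expnD dvdn_pmul2l ?expn_gt0 ?prime_gt0 //.
rewrite subnKC ?(ltnW km) // => lu; exfalso.
have lum : (l %| u m)%N by apply: dvdn_trans lu; rewrite -{1}(expn1 l) dvdn_exp2l ?subn_gt0.
have := padic_coprime m u1; rewrite coprime_sym coprime_pexpl; last exact: leq_ltn_trans km.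
by rewrite prime_coprime // lum.
Qed.

Lemma padic_modX x m : (l%:R ^+ m * x) m = 0%N.
Proof. by rewrite padicM -natrX padic_nat modnMml mulnC modnMl. Qed.

Lemma padic_frac (c : padic hl) : exists (m : nat) (a : Zl),
  l%:R ^+ m * c = Zp_Qp hl a.
Proof.
have [n [d [d0 Dc]]] := frac_numden c.
have [m [u [Du u1]]] := padic_decomp d0; have [v Dv] := padic_unit_inv u1.
exists m, (n * v); rewrite rmorphM /= -[Zp_Qp hl n]Dc -[tofrac d]/(Zp_Qp hl d) Du.
rewrite rmorphM rmorphXn rmorph_nat -!mulrA -rmorphM Dv rmorph1 mulr1.
by rewrite mulrC.
Qed.

End PadicFacts.

(** The limit is the diagonal sequence of residues. *)
Lemma padic_limit (p : nat) (hp : prime p) (a : nat -> padic_int hp) :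
  (forall k, a k.+1 k = a k k) ->
  exists A : padic_int hp, forall k, exists b, A - a k = p%:R ^+ k * b.
Proof.
move=> ak; have AP n : (a n.+1 n.+1 %% p ^ n)%N = a n n by rewrite pseqP ak.
exists (PadicInt hp AP) => k; apply: padic_divX.
have := padicD (PadicInt hp AP - a k) (a k) k; rewrite subrK.
set d := pseq (_ - _) k => E.
have /eqP : (d + a k k = 0 + a k k %[mod p ^ k])%N by rewrite -E add0n padic_mod.
by rewrite eqn_modDr mod0n padic_mod => /eqP.
Qed.

Lemma prime_unit_padic (p N : nat) (hp : prime p) : coprime p N ->
  exists v : padic_int hp, N%:R * v = 1.
Proof.
move=> pN; apply: padic_unit_inv; rewrite padic_nat expn1.
by rewrite -/(dvdn _ _) -prime_coprime.
Qed.

Lemma exprDn_middle (R : comNzRingType) (x y : R) m n : m = n.+1 ->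
  (x + y) ^+ m - (x ^+ m + y ^+ m)
  = \sum_(i < n) x ^+ (m - i.+1) * y ^+ i.+1 *+ 'C(m, i.+1).
Proof.
move=> ->; rewrite exprDn big_ord_recl big_ord_recr /= subn0 expr0 mulr1 bin0 mulr1n.
rewrite /bump leq0n add1n subnn expr0 mul1r binn mulr1n.
rewrite (eq_bigr (fun i : 'I_n => x ^+ (n.+1 - i.+1) * y ^+ i.+1 *+ 'C(n.+1, i.+1))); last first.
  by move=> i _; rewrite !leq0n !add1n.
by set S := (X in _ = X); rewrite opprD addrACA subrr add0r addrK.
Qed.

(** * Roots of unity of order prime to p over Q_p *)

Section UnramifiedCyclotomic.
Variables (p : nat) (hp : prime p) (O : alg_closure (padic hp)).
Variables (N : nat) (pN : coprime p N) (z : O) (prim_z : N.-primitive_root z).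
Local Notation Zp := (padic_int hp).

(** [Zp_emb] is a bare function; [ze] is the same map with its ring morphism structure. *)
Variables (ze : {rmorphism Zp -> O}) (zeE : ze = Zp_emb O :> (Zp -> O)).

Let ze_inj : injective ze.
Proof.
rewrite zeE => x y /fmorph_inj/eqP; rewrite -subr_eq0 -rmorphB tofrac_eq0 subr_eq0.
by move/eqP.
Qed.

Let N_gt0 : (0 < N)%N := prim_order_gt0 prim_z.

Let inR (x : O) := exists c : 'I_N -> Zp, x = \sum_i ze (c i) * z ^+ i.

Let inR_D x y : inR x -> inR y -> inR (x + y).
Proof.
move=> [c ->] [d ->]; exists (fun i => c i + d i); rewrite -big_split.
by apply: eq_bigr => i _; rewrite rmorphD mulrDl.
Qed.

Let inR_sum (I : Type) (s : seq I) (f : I -> O) :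
  (forall i, inR (f i)) -> inR (\sum_(i <- s) f i).
Proof.
move=> fR; apply: (big_ind inR) => //.
by exists (fun=> 0); rewrite big1 // => i _; rewrite rmorph0 mul0r.
Qed.

Let inR_Z a n : inR (ze a * z ^+ n).
Proof.
pose i0 := Ordinal (ltn_pmod n N_gt0).
exists (fun i => if i == i0 then a else 0).
rewrite (bigD1 i0) //= eqxx big1 ?addr0 ?(prim_expr_mod prim_z) // => i /negPf ->.
by rewrite rmorph0 mul0r.
Qed.

Let inR_ze a : inR (ze a).
Proof. by have := inR_Z a 0; rewrite expr0 mulr1. Qed.

Let inR_M x y : inR x -> inR y -> inR (x * y).
Proof.
move=> [c ->] [d ->]; rewrite big_distrl /=; apply: inR_sum => i.
rewrite big_distrr /=; apply: inR_sum => j.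
by rewrite mulrACA -rmorphM -exprD; exact: inR_Z.
Qed.

Let inR_nat n : inR n%:R. Proof. by rewrite -(rmorph_nat ze); exact: inR_ze. Qed.
Let inR_1 : inR 1. Proof. exact: (inR_nat 1). Qed.
Let inR_N x : inR x -> inR (- x).
Proof.
move=> [c ->]; exists (fun i => - c i); rewrite -sumrN.
by apply: eq_bigr => i _; rewrite rmorphN mulNr.
Qed.
Let inR_X x n : inR x -> inR (x ^+ n).
Proof. by move=> xR; elim: n => [|n IH]; rewrite ?expr0 ?exprS //; exact: inR_M. Qed.

Let val_int_R x : inR x -> val_int x.
Proof.
have zi : integralOver ze z.
  exists ('X^N - 1); first exact: monicXnsubC.
  rewrite rmorphB rmorph1 /= map_polyXn; apply/rootP.
  by rewrite hornerD hornerN hornerXn hornerC (prim_expr_order prim_z) subrr.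
move=> [c ->]; rewrite /val_int -zeE; apply: (big_ind (integralOver ze)).
- exact: (integral0 ze).
- exact: integral_add.
move=> i _; apply: integral_mul; first exact: integral_id.
elim: (i : nat) => [|n IH]; first by rewrite expr0; exact: (integral1 ze).
by rewrite exprS; apply: integral_mul.
Qed.

(** Multiplying a monic equation of degree d for 1/p by p^d gives a relation 1 + pc = 0 in Z_p,
    impossible modulo p. *)
Lemma padic_inv_not_integral (x : O) : p%:R * x = 1 -> ~ val_int x.
Proof.
rewrite /val_int -zeE => px [P Pm /rootP]; pose d := (size P).-1.
have szP : size P = d.+1 by rewrite /d prednK // lt0n size_poly_eq0 monic_neq0.
have px1 i : p%:R ^+ i * x ^+ i = 1 by rewrite -exprMn px expr1n.
move/(congr1 (fun y => p%:R ^+ d * y)); rewrite mulr0.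
rewrite (@horner_coef_wide _ d.+1) ?(leq_trans (size_poly _ _)) ?szP //.
rewrite big_ord_recr /= coef_map /=.
have -> : P`_d = 1 by have := monicP Pm; rewrite /lead_coef szP.
rewrite rmorph1 mul1r mulrDr px1 big_distrr /=.
have -> : \sum_(i < d) p%:R ^+ d * ((map_poly ze P)`_i * x ^+ i)
    = ze (p%:R * \sum_(i < d) p%:R ^+ (d - i).-1 * P`_i).
  rewrite rmorphM rmorph_nat rmorph_sum big_distrr /=; apply: eq_bigr => i _.
  rewrite coef_map /= rmorphM rmorphXn rmorph_nat [RHS]mulrA -exprS prednK ?subn_gt0 //.
  have -> : p%:R ^+ d = p%:R ^+ (d - i) * p%:R ^+ i :> O by rewrite -exprD subnK // ltnW.
  by rewrite mulrACA px1 mulr1.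
rewrite -(rmorph1 ze) -rmorphD -(rmorph0 ze) => /ze_inj.
move/(congr1 (fun y : Zp => y 1%N)); rewrite padicD padicM padic_nat padic0 expn1 modnn mul0n mod0n.
have -> : (1 : Zp) 1%N = 1%N by rewrite -[1]/(1%:R : Zp) padic_nat expn1 modn_small ?prime_gt1.
by rewrite add0n modn_small // prime_gt1.
Qed.

Let pO0 k : (p%:R ^+ k : O) != 0.
Proof.
rewrite -(rmorph_nat ze) -rmorphXn -(rmorph0 ze) (inj_eq ze_inj).
exact: padic_natl_neq0.
Qed.

Let pR k x := exists2 y, inR y & x = p%:R ^+ k * y.

Let pR_D k x y : pR k x -> pR k y -> pR k (x + y).
Proof. by move=> [a aR ->] [b bR ->]; exists (a + b); rewrite ?mulrDr //; exact: inR_D. Qed.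
Let pR_M k x y : pR k x -> inR y -> pR k (x * y).
Proof. by move=> [a aR ->] yR; exists (a * y); rewrite ?mulrA //; exact: inR_M. Qed.
Let pR_W k m x : (m <= k)%N -> pR k x -> pR m x.
Proof.
move=> mk [a aR ->]; exists (p%:R ^+ (k - m) * a).
  by apply: inR_M => //; apply/inR_X/inR_nat.
by rewrite mulrA -exprD subnKC.
Qed.
Let pR_inR k x : pR k x -> inR x.
Proof. by move=> [a aR ->]; apply: inR_M => //; apply/inR_X/inR_nat. Qed.

(** A nonzero [x] integral over Z_p divides a nonzero constant p^m u with u a unit; if p^(m+1)
    divided [x], then 1/p would be integral. *)
Let separated x : (forall k, pR k x) -> x = 0.
Proof.
move=> xk; apply/eqP/negPn/negP => x0.
have xR := pR_inR (xk 0%N).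
have := val_int_R xR; rewrite /val_int -zeE => -[P Pm Px].
have [c [y [c0 yR Dc]]] : exists c y, [/\ c != 0, inR y & x * y = ze c].
  move: Px; have P0 := monic_neq0 Pm; elim/poly_ind: P P0 {Pm} => [|P c IH] P0 //.
    by rewrite eqxx in P0.
  have [c0|c0] := eqVneq c 0.
    rewrite c0 addr0 in P0 *; rewrite mulf_eq0 negb_or in P0.
    have /andP[P0' _] := P0; move=> H; apply: (IH P0').
    by move: H; rewrite rmorphM /= map_polyX rootM rootX (negPf x0) orbF.
  move=> /rootP; rewrite rmorphD rmorphM /= map_polyX map_polyC /= !hornerE => /eqP.
  rewrite addr_eq0 => /eqP E; exists c, (- (map_poly ze P).[x]); split=> //.
    apply: inR_N; rewrite horner_coef; apply: inR_sum => i.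
    by rewrite coef_map; apply: inR_M; [exact: inR_ze|exact: inR_X].
  by rewrite mulrN mulrC E opprK.
have [m [u [Du u1]]] := padic_decomp c0; have [v Dv] := padic_unit_inv u1.
have [a aR Da] := xk m.+1.
apply: (@padic_inv_not_integral (a * y * ze v)); last first.
  by apply/val_int_R/inR_M; [exact: inR_M|exact: inR_ze].
apply: (mulfI (pO0 m)); rewrite mulr1 !mulrA -exprSr -Da Dc Du rmorphM rmorphXn rmorph_nat.
by rewrite -mulrA -rmorphM Dv rmorph1 mulr1.
Qed.

(** The powers z^i for i < N may be dependent, so the coefficients of [a k] are not determined.
    Coefficients are chosen for the differences instead, and their series converge in Z_p. *)
Let complete (a : nat -> O) : inR (a 0%N) -> (forall k, pR k (a k.+1 - a k)) ->
  exists2 A, inR A & forall k, pR k (A - a k).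
Proof.
move=> a0 ak.
have ck k : exists c : 'I_N -> Zp, a k.+1 - a k = \sum_i ze (p%:R ^+ k * c i) * z ^+ i.
  have [y [c Dy] ->] := ak k; exists c; rewrite Dy big_distrr /=.
  by apply: eq_bigr => i _; rewrite rmorphM rmorphXn rmorph_nat mulrA.
pose c k := sval (cid (ck k)); have cP k := svalP (cid (ck k)).
pose S i k := \sum_(j < k) p%:R ^+ j * c j i.
have SE i k : S i k.+1 = S i k + p%:R ^+ k * c k i by rewrite /S big_ord_recr.
have limS i : exists A : Zp, forall k, exists b, A - S i k = p%:R ^+ k * b.
  apply: padic_limit => k; rewrite SE padicD padic_modX addn0.
  by rewrite padic_mod.
pose L i := sval (cid (limS i)); have LP i := svalP (cid (limS i)).
have aE k : a k = a 0%N + \sum_i ze (S i k) * z ^+ i.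
  elim: k => [|k IH].
    by rewrite big1 ?addr0 // => i _; rewrite /S big_ord0 rmorph0 mul0r.
  have [g [Sg /eqP]] : exists g : 'I_N -> Zp, (forall i, S i k.+1 = S i k + p%:R ^+ k * g i)
      /\ a k.+1 - a k = \sum_i ze (p%:R ^+ k * g i) * z ^+ i.
    by exists (c k); split=> [i|]; [exact: SE|exact: cP].
  rewrite subr_eq => /eqP ->; rewrite {}IH addrCA; congr (_ + _).
  rewrite -big_split /=; apply: eq_bigr => i _.
  by rewrite Sg rmorphD addrC mulrDl.
exists (a 0%N + \sum_i ze (L i) * z ^+ i).
  by apply: inR_D => //; exists L.
move=> k; rewrite [a k]aE opprD addrACA subrr add0r -sumrB.
have bk i : exists b, L i - S i k = p%:R ^+ k * b by apply: LP.
pose b i := sval (cid (bk i)); have bP i := svalP (cid (bk i)).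
exists (\sum_i ze (b i) * z ^+ i); first by exists b.
rewrite big_distrr /=; apply: eq_bigr => i _.
by rewrite -mulrBl -rmorphB bP rmorphM rmorphXn rmorph_nat mulrA.
Qed.

Let pR_sum (I : Type) (s : seq I) (f : I -> O) k :
  (forall i, pR k (f i)) -> pR k (\sum_(i <- s) f i).
Proof.
move=> fR; apply: (big_ind (pR k)) => // [|x y]; last exact: pR_D.
by exists 0; rewrite ?mulr0 //; exact: (inR_nat 0).
Qed.

Let pR_N k x : pR k x -> pR k (- x).
Proof. by move=> [a aR ->]; exists (- a); rewrite ?mulrN //; exact: inR_N. Qed.

Let split3 (a b c : O) : a - c = (a - b) + (b - c).
Proof. by rewrite addrA subrK. Qed.

Let frob_D x y : inR x -> inR y -> pR 1 ((x + y) ^+ p - (x ^+ p + y ^+ p)).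
Proof.
move=> xR yR; have p0 := prime_gt0 hp.
rewrite (exprDn_middle _ _ (esym (prednK p0))).
apply: pR_sum => i; have ip : (0 < i.+1 < p)%N.
  by rewrite /= -[X in (_ < X)%N](prednK p0) ltnS ltn_ord.
have /dvdnP[m Dm] := prime_dvd_bin hp ip.
exists (x ^+ (p - i.+1) * y ^+ i.+1 *+ m).
  by rewrite -mulr_natr; apply: inR_M => //; apply: inR_M; exact: inR_X.
by rewrite Dm mulrnA expr1 mulr_natl.
Qed.

Let frob_ze a : pR 1 (ze a ^+ p - ze a).
Proof.
have : (a ^+ p - a) 1%N = 0%N.
  have := padicD (a ^+ p - a) a 1; rewrite subrK; set d := pseq (_ - _) 1 => E.
  have aX n : (a ^+ n) 1%N = (a 1%N ^ n %% p)%N.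
    elim: n => [|n IH]; first by rewrite expr0 expn0 -[1]/(1%:R) padic_nat expn1.
    by rewrite exprS padicM IH expn1 modnMmr expnS.
  have /eqP : (d + a 1%N = 0 + a 1%N %[mod p ^ 1])%N.
    by rewrite -E aX expn1 add0n fermat_little.
  by rewrite eqn_modDr mod0n padic_mod => /eqP.
move/padic_divl=> [b Db]; exists (ze b); first exact: inR_ze.
by rewrite -rmorphXn -rmorphB Db rmorphM rmorph_nat expr1.
Qed.

Let frob_sum (I : Type) (s : seq I) (f : I -> O) : (forall i, inR (f i)) ->
  pR 1 ((\sum_(i <- s) f i) ^+ p - \sum_(i <- s) f i ^+ p).
Proof.
move=> fR; elim: s => [|i s IH].
  rewrite !big_nil expr0n gtn_eqF ?prime_gt0 // subrr.
  by exists 0; rewrite ?mulr0 //; exact: (inR_nat 0).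
rewrite !big_cons (split3 _ (f i ^+ p + (\sum_(j <- s) f j) ^+ p)).
apply: pR_D; first by apply: frob_D => //; exact: inR_sum.
by rewrite opprD addrACA subrr add0r.
Qed.

Let pR_mul_congr x y x' y' : inR x -> inR y' -> pR 1 (x - x') -> pR 1 (y - y') ->
  pR 1 (x * y - x' * y').
Proof.
move=> xR yR xx yy; have -> : x * y - x' * y' = (y - y') * x + (x - x') * y' by ring.
by apply: pR_D; apply: pR_M.
Qed.

(* y |-> y^(p^k) acts on R/p as the substitution z |-> z^(p^k). *)
Let frob_iter (c : 'I_N -> Zp) k :
  pR 1 ((\sum_i ze (c i) * z ^+ i) ^+ (p ^ k) - \sum_i ze (c i) * z ^+ (i * p ^ k)).
Proof.
elim: k => [|k IH].
  rewrite expn0 expr1; under [X in _ - X]eq_bigr do rewrite muln1.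
  by rewrite subrr; exists 0; rewrite ?mulr0 //; exact: (inR_nat 0).
set Y := \sum_i _ in IH *; set Z := (X in _ - X) in IH.
have YR : inR Y by apply: inR_sum => i; apply: inR_Z.
have ZR : inR Z by apply: inR_sum => i; apply: inR_Z.
have key : pR 1 ((Y ^+ (p ^ k)) ^+ p - Z ^+ p).
  have H n : pR 1 ((Y ^+ (p ^ k)) ^+ n - Z ^+ n).
    elim: n => [|n IHn]; first by rewrite !expr0 subrr; exists 0; rewrite ?mulr0 //; exact: (inR_nat 0).
    by rewrite !exprS; apply: pR_mul_congr => //; exact: inR_X.
  exact: H.
rewrite expnSr exprM (split3 _ (Z ^+ p)); apply: pR_D => //.
rewrite (split3 _ (\sum_i (ze (c i) * z ^+ (i * p ^ k)) ^+ p)).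
apply: pR_D; first by apply: frob_sum => i; exact: inR_Z.
rewrite -sumrB; apply: pR_sum => i; rewrite exprMn -exprM -mulnA -expnSr -mulrBl.
apply: pR_M; first exact: frob_ze.
by rewrite -[z ^+ _]mul1r -(rmorph1 ze); exact: inR_Z.
Qed.

Let frob_congr y : inR y -> pR 1 (y ^+ (p ^ totient N) - y).
Proof.
move=> [c Dy]; have := frob_iter c (totient N); rewrite -Dy.
suff -> : \sum_i ze (c i) * z ^+ (i * p ^ totient N) = y by [].
rewrite Dy; apply: eq_bigr => i _; congr (_ * _).
rewrite -(prim_expr_mod prim_z) -modnMmr Euler_exp_totient // modnMmr muln1.
exact: prim_expr_mod.
Qed.

(** The ring Z_p[z] is local: the power e = y^(q - 1) is idempotent modulo p and lifts to an
    idempotent E of a domain, so E is 0 or 1. In the first case p divides y, in the second y is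
    invertible. *)
Let dichotomy y : inR y -> pR 1 y \/ exists2 y', inR y' & y * y' = 1.
Proof.
move=> yR; set q := (p ^ totient N)%N.
have q1 : (1 < q)%N by rewrite -(expn0 p) ltn_exp2l ?prime_gt1 // totient_gt0.
pose e := y ^+ q.-1.
have eR : inR e by apply: inR_X.
have ey : pR 1 (e * y - y) by rewrite /e -exprSr prednK ?(ltnW q1) //; exact: frob_congr.
have ee : pR 1 (e * e - e).
  have -> : e * e - e = (e * y - y) * y ^+ q.-2.
    have De : e = y * y ^+ q.-2.
      by rewrite /e -exprS; congr (_ ^+ _); case: (q) q1 => [|[]].
    by rewrite mulrBl -mulrA -De.
  by apply: pR_M => //; exact: inR_X.
(* Newton iteration for x^2 - x: the error of [h x] is a multiple of the square of the error of
   [x]. *)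
pose h (x : O) := 3%:R * x ^+ 2 - 2%:R * x ^+ 3.
pose a k := iter k h e.
have aR k : inR (a k).
  elim: k => [//|k IH] /=; apply: inR_D; first by apply: inR_M; [exact: inR_nat|exact: inR_X].
  by apply/inR_N/inR_M; [exact: inR_nat|exact: inR_X].
have aa k : pR k.+1 (a k * a k - a k).
  elim: k => [//|k [b bR Db]] /=; set x := a k in Db *.
  have -> : h x * h x - h x = (x * x - x) ^+ 2 * (4%:R * (x * x - x) - 3%:R).
    by rewrite /h; ring.
  rewrite Db; apply: pR_M; last first.
    apply: inR_D; last by apply/inR_N/inR_nat.
    by apply: inR_M; [exact: inR_nat|apply: inR_M => //; apply/inR_X/inR_nat].
  apply: (@pR_W (k.+1 * 2)); first by lia.
  by exists (b ^+ 2); [exact: inR_X|rewrite exprMn -exprM].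
have da k : pR k.+1 (a k.+1 - a k).
  have -> : a k.+1 - a k = (a k * a k - a k) * (1 - 2%:R * a k).
    by rewrite /a iterS -/(a k) /h; ring.
  apply: pR_M => //; apply: inR_D => //; apply/inR_N/inR_M => //; exact: inR_nat.
have [||E ER Ea] := @complete a; [exact: eR|by move=> k; apply: pR_W (da k)|].
have E2 : E * E - E = 0.
  apply: separated => k; have [b bR Db] := Ea k.
  have -> : E * E - E = (a k * a k - a k) + (E - a k) * (E + a k - 1) by ring.
  apply: pR_D; first exact: pR_W (aa k).
  by apply: pR_M => //; apply: inR_D; [exact: inR_D|exact: inR_N].
have Ee : pR 1 (E - e).
  have -> : E - e = (E - a 1%N) + (a 1%N - a 0%N) by rewrite addrA subrK.
  by apply: pR_D.
have /orP[/eqP E0|/eqP E1] : (E == 0) || (E == 1).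
- by rewrite -[E == 1]subr_eq0 -mulf_eq0 mulrBr mulr1 E2.
- left; have -> : y = (E - e) * y - (e * y - y) + 2%:R * e * y - E * y by ring.
  rewrite E0 mul0r subr0 sub0r.
  have eP : pR 1 e by rewrite -[e]opprK -[- e]add0r -E0; apply: pR_N.
  apply: pR_D; first by apply: pR_D; [apply: pR_M => //; exact: pR_N|exact: pR_N].
  by rewrite mulrC mulrA mulrC; apply: pR_M => //; apply: inR_M => //; exact: inR_nat.
(* Since E = 1, [e] is congruent to 1 modulo p and is inverted by a geometric series. *)
right; pose w := e - 1; have [w' w'R Dw] : pR 1 w by rewrite /w -E1 -opprB; apply: pR_N.
pose g k := \sum_(j < k) (- w) ^+ j.
have wR : inR w by apply: inR_D => //; apply: inR_N.
have gR k : inR (g k) by apply: inR_sum => j; apply/inR_X/inR_N.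
have wk k : pR k ((- w) ^+ k).
  exists ((- w') ^+ k); first by apply/inR_X/inR_N.
  by rewrite Dw expr1 -mulrN exprMn.
have [||A AR Ag] := @complete g; first by exact: gR.
  by move=> k; rewrite /g big_ord_recr /= addrAC subrr add0r.
exists (y ^+ q.-2 * A); first by apply: inR_M => //; exact: inR_X.
have De : y * y ^+ q.-2 = e by rewrite /e -exprS; congr (_ ^+ _); case: (q) q1 => [|[]].
rewrite mulrA De; apply/eqP; rewrite -subr_eq0; apply/eqP; apply: separated => k.
have gw : e * g k = 1 - (- w) ^+ k.
  have := subrX1 (- w) k; rewrite -/(g k) => E'.
  have -> : e = - (- w - 1) by rewrite /w; ring.
  by rewrite mulNr -E' opprB.
have -> : e * A - 1 = (A - g k) * e - (- w) ^+ k by rewrite mulrBl [g k * e]mulrC gw [A * e]mulrC; ring.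
by apply: pR_D; [exact: pR_M|apply: pR_N].
Qed.

(** Once denominators are cleared, [separated] gives the exact power of p dividing an element of
    Q_p(z), and the cofactor is a unit by [dichotomy]. *)
Lemma unramified_cyclotomic : unramified_elt z.
Proof.
move=> P /=; set y := _.[z] => y0.
have [m mP] : exists m, forall i, exists a, p%:R ^+ m * P`_i = Zp_Qp hp a.
  have mi i : exists m a, p%:R ^+ m * P`_i = Zp_Qp hp a by apply: padic_frac.
  pose mf i := sval (cid (mi i)).
  exists (\sum_(i < size P) mf i)%N => i.
  have [iP|iP] := ltnP i (size P); last by exists 0; rewrite nth_default // mulr0 rmorph0.
  rewrite (bigD1 (Ordinal iP)) //= addnC exprD -mulrA.
  have [a ->] := svalP (cid (mi i)); set M := (\sum_(_ < _ | _) _)%N.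
  by exists (p%:R ^+ M * a); rewrite rmorphM rmorphXn rmorph_nat.
pose Y := p%:R ^+ m * y.
have YR : inR Y.
  rewrite /Y /y horner_coef size_map_poly big_distrr /=; apply: inR_sum => i.
  have [a Da] := mP i; rewrite coef_map mulrA -(rmorph_nat (ac_emb O)) -rmorphXn -rmorphM.
  by rewrite Da -[ac_emb O _]/(Zp_emb O a) -zeE; exact: inR_Z.
have Y0 : Y != 0 by rewrite mulf_neq0.
have [k [[u uR Du] nk]] : exists k, pR k Y /\ ~ pR k.+1 Y.
  apply: contrapT => H; case/eqP: Y0; apply: separated; elim=> [|k IH].
    by exists Y; rewrite ?mul1r.
  by apply: contrapT => nk; apply: H; exists k.
have [[v vR Dv]|[u' u'R Du']] := dichotomy uR.
  by case: nk; exists v; rewrite // Du Dv expr1 mulrA exprSr.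
have u0 : u != 0 by apply: contra_eq_neq Du' => ->; rewrite mul0r eq_sym oner_eq0.
exists (m%:Z - k%:Z).
have -> : y * p%:R ^ (m%:Z - k%:Z) = u.
  have p0 : (p%:R : O) != 0 by have := pO0 1; rewrite expr1.
  rewrite expfzDr // mulrA [y * _]mulrC -exprnP -/Y Du -invr_expz -exprnP.
  by rewrite mulrAC divff // mul1r.
split=> //; first exact: val_int_R.
have -> : u^-1 = u' by apply: (mulfI u0); rewrite divff.
exact: val_int_R.
Qed.

(** Distinct powers of [z] stay distinct modulo p: for 0 < c < N the difference 1 - z^c divides N,
    which is a p-adic unit. *)
Lemma frobenius_cyclotomic (b : nat) (y : O) : val_int y ->
  z ^+ b - z ^+ p = p%:R * y -> z ^+ b = z ^+ p.
Proof.
move=> yi E; apply/eqP; apply: contrapT => /negP zbp.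
have z0 := prim_root_neq0 prim_z.
pose c := ((b + (N * p - p)) %% N)%N.
have pNp : (p <= N * p)%N by rewrite leq_pmull.
have zc : z ^+ p * z ^+ c = z ^+ b.
  rewrite /c (prim_expr_mod prim_z) -exprD addnCA subnKC // exprD mulnC exprM.
  by rewrite exprAC (prim_expr_order prim_z) expr1n mulr1.
have c0 : (0 < c)%N.
  by rewrite lt0n; apply: contra zbp => /eqP c0; rewrite -zc c0 expr0 mulr1.
have cN : (c < N)%N by rewrite ltn_mod.
have zR m : inR (z ^+ m) by have := inR_Z 1 m; rewrite rmorph1 mul1r.
have [D DR DN] : exists2 D, inR D & (1 - z ^+ c) * D = N%:R.
  exists (\prod_(1 <= i < N | i != c) (1 - z ^+ i)).
    apply: (big_ind inR) => [//||i _]; first exact: inR_M.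
    by apply: inR_D => //; apply: inR_N.
  rewrite -(prod_1subXn prim_z) [RHS](bigD1_seq c) ?iota_uniq //=.
  by rewrite mem_index_iota c0 cN.
have [v Dv] := prime_unit_padic hp pN.
have [zi ziR Dzi] : exists2 zi, inR zi & zi * z ^+ p = 1.
  exists (z ^+ (N * p - p)) => //.
  by rewrite -exprD subnK // exprM (prim_expr_order prim_z) expr1n.
apply: (@padic_inv_not_integral (- y * (zi * D * ze v))); last first.
  have := val_int_R (inR_M (inR_M ziR DR) (inR_ze v)).
  rewrite /val_int -zeE in yi * => H.
  by apply: integral_mul => //; exact: (integral_opp (RtoK := ze)).
rewrite mulrA mulrN -E -zc -{2}[z ^+ p]mulr1 -mulrBr -mulrN opprB.
have -> : z ^+ p * (1 - z ^+ c) * (zi * D * ze v)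
   = (zi * z ^+ p) * ((1 - z ^+ c) * D * ze v) by ring.
by rewrite Dzi mul1r DN -(rmorph_nat ze) -rmorphM Dv rmorph1.
Qed.

End UnramifiedCyclotomic.

Lemma frobenius_on_roots (p : nat) (hp : prime p) (F : gal_group Qbar) N (x : algC) :
  frobenius_at hp F -> coprime p N -> N.-primitive_root x -> F x = x ^+ p.
Proof.
move=> [O [j [t [tF jF]]]] pN prim_x.
have prim_jx : N.-primitive_root (j x) by rewrite fmorph_primitive_root.
have [b Db] : exists b : nat, F x = x ^+ b.
  have : F x ^+ N = 1 by rewrite -rmorphXn /= (prim_expr_order prim_x) rmorph1.
  by move/(prim_rootP prim_x) => [b Db]; exists b.
pose ze : {rmorphism padic_int hp -> O} := ac_emb O \o Zp_Qp hp.
have zeE : ze = Zp_emb O :> (_ -> _) by [].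
have xi : val_int (j x).
  exists ('X^N - 1); first exact/monicXnsubC/(prim_order_gt0 prim_x).
  rewrite -zeE rmorphB rmorph1 /= map_polyXn; apply/rootP.
  by rewrite hornerD hornerN hornerXn hornerC (prim_expr_order prim_jx) subrr.
have [y yi Ey] := tF (j x) (unramified_cyclotomic pN prim_jx zeE) xi.
rewrite -jF Db rmorphXn /= in Ey.
have := frobenius_cyclotomic pN prim_jx zeE yi Ey.
by rewrite -!rmorphXn => /fmorph_inj <-.
Qed.

(** * Homomorphisms to Z_l and the Kronecker-Weber theorem *)

Definition ghom (l : nat) (hl : prime l) (Phi : gal_group Qbar -> padic_int hl) :=
  (forall s t, Phi (gal_mul s t) = Phi s + Phi t) /\
  (forall n, exists E : seq algC, forall s : gal_group Qbar,
     {in E, s =1 id} -> Phi s n = 0%N).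

Lemma ghom1 l (hl : prime l) Phi : ghom (hl := hl) Phi -> Phi (gal_one Qbar) = 0.
Proof. by case=> M _; apply: (addrI (Phi (gal_one Qbar))); rewrite -M gal_mul1 addr0. Qed.

Lemma ghomX l (hl : prime l) Phi s n : ghom (hl := hl) Phi ->
  Phi (gal_pow s n) = Phi s *+ n.
Proof.
move=> hPhi; have [M _] := hPhi; elim: n => [|n IH]; first by rewrite mulr0n (ghom1 hPhi).
by rewrite mulrS -IH -M.
Qed.

Lemma gal_powE s n x : gal_pow (C := Qbar) s n x = iter n s x.
Proof. by elim: n => [//|n IH]; rewrite iterS -IH. Qed.

Lemma ghom_level l (hl : prime l) Phi n s t : ghom (hl := hl) Phi ->
  (Phi (gal_mul s t) n = Phi s n + Phi t n %[mod l ^ n])%N.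
Proof. by case=> M _; rewrite M padicD modn_mod. Qed.

Lemma ghom_tame l (hl : prime l) (z tau : algC) (prim_z : l.-primitive_root z) Phi :
  ghom (hl := hl) Phi -> tau != 0 ->
  (forall s : gal_group Qbar, s z = z -> s tau = z ^+ Phi s 1%N * tau) ->
  forall q (q_pr : prime q) (ql : coprime q l) (r : 'F_q)
    (prim_r : l.-primitive_root r),
  (l %| pval (uplace prim_z q_pr ql (pchar_Fp q_pr) prim_r) (tau ^+ l))%Z.
Proof.
(* The level q + 1 is high enough for every q: l^(q + 1) exceeds q - 1 and so cannot divide it. *)
move=> hPhi tau0 tauP q q_pr ql r prim_r; have [E EP] := hPhi.2 q.+1.
have fM s t := ghom_level q.+1 s t hPhi.
have fE (s : gal_group Qbar) : {in E, s =1 id} -> (Phi s q.+1 = 0 %[mod l ^ q.+1])%N.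
  by move=> sE; rewrite EP.
have tauP' (s : gal_group Qbar) : s z = z -> s tau = z ^+ Phi s q.+1 * tau.
  move=> sz; rewrite tauP // -[in RHS](prim_expr_mod prim_z).
  have := @padic_low _ _ (Phi s) 1 q.+1 isT; rewrite expn1 => ->.
  by rewrite prim_expr_mod.
apply: (@tame_dvd_Fp l hl q z prim_z (fun s => Phi s q.+1) fM E fE tau tau0 tauP').
have q1 := prime_gt1 q_pr; rewrite gtnNdvd //; first by rewrite -ltnS prednK // ltnW.
apply: leq_ltn_trans (leq_pred q) _; apply: ltn_trans (ltnSn q) _.
exact/ltn_expl/prime_gt1.
Qed.

Lemma exprz1_absz (K : fieldType) (x : K) (c : int) : x ^ c = 1 -> x ^+ `|c| = 1.
Proof. by case: c => n //; rewrite NegzE -invr_expz => /eqP; rewrite invr_eq1 => /eqP. Qed.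

(** The class of mu^c is a power of [z], the l-th power of a power of [z']. Hence tau^c lies in
    Q(z') and is fixed by [s], which forces l to divide c times the value of [Phi] at [s]. *)
Lemma kronecker_weber_odd l (l_pr : prime l) (z' : algC) Phi (s : gal_group Qbar) :
  (2 < l)%N -> (l ^ 2).-primitive_root z' -> ghom (hl := l_pr) Phi ->
  s z' = z' -> Phi s 1%N = 0%N.
Proof.
move=> l2 prim_z' hPhi; pose z := z' ^+ l; have l0 := prime_gt0 l_pr.
have prim_z : l.-primitive_root z.
  have ll : (l %| l ^ 2)%N by rewrite expnS dvdn_mulr.
  by have := dvdn_prim_root prim_z' ll; rewrite expnS expn1 mulKn.
have [E EP] := hPhi.2 1%N.
have fM s1 t1 : (Phi (gal_mul s1 t1) 1%N = Phi s1 1%N + Phi t1 1%N %[mod l])%N.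
  by have := ghom_level 1 s1 t1 hPhi; rewrite expn1.
have fE (s1 : gal_group Qbar) : {in E, s1 =1 id} -> (Phi s1 1%N = 0 %[mod l])%N.
  by move=> sE; rewrite EP.
have [tau tau0 tauP] := kummer_generator prim_z fM fE.
pose mu := tau ^+ l; have Fmu : fixF z mu := kummer_pow prim_z tauP.
have mu0 : mu != 0 by rewrite expf_neq0.
have mu_eigen a : coprime a l -> eqpow l z (sg l a mu) (mu ^+ a).
  move=> co; exists (sg l a tau / tau ^+ a); split.
  - exact: (kummer_eigen prim_z fM tauP (sgE prim_z co)).
  - by rewrite mulf_neq0 ?invr_eq0 ?expf_neq0 ?fmorph_eq0.
  by rewrite /mu rmorphXn /= expr_div_n -!exprM [(l * a)%N]mulnC mulrC divfK ?expf_neq0.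
have mu_dvd q (q_pr : prime q) (ql : coprime q l) (r : 'F_q) : (l %| q.-1)%N ->
    l.-primitive_root r -> (l %| vu prim_z q_pr ql (pchar_Fp q_pr) r mu)%Z.
  by move=> _ prim_r; rewrite (vuE prim_z q_pr ql _ prim_r); exact: (ghom_tame prim_z hPhi).
have [c [j [lc [xi [Fxi xi0 Exi]]]]] :=
  eigen_root_of_unity l_pr l2 Fmu mu0 mu_eigen mu_dvd.
move=> sz'; have sz : s z = z by rewrite /z rmorphXn /= sz'.
have key : (tau ^ c / (z' ^+ j * xi)) ^+ l = 1.
  rewrite expr_div_n exprMn -exprM [(j * l)%N]mulnC exprM -/z -Exi.
  have -> : (tau ^ c) ^+ l = mu ^ c by rewrite exprnP exprz_exp mulrC -exprz_exp.
  rewrite divff //.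
  exact: expfz_neq0.
have [k Dk] := prim_rootP prim_z key.
have z'0 := prim_root_neq0 prim_z'; have z0 := prim_root_neq0 prim_z.
have Dtau : tau ^ c = z ^+ k * (z' ^+ j * xi).
  by rewrite -Dk divfK // mulf_neq0 // expf_neq0.
have : s (tau ^ c) = tau ^ c.
  by rewrite Dtau !rmorphM !rmorphXn /= sz' (Fxi s sz).
rewrite fmorphXz /= tauP // exprzMl ?unitfE ?expf_neq0 //.
rewrite -[X in _ = X]mul1r => /(mulIf (expfz_neq0 c tau0))/exprz1_absz.
rewrite -exprM => /eqP; rewrite -(prim_order_dvd prim_z) Euclid_dvdM //.
rewrite dvdzE /= in lc; rewrite (negPf lc) orbF => lP.
by apply/eqP; apply: contraLR lP => P0; rewrite gtnNdvd ?lt0n // -[X in (_ < X)%N]expn1 padic_lt.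
Qed.

Lemma pval_uplace_nat N (z : algC) (prim_z : N.-primitive_root z) q (q_pr : prime q)
    (ql : coprime q N) (r : 'F_q) (prim_r : N.-primitive_root r) m : (0 < m)%N ->
  pval (uplace prim_z q_pr ql (pchar_Fp q_pr) prim_r) m%:R = (logn q m)%:Z.
Proof.
move=> m0; set p := uplace _ _ _ _ _.
have [m' qm'] := pfactor_coprime q_pr m0; set a := logn q m => Dm.
have m'0 : (0 < m')%N by move: m0; rewrite Dm muln_gt0 => /andP[].
have qC : (q%:R : algC) != 0 by rewrite pnatr_eq0 -lt0n prime_gt0.
have m'C : (m'%:R : algC) != 0 by rewrite pnatr_eq0 -lt0n.
have vq : pval p q%:R = 1.
  by rewrite -(rmorph_nat (ev z) q); exact: (pvalE (isvalw p)).
have vm' : pval p m'%:R = 0.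
  rewrite -(rmorph_nat (ev z) m'); apply/pval_unit/unitp_ev.
  by rewrite rmorph_nat -(dvdn_pcharf (pchar_Fp q_pr)) -prime_coprime.
rewrite Dm natrM natrX pvalM ?expf_neq0 //; last 1 first.
- exact/fixFX/fixF_nat.
- by rewrite vm' add0r pvalX ?vq ?natz //; exact: fixF_nat.
exact: fixF_nat.
Qed.

Lemma square_up_to_two m : (0 < m)%N ->
  (forall q, prime q -> q != 2 -> ~~ odd (logn q m)) ->
  exists j d, [/\ (0 < d)%N & m = (2 ^ j * d ^ 2)%N].
Proof.
elim/ltn_ind: m => m IH m0 mP; have [m1|m1] := leqP m 1.
  by exists 0%N, 1%N; split=> //; lia.
have [q q_pr /dvdnP[m' Dm]] := pdivP m1.
have m'0 : (0 < m')%N by move: m0; rewrite Dm muln_gt0 => /andP[].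
have [q2|q2] := eqVneq q 2%N.
  have [|//||j [d [d0 Dm']]] := IH m'.
  - by rewrite Dm q2; lia.
  - move=> q' q'_pr q'2; have := mP q' q'_pr q'2.
    by rewrite Dm q2 lognM // (logn_prime _ (isT : prime 2)) (negPf q'2) addn0.
  by exists j.+1, d; split=> //; rewrite Dm Dm' q2 [(2 ^ j.+1)%N]expnS mulnC mulnA.
have : (0 < logn q m')%N.
  have q0 := prime_gt0 q_pr; have := mP q q_pr q2; rewrite Dm lognM // (logn_prime _ q_pr) eqxx addn1 /=.
  by rewrite negbK; case: (logn q m').
rewrite logn_gt0 mem_primes => /and3P[_ _ /dvdnP[n Dm']].
have n0 : (0 < n)%N by move: m'0; rewrite Dm' muln_gt0 => /andP[].
have [|//||j [d [d0 Dn]]] := IH n.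
- by rewrite Dm Dm' -mulnA ltn_Pmulr //; have := prime_gt1 q_pr; nia.
- move=> q' q'_pr q'2; have := mP q' q'_pr q'2.
  by rewrite Dm Dm' !lognM ?muln_gt0 ?n0 ?prime_gt0 // -addnA addnn oddD odd_double addbF.
exists j, (d * q)%N; split; first by rewrite muln_gt0 d0 prime_gt0.
by rewrite Dm Dm' Dn expnMn; lia.
Qed.

(** For a primitive eighth root of unity this exhibits the square root of 2. *)
Lemma add_inv_sqr (w : algC) : w ^+ 4 = -1 -> (w + w^-1) ^+ 2 = 2%:R.
Proof.
move=> w4; have w0 : w != 0.
  by apply: contra_eq_neq w4 => ->; rewrite expr0n /= eq_sym oppr_eq0 oner_eq0.
have E0 : w ^+ 2 + w^-1 ^+ 2 = 0.
  apply: (mulfI (expf_neq0 2 w0)); rewrite mulr0 mulrDr -exprD w4 -exprMn divff //.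
  by rewrite expr1n addNr.
by rewrite sqrrD divff // addrAC E0 add0r.
Qed.

(** The Kummer generator has a rational square, positive because complex conjugation fixes [tau] and
    with even valuation at every odd prime. So [tau] is a rational multiple of a power of the square
    root of 2. *)
Lemma kronecker_weber_two (hl : prime 2) (w : algC) Phi (s : gal_group Qbar) :
  w ^+ 4 = -1 -> ghom (hl := hl) Phi -> s (w + w^-1) = w + w^-1 -> Phi s 1%N = 0%N.
Proof.
move=> w4 hPhi; have [z prim_z] := C_prim_root_exists (isT : 0 < 2)%N.
have zN : z = -1.
  have : z ^+ 2 = 1 := prim_expr_order prim_z.
  move/eqP; rewrite sqrf_eq1 => /orP[/eqP z1|/eqP //].
  by have := prim_order_dvd prim_z 1; rewrite expr1 z1 eqxx.
have fixz (s1 : gal_group Qbar) : s1 z = z by rewrite zN rmorphN1.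
have [E EP] := hPhi.2 1%N.
have fM s1 t1 : (Phi (gal_mul s1 t1) 1%N = Phi s1 1%N + Phi t1 1%N %[mod 2])%N.
  by have := ghom_level 1 s1 t1 hPhi; rewrite expn1.
have fE (s1 : gal_group Qbar) : {in E, s1 =1 id} -> (Phi s1 1%N = 0 %[mod 2])%N.
  by move=> sE; rewrite EP.
have [tau tau0 tauP] := kummer_generator prim_z fM fE.
pose mu := tau ^+ 2; have Fmu : fixF z mu := kummer_pow prim_z tauP.
pose c := gal_of_aut Num.conj.
(* Conjugation is an involution and Z_2 is torsion free. *)
have Phic : Phi c = 0.
  have cc : gal_mul c c = gal_one Qbar by apply: gal_ext => x; exact: conjCK.
  have := ghom1 hPhi; rewrite -cc hPhi.1 -mulr2n -mulr_natl => /eqP.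
  have := padic_natl_neq0 hl 1; rewrite expr1 mulf_eq0 => /negPf -> /=.
  by move/eqP.
have tauR : tau^* = tau.
  by have := tauP c (fixz c); rewrite Phic padic0 expr0 mul1r.
have mu_gt0 : 0 < mu.
  by rewrite /mu expr2 -{2}tauR -normCK exprn_gt0 // normr_gt0.
have [P [N [N0 Dmu]]] := fixF_frac Fmu.
have [a Da] : exists a : int, ev z P = a%:~R.
  exists (ev (-1) P); rewrite -[RHS]/((intmul 1 : int -> algC) _).
  by rewrite (ev_rmorph (-1) (intr : {rmorphism int -> algC})) rmorphN1 zN.
have NC : (N%:R : algC) != 0 by rewrite pnatr_eq0 -lt0n.
have a0 : (0 < a)%R.
  by move: mu_gt0; rewrite Dmu Da pmulr_lgt0 ?invr_gt0 ?ltr0n // ltr0z.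
pose m := (`|a| * N)%N.
have m0 : (0 < m)%N by rewrite muln_gt0 N0 absz_gt0 gt_eqF.
have Dm : m%:R = (tau * N%:R) ^+ 2 :> algC.
  rewrite exprMn -/mu Dmu Da expr2 mulrA divfK // /m natrM; congr (_ * _).
  by rewrite -[in RHS](gtz0_abs a0).
have mP q : prime q -> q != 2 -> ~~ odd (logn q m).
  move=> q_pr q2; have ql : coprime q 2.
    by rewrite prime_coprime // dvdn_prime2.
  have lq : (2 %| q.-1)%N.
    by move: q_pr => /even_prime[/eqP|]; [rewrite (negPf q2)|case: (q) => [|n] //=; rewrite dvdn2].
  have [r prim_r] := Fp_prim_root (isT : prime 2) q_pr lq.
  have := ghom_tame prim_z hPhi tau0 (fun s1 _ => tauP s1 (fixz s1)) q_pr ql prim_r.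
  have := pval_uplace_nat prim_z q_pr ql prim_r m0.
  have := pval_uplace_nat prim_z q_pr ql prim_r N0.
  set v := pval _ => vN vm vt.
  have : v m%:R = v (tau ^+ 2) + (v N%:R) *+ 2.
    have <- : v (N%:R ^+ 2) = v N%:R *+ 2 by apply: pvalX => //; exact: fixF_nat.
    rewrite Dm exprMn; apply: pvalM; [exact: Fmu|exact/fixFX/fixF_nat| |]; exact: expf_neq0.
  rewrite vm vN => Ev; move: vt; have -> : v (tau ^+ 2) = (logn q m)%:Z - (logn q N)%:Z *+ 2.
    by rewrite Ev addrK.
  by rewrite -mulr_natr natz rpredBr ?dvdz_mull // dvdzE /= dvdn2.
have [j [d [d0 Dm2]]] := square_up_to_two m0 mP.
set r2 := w + w^-1.
have r22 : r2 ^+ 2 = 2%:R := add_inv_sqr w4.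
have dC : (d%:R : algC) != 0 by rewrite pnatr_eq0 -lt0n.
have : (tau * N%:R) ^+ 2 = (r2 ^+ j * d%:R) ^+ 2.
  by rewrite -Dm Dm2 exprMn exprAC r22 natrM !natrX.
move=> /eqP; rewrite eqf_sqr => Etau sr2.
have : s (tau * N%:R) = tau * N%:R.
  by case/orP: Etau => /eqP ->; rewrite ?rmorphN rmorphM rmorphXn rmorph_nat /= sr2.
rewrite rmorphM rmorph_nat /= => /(mulIf NC); rewrite tauP // -[X in _ = X]mul1r.
move/(mulIf tau0)/eqP; rewrite -(prim_order_dvd prim_z) => lP.
by apply/eqP; apply: contraLR lP => P0; rewrite gtnNdvd ?lt0n // -[X in (_ < X)%N]expn1 padic_lt.
Qed.

Lemma exp1D_mod_square l b : ((1 + l) ^ b = 1 + l * b %[mod l ^ 2])%N.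
Proof.
elim: b => [|b IH]; first by rewrite muln0.
rewrite expnS -modnMmr IH modnMmr.
have -> : ((1 + l) * (1 + l * b) = b * l ^ 2 + (1 + l * b.+1))%N by rewrite expnS expn1; lia.
by rewrite modnMDl.
Qed.

(** For odd l, [t] generates the subgroup of order l of Gal(Q(zeta_(l^2))/Q). The power s^(l - 1)
    acts there as a power of [t], and l - 1 is prime to l. *)
Lemma kronecker_weber l (hl : prime l) : exists t : gal_group Qbar,
  forall Phi, ghom (hl := hl) Phi -> Phi t 1%N = 0%N -> forall s, Phi s 1%N = 0%N.
Proof.
have [l2|l2] := leqP l 2.
  have El : l = 2 by apply/eqP; rewrite eqn_leq l2 prime_gt1.
  subst l; have [w prim_w] := C_prim_root_exists (isT : 0 < 8)%N.
  have w0 := prim_root_neq0 prim_w.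
  have w4 : w ^+ 4 = -1.
    have : (w ^+ 4) ^+ 2 = 1 by rewrite -exprM (prim_expr_order prim_w).
    move/eqP; rewrite sqrf_eq1 => /orP[/eqP w41|/eqP //].
    by have := prim_order_dvd prim_w 4; rewrite w41 eqxx.
  (* The exponent 3 modulo 8 changes the sign of the square root of 2. *)
  have [nu nuP] := Qn_aut_exists (isT : coprime 3 8).
  have nuw : nu w = w ^+ 3 by apply/nuP/prim_expr_order.
  have w3 : w ^+ 3 = - w^-1.
    by apply: (mulfI w0); rewrite -exprS w4 mulrN divff.
  pose t := gal_of_aut nu; exists t => Phi hPhi Phit s.
  set r2 := w + w^-1.
  have tr2 : t r2 = - r2.
    by rewrite /r2 rmorphD fmorphV /= nuw w3 invrN invrK opprD addrC.
  have fix0 := kronecker_weber_two w4 hPhi.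
  have : (s r2) ^+ 2 = r2 ^+ 2.
    by rewrite -rmorphXn /= (add_inv_sqr w4) rmorph_nat.
  move=> /eqP; rewrite eqf_sqr => /orP[/eqP /fix0 //|/eqP sr2].
  have /fix0 : gal_mul s t r2 = r2 by rewrite /= tr2 rmorphN /= sr2 opprK.
  by rewrite hPhi.1 padicD Phit addn0 padic_mod.
have l20 : (0 < l ^ 2)%N by rewrite expn_gt0 prime_gt0.
have [z prim_z] := C_prim_root_exists l20.
have co : coprime (1 + l) (l ^ 2) by rewrite coprimeXr // coprime_sym /coprime gcdnDr gcdn1.
have [nu nuP] := Qn_aut_exists co.
pose t := gal_of_aut nu; exists t => Phi hPhi Phit s.
have tz : t z = z ^+ (1 + l) by apply/nuP/prim_expr_order.
have [a Da] : exists a : nat, s z = z ^+ a.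
  have : s z ^+ (l ^ 2) = 1 by rewrite -rmorphXn /= (prim_expr_order prim_z) rmorph1.
  by move/(prim_rootP prim_z) => [a Da]; exists a.
have powz (u : gal_group Qbar) b n : u z = z ^+ b -> gal_pow u n z = z ^+ (b ^ n).
  move=> uz; elim: n => [|n IH]; first by rewrite expn0 expr1.
  have -> : gal_pow u n.+1 z = u (gal_pow u n z) by [].
  by rewrite IH rmorphXn /= uz -exprM -expnS.
have coa : coprime a l.
  have : (l ^ 2).-primitive_root (s z) by rewrite fmorph_primitive_root.
  by rewrite Da (prim_root_exp_coprime _ prim_z) coprime_pexpr.
have : (a ^ l.-1 = 1 %[mod l])%N.
  by rewrite -(totient_prime hl) Euler_exp_totient.
have a0 : (0 < a ^ l.-1)%N.
  rewrite expn_gt0; case: a coa {Da} => [|a] //; rewrite /coprime gcd0n => /eqP l1.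
  by rewrite l1 in l2.
move/eqP; rewrite eqn_mod_dvd // => /dvdnP[b Db].
have Dab : (a ^ l.-1 = 1 + l * b)%N by rewrite mulnC -Db subnKC.
(* Modulo l^2 the power (1 + l)^b is 1 + lb, so t^b and s^(l - 1) agree on the l^2-th roots of
   unity. *)
pose tb := gal_pow t b; pose s1 := gal_pow s l.-1.
have Es1 : s1 z = tb z.
  rewrite (powz s a) // (powz t (1 + l)%N) // Dab -(prim_expr_mod prim_z).
  by rewrite -exp1D_mod_square prim_expr_mod.
have uz : gal_mul (gal_opp tb) s1 z = z by rewrite /= Es1 gal_funK.
have := kronecker_weber_odd l2 prim_z hPhi uz.
have -> : Phi (gal_mul (gal_opp tb) s1) = Phi s1 - Phi tb.
  apply: (addrI (Phi tb)); rewrite -hPhi.1 gal_mulA gal_mulV gal_1mul.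
  by rewrite addrC subrK.
rewrite !(ghomX _ _ hPhi) => E.
have : (Phi s *+ l.-1) 1%N = 0%N.
  rewrite -[_ *+ l.-1](subrK (Phi t *+ b)) padicD E add0n padic_mod.
  by rewrite -mulr_natr padicM Phit mul0n mod0n.
rewrite -mulr_natr padicM padic_nat modnMmr expn1 => /eqP.
rewrite -/(dvdn _ _) Gauss_dvdl; last first.
  by rewrite prime_coprime // gtnNdvd //; lia.
move=> lP; apply/eqP; apply: contraLR lP => P0.
by rewrite gtnNdvd ?lt0n // -[X in (_ < X)%N]expn1 padic_lt.
Qed.

Lemma expr1D_quad (R : comNzRingType) (x : R) m :
  exists K, (1 + x) ^+ m = 1 + x *+ m + x ^+ 2 * K.
Proof.
elim: m => [|m [K IH]]; first by exists 0; rewrite expr0 mulr0n mulr0 !addr0.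
exists (m%:R + K + x * K); rewrite exprS IH mulrS -[x *+ m]mulr_natr.
by move: (m%:R) => c; ring.
Qed.

(** * The logarithm of the cyclotomic character *)

Section PadicLog.
Variables (l : nat) (hl : prime l).
Local Notation Zl := (padic_int hl).
Implicit Types (u v b x y B : Zl).

Lemma padic_eq0 x : (forall n, x n = 0%N) -> x = 0.
Proof. by move=> x0; apply: padic_ext => n; rewrite x0 padic0. Qed.

Lemma padic_one1 : (1 : Zl) 1%N = 1%N.
Proof. by rewrite -[1]/(1%:R : Zl) padic_nat expn1 modn_small ?prime_gt1. Qed.

Lemma padicX x m n : (x ^+ m) n = (x n ^ m %% l ^ n)%N.
Proof.
elim: m => [|m IH]; first by rewrite expr0 expn0 -[1]/(1%:R : Zl) padic_nat.
by rewrite exprS padicM IH modnMmr expnS.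
Qed.

Lemma padic_congr x y n : x n = y n -> exists b, x = y + l%:R ^+ n * b.
Proof.
move=> xy; have [|b Db] := @padic_divX l hl (x - y) n; last first.
  by exists b; rewrite -Db addrC subrK.
have := padicD (x - y) y n; rewrite subrK xy.
set d := pseq (_ - _) n => E.
have /eqP : (d + y n = 0 + y n %[mod l ^ n])%N by rewrite -E add0n padic_mod.
by rewrite eqn_modDr mod0n padic_mod => /eqP.
Qed.

Lemma padic_natr_neq0 m : (0 < m)%N -> (m%:R : Zl) != 0.
Proof.
move=> m0; apply/eqP => /(congr1 (fun x : Zl => x m)); rewrite padic0 padic_nat.
by rewrite modn_small => [E|]; [rewrite E in m0|exact/ltn_expl/prime_gt1].
Qed.

(* B is the logarithm of u, divided by l^2. *)
Definition is_log u B := forall n, exists d,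
  u ^+ (l ^ n) = 1 + l%:R ^+ n.+2 * (B + l%:R ^+ n * d).

(** Put u = 1 + l^2 b and write u^(l^n) = 1 + l^(n+2) b_n. Starting from l^2, the correction from
    b_n to b_(n+1) is divisible by l^(n+1) even for l = 2. Each b_n is b times a unit, so a zero
    limit forces b = 0. *)
Lemma is_log_exists b : exists B, is_log (1 + l%:R ^+ 2 * b) B /\ (B = 0 -> b = 0).
Proof.
pose K n (c : Zl) := sval (cid (expr1D_quad (l%:R ^+ n.+2 * c) l)).
have KP n c : (1 + l%:R ^+ n.+2 * c) ^+ l
    = 1 + l%:R ^+ n.+3 * (c + l%:R ^+ n.+1 * (c ^+ 2 * K n c)).
  have := svalP (cid (expr1D_quad (l%:R ^+ n.+2 * c) l)); rewrite /= -/(K n c) => ->.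
  by rewrite -mulr_natr !exprS; set e := _ ^+ n; ring.
pose bs := fix bs n :=
  if n is m.+1 then bs m + l%:R ^+ m.+1 * (bs m ^+ 2 * K m (bs m)) else b.
have bsS n : bs n.+1 = bs n + l%:R ^+ n.+1 * (bs n ^+ 2 * K n (bs n)) by [].
have bsP n : (1 + l%:R ^+ 2 * b) ^+ (l ^ n) = 1 + l%:R ^+ n.+2 * bs n.
  elim: n => [|n IH]; first by rewrite expn0 expr1.
  by rewrite expnSr exprM IH KP bsS.
have bsU n : exists w, bs n = b * (1 + l%:R * w).
  elim: n => [|n [w Dw]]; first by exists 0; rewrite mulr0 addr0 mulr1.
  exists (w + (1 + l%:R * w) * (l%:R ^+ n * bs n * K n (bs n))).
  by rewrite bsS exprS; move: (K n (bs n)) => k; rewrite Dw; set e := _ ^+ n; ring.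
have [|B BP] := @padic_limit l hl bs.
  by move=> k; rewrite bsS padicD exprSr -mulrA padic_modX addn0 padic_mod.
exists B; split=> [n|B0].
  have [d Dd] := BP n; exists (- d); rewrite bsP; congr (1 + _ * _).
  by rewrite mulrN -Dd opprB addrC subrK.
apply: padic_eq0 => n; have [d Dd] := BP n; have [w Dw] := bsU n.
have [|v Dv] := @padic_unit_inv l hl (1 + l%:R * w).
  rewrite padicD padicM padic_nat expn1 modnn mul0n mod0n addn0 padic_one1.
  by rewrite modn_small ?prime_gt1.
have Db : bs n = - (l%:R ^+ n * d) by rewrite -Dd B0 sub0r opprK.
have -> : b = l%:R ^+ n * (- d * v).
  apply: etrans (_ : b * (1 + l%:R * w) * v = _); first by rewrite -mulrA Dv mulr1.
  by rewrite -Dw Db; ring.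
exact: padic_modX.
Qed.

Lemma is_log_uniq u B C : is_log u B -> is_log u C -> B = C.
Proof.
move=> uB uC; apply/eqP; rewrite -subr_eq0; apply/eqP; apply: padic_eq0 => n.
have [d Dd] := uB n; have [e De] := uC n.
move: Dd; rewrite De => /addrI/(mulfI (padic_natl_neq0 hl _)) E.
have -> : B = C + l%:R ^+ n * e - l%:R ^+ n * d by rewrite E addrK.
have -> : C + l%:R ^+ n * e - l%:R ^+ n * d - C = l%:R ^+ n * (e - d) by ring.
exact: padic_modX.
Qed.

Lemma is_logM u v B C : is_log u B -> is_log v C -> is_log (u * v) (B + C).
Proof.
move=> uB vC n; have [d Dd] := uB n; have [e De] := vC n.
exists (d + e + l%:R ^+ 2 * ((B + l%:R ^+ n * d) * (C + l%:R ^+ n * e))).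
by rewrite exprMn Dd De !exprS; set X := _ ^+ n; ring.
Qed.

Lemma is_log_near u B n x :
  is_log u B -> u = 1 + l%:R ^+ (2 * n).+2 * x -> B n = 0%N.
Proof.
move=> uB Du; have [d Dd] := uB n.
have [K DK] := expr1D_quad (l%:R ^+ (2 * n).+2 * x) (l ^ n).
move: Dd; rewrite Du DK -addrA => /addrI.
(* Of the 2n + 2 factors l, n + 2 cancel against the normalization of the logarithm, which leaves
   l^n. *)
have -> : l%:R ^+ (2 * n).+2 = l%:R ^+ n.+2 * l%:R ^+ n :> Zl.
  by rewrite -exprD; congr (_ ^+ _); lia.
set L := _ ^+ n.+2; set X := _ ^+ n => E.
have E2 : L * (B + X * d) = L * (X * (x * ((l ^ n)%:R + L * X * x * K))).
  by rewrite -E -mulr_natr; ring.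
have E3 := mulfI (padic_natl_neq0 hl n.+2) E2.
have -> : B = X * (x * ((l ^ n)%:R + L * X * x * K) - d) by rewrite mulrBr -E3 addrK.
exact: padic_modX.
Qed.

Lemma lroot_ex n : exists x : algC, (l ^ n).-primitive_root x.
Proof.
have ln0 : (0 < l ^ n)%N by rewrite expn_gt0 prime_gt0.
by have [x px] := C_prim_root_exists ln0; exists x.
Qed.

Definition lroot n : algC := sval (cid (lroot_ex n)).
Lemma lroot_prim n : (l ^ n).-primitive_root (lroot n).
Proof. exact: (svalP (cid (lroot_ex n))). Qed.

Implicit Types s t : gal_group Qbar.

Lemma cyclotomic_exponent_ex s n : exists a, s (lroot n) = lroot n ^+ a.
Proof.
have prim := lroot_prim n.
have : s (lroot n) ^+ (l ^ n) = 1 by rewrite -rmorphXn /= (prim_expr_order prim) rmorph1.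
by move/(prim_rootP prim) => [a Da]; exists a.
Qed.

Definition cyclotomic_exponent s n := sval (cid (cyclotomic_exponent_ex s n)).

Lemma cyclotomic_exponentP s n (x : algC) :
  x ^+ (l ^ n) = 1 -> s x = x ^+ cyclotomic_exponent s n.
Proof.
move/(prim_rootP (lroot_prim n)) => [i ->]; rewrite rmorphXn /=.
by rewrite (svalP (cid (cyclotomic_exponent_ex s n))) -!exprM mulnC.
Qed.

Lemma cyclotomic_exponentS s n :
  (cyclotomic_exponent s n.+1 = cyclotomic_exponent s n %[mod l ^ n])%N.
Proof.
have xn := prim_expr_order (lroot_prim n).
have xn1 : lroot n ^+ (l ^ n.+1) = 1 by rewrite expnSr exprM xn expr1n.
apply/eqP; rewrite -(eq_prim_root_expr (lroot_prim n)).
by rewrite -(cyclotomic_exponentP s xn1) -(cyclotomic_exponentP s xn).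
Qed.

Definition cyclotomic_char s : Zl := padic_of hl (cyclotomic_exponentS s).
Local Notation chi := cyclotomic_char.

Lemma cyclotomic_charP s n (x : algC) : x ^+ (l ^ n) = 1 -> s x = x ^+ chi s n.
Proof. by move=> xn; rewrite (cyclotomic_exponentP s xn) -(expr_mod _ xn). Qed.

Lemma cyclotomic_char_uniq s n (x : algC) (b : nat) :
  (l ^ n).-primitive_root x -> s x = x ^+ b -> chi s n = (b %% l ^ n)%N.
Proof.
move=> prim; rewrite (cyclotomic_exponentP s (prim_expr_order prim)) => /eqP.
by rewrite (eq_prim_root_expr prim) => /eqP.
Qed.

Lemma cyclotomic_charM s t : chi (gal_mul s t) = chi s * chi t.
Proof.
apply: padic_ext => n; rewrite padicM; apply: cyclotomic_char_uniq (lroot_prim n) _.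
have xn := prim_expr_order (lroot_prim n).
by rewrite /= (cyclotomic_charP t xn) rmorphXn /= (cyclotomic_charP s xn) -exprM.
Qed.

Lemma cyclotomic_char1 : chi (gal_one Qbar) = 1.
Proof.
apply: padic_ext => n; rewrite (cyclotomic_char_uniq (b := 1) (lroot_prim n)) //.
Qed.

Lemma cyclotomic_char_frobenius p (hp : prime p) (F : gal_group Qbar) :
  frobenius_at hp F -> p <> l -> chi F = p%:R.
Proof.
move=> hF pl; apply: padic_ext => n; rewrite padic_nat.
apply: cyclotomic_char_uniq (lroot_prim n) _.
apply: (frobenius_on_roots hF) (lroot_prim n).
by rewrite coprimeXr // prime_coprime // dvdn_prime2 //; apply/eqP.
Qed.

(** The exponent l - 1 gives 1 modulo l by Fermat, and the further exponent l gives 1 modulo l^2. *)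
Lemma cyclotomic_char_pow s : exists b, chi s ^+ (l * l.-1) = 1 + l%:R ^+ 2 * b.
Proof.
have chi1 : chi s 1%N != 0%N.
  apply/eqP => s0; have := cyclotomic_char1; rewrite -(gal_mulV s) cyclotomic_charM.
  move/(congr1 (fun x : Zl => x 1%N)).
  by rewrite padicM s0 mul0n mod0n padic_one1.
have [|c Dc] := @padic_congr (chi s ^+ l.-1) 1 1.
  rewrite padicX padic_one1 expn1 -(totient_prime hl) Euler_exp_totient.
    by rewrite modn_small ?prime_gt1.
  by have := padic_coprime 1 chi1; rewrite expn1.
rewrite mulnC exprM Dc; have [K ->] := expr1D_quad (l%:R ^+ 1 * c) l.
by exists (c + c ^+ 2 * K); rewrite -mulr_natr; ring.
Qed.

Lemma log_cyclotomic p (hp : prime p) (F : gal_group Qbar) :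
  frobenius_at hp F -> p <> l -> exists Psi, ghom (hl := hl) Psi /\ Psi F <> 0.
Proof.
move=> hF pl; pose k := (l * l.-1)%N.
have ex s : exists B, is_log (chi s ^+ k) B /\ (B = 0 -> chi s ^+ k = 1).
  have [b ->] := cyclotomic_char_pow s; have [B [lB B0]] := is_log_exists b.
  by exists B; split=> // /B0 ->; rewrite mulr0 addr0.
pose Psi s := sval (cid (ex s)); have PsiP s := svalP (cid (ex s)).
exists Psi; split; first split=> [s t|n].
- apply: is_log_uniq (PsiP (gal_mul s t)).1 _; rewrite cyclotomic_charM exprMn.
  by apply: is_logM; exact: (PsiP _).1.
- exists [:: lroot (2 * n).+2] => s sE.
  have [|b Db] := @padic_congr (chi s) 1 (2 * n).+2.
    rewrite (cyclotomic_char_uniq (b := 1) (lroot_prim _)) ?expr1 //.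
    by apply: sE; rewrite mem_seq1.
  have [K DK] := expr1D_quad (l%:R ^+ (2 * n).+2 * b) k.
  apply: (is_log_near (x := b *+ k + l%:R ^+ (2 * n).+2 * b ^+ 2 * K) (PsiP s).1).
  rewrite Db DK -addrA mulrDr mulrnAr; congr (_ + (_ + _)).
  by rewrite exprMn expr2 !mulrA.
move=> /(PsiP F).2; rewrite (cyclotomic_char_frobenius hF pl) -natrX.
(* At level p^k the integer p^k is its own residue, because p^k < l^(p^k). *)
move/(congr1 (fun x : Zl => x (p ^ k)%N)); rewrite -[1]/(1%:R : Zl) !padic_nat.
have l1 := prime_gt1 hl; have pk : (p ^ k < l ^ (p ^ k))%N by apply: ltn_expl.
have k0 : (0 < k)%N by rewrite /k muln_gt0 -subn1 subn_gt0 l1 ltnW.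
have pk1 : (1 < p ^ k)%N by rewrite -(exp1n k) ltn_exp2r // prime_gt1.
rewrite !modn_small // => [E|]; first by rewrite E in pk1.
exact: ltn_trans pk1 pk.
Qed.

Lemma ghom_div Phi : ghom (hl := hl) Phi -> (forall s, Phi s 1%N = 0%N) ->
  exists Phi', ghom (hl := hl) Phi' /\ forall s, Phi s = l%:R * Phi' s.
Proof.
move=> [M C] P1; pose Phi' s := sval (cid (padic_divl (P1 s))).
have P' s : Phi s = l%:R * Phi' s := svalP (cid (padic_divl (P1 s))).
have l0 : (l%:R : Zl) != 0 by have := padic_natl_neq0 hl 1; rewrite expr1.
exists Phi'; split=> //; split=> [s t|n].
  by apply: (mulfI l0); rewrite mulrDr -!P' M.
have [E EP] := C n.+1; exists E => s /EP /padic_divX[y Dy].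
have -> : Phi' s = l%:R ^+ n * y by apply: (mulfI l0); rewrite -P' Dy exprS mulrA.
exact: padic_modX.
Qed.

Lemma ghom_lin Phi Psi b : ghom (hl := hl) Phi -> ghom (hl := hl) Psi ->
  ghom (hl := hl) (fun s => Psi s - b * Phi s).
Proof.
move=> [M C] [M' C']; split=> [s t|n]; first by rewrite M M'; ring.
have [E EP] := C n; have [E' EP'] := C' n; exists (E ++ E') => s sE.
have /padic_divX[y ->] : Phi s n = 0%N by apply: EP => x xE; rewrite sE // mem_cat xE.
have /padic_divX[y' ->] : Psi s n = 0%N.
  by apply: EP' => x xE; rewrite sE // mem_cat xE orbT.
have -> : l%:R ^+ n * y' - b * (l%:R ^+ n * y) = l%:R ^+ n * (y' - b * y) by ring.
exact: padic_modX.
Qed.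

(* Homomorphisms to Z_l form a rank one module (Kronecker-Weber), so that one
   of them killing F would force the logarithm of the cyclotomic character to
   kill F as well. *)
Lemma ghom_frobenius_eq0 p (hp : prime p) (F : gal_group Qbar) Phi :
  frobenius_at hp F -> p <> l -> ghom (hl := hl) Phi -> Phi F = 0 ->
  forall s, Phi s = 0.
Proof.
move=> hF pl hPhi PF s0; apply: contrapT => /eqP /padic_neq0[n].
have [t KW] := kronecker_weber hl.
have l0 : (l%:R : Zl) != 0 by have := padic_natl_neq0 hl 1; rewrite expr1.
(* Division by l continues as long as the value at [t] is 0 modulo l; the nonzero residue at level n
   bounds the number of divisions. *)
move=> Pn; have {n Pn hPhi PF} [Phi1 [hPhi1 PF1 Pt1]] : exists Phi1,
    [/\ ghom (hl := hl) Phi1, Phi1 F = 0 & Phi1 t 1%N != 0%N].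
  elim: n => [|n IH] in Phi hPhi PF Pn *; first by rewrite padic_at0 in Pn.
  have [Pt|Pt] := eqVneq (Phi t 1%N) 0%N; last by exists Phi.
  have [Phi' [hPhi' DPhi]] := ghom_div hPhi (KW _ hPhi Pt).
  apply: (IH Phi' hPhi').
    by apply/eqP; move/eqP: PF; rewrite DPhi mulf_eq0 (negPf l0).
  rewrite lt0n; apply: contraTneq Pn => /padic_divX[y Dy].
  by rewrite DPhi Dy mulrA -exprS padic_modX.
have [v Dv] := padic_unit_inv Pt1.
have [Psi [hPsi]] := log_cyclotomic hF pl; apply; apply: padic_eq0 => n.
elim: n => [|n IH] in Psi hPsi *; first exact: padic_at0.
(* This combination vanishes at [t], hence is divisible by l, and has the same value as [Psi] at F.
   Repeating the division shows that the value at F is divisible by every power of l. *)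
have hPsi1 := ghom_lin (Psi t * v) hPhi1 hPsi.
have [|Psi' [hPsi' DPsi]] := ghom_div hPsi1 (KW _ hPsi1 _).
  by rewrite -mulrA [v * _]mulrC Dv mulr1 subrr padic0.
have := DPsi F; rewrite PF1 mulr0 subr0 => ->.
have /padic_divX[y ->] := IH Psi' hPsi'.
by rewrite mulrA -exprS padic_modX.
Qed.

(** The iterates of [x] are roots of one polynomial, so [x] returns after at most as many steps as
    its size, a number that divides the factorial. *)
Lemma gal_iter_fixed s (x : algC) j : iter (j * (size (minCpoly x))`!) s x = x.
Proof.
have [q [Dq _] _] := minCpolyP x; have p0 : minCpoly x != 0 := monic_neq0 (minCpoly_monic x).
have Es : map_poly s (minCpoly x) = minCpoly x.
  by rewrite Dq -map_poly_comp; apply: eq_map_poly => a /=; rewrite fmorph_rat.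
have root_it i : root (minCpoly x) (iter i s x).
  elim: i => [|i IH]; first exact: root_minCpoly.
  by rewrite iterS -Es fmorph_root.
set n := size (minCpoly x); have n0 : (0 < n)%N by rewrite size_poly_gt0.
have [k k0n Dk] : exists2 k, (0 < k <= n)%N & iter k s x = x.
  have : ~~ uniq (traject s x n).
    apply/negP => U; have := @max_poly_roots _ _ (traject s x n) p0 _ U.
    rewrite size_traject ltnn => H; suff: false by [].
    by apply: H; apply/allP => y /trajectP[i _ ->].
  rewrite -(prednK n0) looping_uniq negbK => /trajectP[i ilt Ei].
  exists (n.-1 - i)%N; first by lia.
  have injs : injective (iter i s).
    by elim: (i) => [//|m IH] y1 y2 /(can_inj (gal_funK s))/IH.
  by apply: injs; rewrite -iterD subnKC ?(ltnW ilt).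
have /dvdnP[m ->] := dvdn_fact k0n; rewrite mulnA; elim: (j * m)%N => [//|i IH].
by rewrite mulSn iterD IH Dk.
Qed.

(** [c] may have denominators, but [c] times D takes values in Z_l, because the D-th power of any
    element fixes the finite set on whose pointwise stabilizer [c] is integral. *)
Lemma padic_character_eq0 p (hp : prime p) (F : gal_group Qbar)
    (c : gal_group Qbar -> padic hl) : frobenius_at hp F -> p <> l ->
  (forall s t, c (gal_mul s t) = c s + c t) ->
  (forall N, exists E : seq algC, forall t : gal_group Qbar, {in E, t =1 id} ->
     exists a, c t = Zp_Qp hl (l%:R ^+ N * a)) ->
  c F = 0 -> forall s, c s = 0.
Proof.
move=> hF pl cM cC cF s; have [E EP] := cC 0%N.
have Zinj : injective (Zp_Qp hl).
  move=> x y xy; apply/eqP; rewrite -subr_eq0 -tofrac_eq0.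
  by rewrite -[tofrac _]/(Zp_Qp hl (x - y)) rmorphB xy subrr.
pose D := (\prod_(x <- E) (size (minCpoly x))`!)%N.
have D0 : (0 < D)%N by apply: prodn_gt0 => x; apply: fact_gt0.
have DE t : {in E, gal_pow t D =1 id}.
  move=> x xE; have /dvdnP[j ->] : ((size (minCpoly x))`! %| D)%N.
    by rewrite /D (big_rem x) //= dvdn_mulr.
  by rewrite gal_powE gal_iter_fixed.
have c1 : c (gal_one Qbar) = 0.
  by apply: (addrI (c (gal_one Qbar))); rewrite -cM gal_mul1 addr0.
have cX t n : c (gal_pow t n) = c t *+ n.
  by elim: n => [|n IH]; rewrite ?mulr0n // mulrS -IH -cM.
have DI t : exists a, c t *+ D = Zp_Qp hl a.
  by have [a Da] := EP _ (DE t); exists a; rewrite -cX Da mul1r.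
pose Phi t := sval (cid (DI t)).
have PhiP t : c t *+ D = Zp_Qp hl (Phi t) := svalP (cid (DI t)).
have hPhi : ghom (hl := hl) Phi.
  split=> [t u|n]; first by apply: Zinj; rewrite rmorphD /= -!PhiP cM mulrnDl.
  have [E' EP'] := cC n; exists E' => t /EP'[a Da].
  have -> : Phi t = l%:R ^+ n * (a *+ D).
    by apply: Zinj; rewrite -PhiP Da mulrnAr rmorphMn.
  exact: padic_modX.
have PhiF : Phi F = 0 by apply: Zinj; rewrite -PhiP cF mul0rn rmorph0.
have := PhiP s; rewrite (ghom_frobenius_eq0 hF pl hPhi PhiF) rmorph0 => /eqP.
rewrite -mulr_natr mulf_eq0 => /orP[/eqP //|].
rewrite -(rmorph_nat (Zp_Qp hl)) tofrac_eq0 => DD.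
by have := padic_natr_neq0 D0; rewrite DD.
Qed.

End PadicLog.

(** * Linear algebra: fixed vectors and commutators *)

Lemma vspace_of_pred (K : fieldType) (E : vectType K) (P : E -> Prop) :
  P 0 -> (forall a u v, P u -> P v -> P (a *: u + v)) ->
  exists U : {vspace E}, forall v, v \in U <-> P v.
Proof.
move=> P0 PD.
pose Q d := `[< exists2 U : {vspace E}, \dim U = d & forall v, v \in U -> P v >].
have Q0 : exists d, Q d.
  exists 0%N; apply/asboolP; exists 0%VS; first by rewrite dimv0.
  by move=> v; rewrite memv0 => /eqP ->.
have Qb d : Q d -> (d <= \dim {:E})%N.
  by move=> /asboolP[U <- _]; apply/dimvS/subvf.
case: (ex_maxnP Q0 Qb) => d /asboolP[U dU UP] dmax; exists U => v; split; first exact: UP.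
move=> Pv; apply: contrapT => /negP vU.
have : Q (\dim (U + <[v]>)%VS).
  apply/asboolP; exists (U + <[v]>)%VS => // w /memv_addP[u uU [x /vlineP[a ->] ->]].
  by rewrite addrC; apply: PD => //; apply: UP.
move/dmax; rewrite -dU => le; case/negP: vU.
have /eqP -> : (U == U + <[v]>)%VS by rewrite eqEdim addvSl.
by apply: (subvP (addvSr U _)); rewrite memv_line.
Qed.

Section FixedVector.
Variables (K : fieldType) (E : vectType K) (G : Type) (T : G -> 'End(E)).
Variables (U0 : {vspace E}) (eps : {linear E -> K^o}).
Hypothesis T_stable : forall s u, u \in U0 -> T s u \in U0.
Hypothesis T_comm : forall s t u, u \in U0 -> T s (T t u) = T t (T s u).
Hypothesis T_eps : forall s u, u \in U0 -> eps (T s u) = eps u.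
Hypothesis T_split : forall u, u \in U0 ->
  (forall s t, T t (T s u - u) = T s u - u) -> forall s, T s u = u.
Hypothesis eps_neq0 : exists2 u, u \in U0 & eps u != 0.

Let stable (U : {vspace E}) := forall s u, u \in U -> T s u \in U.

Let minimal_sub (Q : {vspace E} -> Prop) : (exists U, Q U) ->
  exists U, Q U /\ forall U', Q U' -> (U' <= U)%VS -> U' = U.
Proof.
move=> [U1 QU1]; pose R d := `[< exists2 U, \dim U = d & Q U >].
have exR : exists d, R d by exists (\dim U1); apply/asboolP; exists U1.
case: (ex_minnP exR) => d /asboolP[U dU QU] dmin; exists U; split=> // U' QU' sU.
apply/eqP; rewrite eqEdim sU dU; apply: dmin; apply/asboolP.
by exists U'.
Qed.

Let A s : 'End(E) := T s - \1%VF.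
Let AE s u : A s u = T s u - u.
Proof. by rewrite /A add_lfunE opp_lfunE id_lfunE. Qed.

Let Ak s k : 'End(E) := iter k (fun f => A s \o f)%VF \1%VF.
Let AkS s k u : Ak s k.+1 u = A s (Ak s k u).
Proof. by rewrite /Ak /= comp_lfunE. Qed.
Let Ak0 s u : Ak s 0 u = u.
Proof. by rewrite /Ak /= id_lfunE. Qed.
Let AkD s k m u : Ak s (k + m) u = Ak s k (Ak s m u).
Proof. by elim: k => [|k IH]; rewrite ?Ak0 // addSn !AkS IH. Qed.

(** Each T s - 1 is nilpotent on a stable subspace U minimal for containing vectors with eps
    nonzero. If no such vector were fixed, a minimal stable Z strictly above the fixed vectors of U
    would be mapped to them by every T s - 1, against [T_split]. *)
Lemma fixed_vector : exists u, [/\ u \in U0, eps u != 0 & forall s, T s u = u].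
Proof.
pose Q U := [/\ (U <= U0)%VS, stable U & exists2 u, u \in U & eps u != 0].
have [|U [[sU stU [u1 u1U eu1]] minU]] := @minimal_sub Q; first by exists U0.
have inU0 u : u \in U -> u \in U0 by apply: subvP.
have AU s k u : u \in U -> Ak s k u \in U.
  move=> uU; elim: k => [|k IH]; first by rewrite Ak0.
  by rewrite AkS AE memvB ?stU.
have AkT s t k u : u \in U -> Ak s k (T t u) = T t (Ak s k u).
  move=> uU; elim: k => [|k IH]; first by rewrite !Ak0.
  by rewrite !AkS IH !AE linearB /= T_comm // inU0 // AU.
have nilp s : exists k, forall u, u \in U -> Ak s k u = 0.
  (* Fitting's decomposition: once the image of a power is stable, U is its kernel plus its image.
     As eps vanishes on images of T s - 1, the kernel contains a vector with eps nonzero, hence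
     equals U by minimality. *)
  pose R d := `[< exists k, \dim (Ak s k.+1 @: U)%VS = d >].
  have exR : exists d, R d by exists (\dim (Ak s 1 @: U)%VS); apply/asboolP; exists 0%N.
  case: (ex_minnP exR) => d /asboolP[k dk] dmin.
  pose I := (Ak s k.+1 @: U)%VS.
  have II : (Ak s k.+1 @: I)%VS = I.
    have -> : (Ak s k.+1 @: I)%VS = (Ak s (k.+1 + k).+1 @: U)%VS.
      rewrite -limg_comp; congr (_ @: _)%VS; apply/lfunP => u.
      by rewrite comp_lfunE -AkD addnS.
    apply/eqP; rewrite eqEdim; apply/andP; split.
      apply/subvP => _ /memv_imgP[u uU ->]; rewrite -addnS AkD.
      by apply: memv_img; apply: AU.
    by rewrite dk; apply: dmin; apply/asboolP; exists (k.+1 + k)%N.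
  pose Kk := (U :&: lker (Ak s k.+1))%VS.
  have KkU : Kk = U.
    apply: minU; last exact: capvSl.
    split; first exact: subv_trans (capvSl _ _) sU.
      move=> t u; rewrite !memv_cap !memv_ker => /andP[uU /eqP ku].
      by rewrite stU // andTb AkT // ku linear0.
    have : Ak s k.+1 u1 \in (Ak s k.+1 @: I)%VS by rewrite II memv_img.
    case/memv_imgP=> v vI Dv.
    have [w wU Dw] := memv_imgP vI.
    have vU : v \in U by rewrite Dw AU.
    exists (u1 - v).
      by rewrite memv_cap memvB //= memv_ker linearB /= Dv subrr.
    rewrite linearB /= Dw AkS AE linearB /= T_eps ?subrr ?subr0 //.
    exact/inU0/AU.
  exists k.+1 => u; rewrite -KkU memv_cap memv_ker => /andP[_ /eqP] //.
have [UG UGP] : exists UG : {vspace E}, forall u,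
    u \in UG <-> (u \in U /\ forall s, T s u = u).
  apply: vspace_of_pred; first by split; [exact: mem0v|move=> s; rewrite linear0].
  move=> a u v [uU Tu] [vU Tv]; split; first by rewrite memvD // memvZ.
  by move=> s; rewrite linearD linearZ /= Tu Tv.
have [//|nofix] := pselect (exists u, [/\ u \in U0, eps u != 0 & forall s, T s u = u]).
have u1G : u1 \notin UG.
  apply/negP => /UGP[_ Tu1]; apply: nofix; exists u1; split=> //; exact: inU0.
have sUG : (UG <= U)%VS by apply/subvP => u /UGP[].
(* Minimality of Z makes [A s] map it into UG or onto Z modulo UG; the second case contradicts
   nilpotency. *)
pose QZ Z := [/\ (UG <= Z)%VS, (Z <= U)%VS, stable Z & Z <> UG].
have [|Z [[sGZ sZU stZ ZG] minZ]] := @minimal_sub QZ.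
  by exists U; split=> // UU; rewrite -UU u1U in u1G.
have AZ s : (A s @: Z + UG)%VS = UG.
  apply: contrapT => nG; have ZE : (A s @: Z + UG)%VS = Z.
    apply: minZ; last first.
      rewrite subv_add sGZ andbT; apply/subvP => _ /memv_imgP[u uZ ->].
      by rewrite AE memvB ?stZ.
    split=> //; first exact: addvSr.
      rewrite subv_add sUG andbT; apply/subvP => _ /memv_imgP[u uZ ->].
      by rewrite AE memvB ?stU //; apply: (subvP sZU).
    move=> t _ /memv_addP[_ /memv_imgP[u uZ ->] [w wG ->]].
    have /UGP[wU Tw] := wG; rewrite linearD /= Tw memv_add //.
    rewrite AE linearB /= T_comm; last exact/inU0/(subvP sZU).
    by rewrite -AE memv_img // stZ.
  apply: ZG; apply/eqP; rewrite eqEsubv sGZ andbT; apply/subvP => u uZ.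
  have [k Ak_0] := nilp s.
  have AkG m w : w \in UG -> Ak s m w \in UG.
    move=> wG; elim: m => [|m IH]; first by rewrite Ak0.
    by have /UGP[_ Tw] := IH; rewrite AkS AE Tw subrr mem0v.
  have [u' u'Z [w wG ->]] : exists2 u', u' \in Z & exists2 w, w \in UG & u = Ak s k u' + w.
    elim: (k) => [|m [u' u'Z [w wG Du]]].
      by exists u => //; exists 0; rewrite ?mem0v // Ak0 addr0.
    move: u'Z; rewrite -{1}ZE => /memv_addP[_ /memv_imgP[u2 u2Z ->] [w2 w2G Du']].
    exists u2 => //; exists (Ak s m w2 + w); first by rewrite memvD ?AkG.
    rewrite Du Du' linearD /= -addrA; congr (_ + _).
    by rewrite -{1}[u2](Ak0 s) -AkS -AkD addn1.
  by rewrite Ak_0 ?add0r //; apply: (subvP sZU).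
case: ZG; apply/eqP; rewrite eqEsubv sGZ andbT; apply/subvP => u uZ.
have uU : u \in U by apply: (subvP sZU).
apply/UGP; split=> //; apply: T_split; first exact: inU0.
move=> s t; have : A s u \in UG.
  by rewrite -(AZ s); apply: (subvP (addvSl _ _)); rewrite memv_img.
by move/UGP => [_]; rewrite AE.
Qed.

End FixedVector.

(** In an eigenbasis of M, a matrix commuting with M has zero entries between distinct eigenvalues,
    and a commutator with M has zero entries between equal ones; X is subject to both. *)
Lemma diag_commutator (L : fieldType) n (M U X : 'M[L]_n) :
  diagonalizable M -> M \in unitmx ->
  U *m M = M *m U + M *m X -> X *m M = M *m X -> X = 0.
Proof.
move=> [P Pu /diagonalizable_forPex[D /(simmxP Pu) PM]] Mu UM XM.
pose cj A := P *m A *m invmx P.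
have cjM A B : cj (A *m B) = cj A *m cj B.
  by rewrite /cj !mulmxA mulmxKV.
have cjMD : cj M = diag_mx D by rewrite /cj PM mulmxK.
have D0 i : D 0 i != 0.
  have : diag_mx D \in unitmx by rewrite -cjMD !unitmx_mul Pu Mu unitmx_inv.
  by rewrite unitmxE det_diag unitfE => /prodf_neq0; apply.
suff X0 : cj X = 0.
  have -> : X = invmx P *m cj X *m P by rewrite /cj !mulmxA mulVmx // mul1mx mulmxKV.
  by rewrite X0 mulmx0 mul0mx.
have E1 : cj U *m diag_mx D = diag_mx D *m cj U + diag_mx D *m cj X.
  by rewrite -cjMD -!cjM UM /cj mulmxDr mulmxDl.
have E2 : cj X *m diag_mx D = diag_mx D *m cj X by rewrite -cjMD -!cjM XM.
apply/matrixP => i j; move/matrixP/(_ i j): E1; move/matrixP/(_ i j): E2.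
rewrite !mul_mx_diag !mul_diag_mx !mxE => XD UD; apply/eqP.
have [Dij|Dij] := eqVneq (D 0 i) (D 0 j); last first.
  move/eqP: XD; rewrite mulrC -subr_eq0 -mulrBl mulf_eq0 subr_eq0 eq_sym.
  by rewrite (negPf Dij).
move/eqP: UD; rewrite Dij mulrC -subr_eq0 opprD addrA subrr sub0r oppr_eq0.
by rewrite mulf_eq0 (negPf (D0 j)).
Qed.

Section EndMx.
Variables (K : fieldType) (V : vectType K).
Let bV : basis_of fullv (vbasis {:V}) := vbasisP _.

Lemma end_mx_comp (f h : 'End(V)) : end_mx (h \o f)%VF = end_mx f *m end_mx h.
Proof. by rewrite /end_mx -passmx.mxof_comp. Qed.

Lemma end_mx1 : end_mx (\1%VF : 'End(V)) = 1%:M.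
Proof. exact: (passmx.mxof1 (basis_free bV)). Qed.

Lemma end_mxD (f h : 'End(V)) : end_mx (f + h) = end_mx f + end_mx h.
Proof.
have := @passmx.mxof_linear _ _ _ (vbasis {:V}) (vbasis {:V}) 1 f h.
by rewrite !scale1r.
Qed.

Lemma end_mxB (f h : 'End(V)) : end_mx (f - h) = end_mx f - end_mx h.
Proof.
have := @passmx.mxof_linear _ _ _ (vbasis {:V}) (vbasis {:V}) (-1) h f.
rewrite !scaleN1r => E; rewrite [f - h]addrC [RHS]addrC; exact: E.
Qed.

Lemma end_mx_eq0 (f : 'End(V)) : end_mx f = 0 -> f = 0.
Proof. by move/eqP; rewrite passmx.mxof_eq0 // => /eqP. Qed.

Lemma semisimple_commutator (f f' u x : 'End(V)) : semisimple_auto f ->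
  (f \o f')%VF = \1%VF -> (f \o u)%VF = (u \o f)%VF + (x \o f)%VF ->
  (f \o x = x \o f)%VF -> x = 0.
Proof.
move=> [L dL] ff' fu fx; apply: end_mx_eq0.
apply: (map_mx_inj (f := GRing.in_alg L)); rewrite map_mx0.
pose m (h : 'End(V)) := map_mx (GRing.in_alg L) (end_mx h).
have mM (h1 h2 : 'End(V)) : m (h2 \o h1)%VF = m h1 *m m h2 by rewrite /m end_mx_comp map_mxM.
apply: (@diag_commutator L _ (m f) (m u)) => //.
- have /eqP := mM f' f; rewrite ff' /m end_mx1 map_mx1 eq_sym => /eqP.
  by case/mulmx1_unit.
- by rewrite -!mM fu /m end_mxD map_mxD.
by rewrite -!mM fx.
Qed.

End EndMx.

(** * Semi-simplicity and stable complements *)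

Section Complement.
Variables (k : fieldType) (C : alg_closure k) (l : nat) (hl : prime l).
Variable V : ladic_rep C hl.
Implicit Types W : {vspace V}.

Lemma stable_add W W' : stable_sub W -> stable_sub W' -> stable_sub (W + W')%VS.
Proof.
move=> sW sW' s _ /memv_addP[u uW [v vW ->]]; rewrite linearD /=.
by rewrite memv_add ?sW ?sW'.
Qed.

Lemma stable_cap W W' : stable_sub W -> stable_sub W' -> stable_sub (W :&: W')%VS.
Proof.
by move=> sW sW' s v; rewrite !memv_cap => /andP[vW vW']; rewrite sW ?sW'.
Qed.

(** W' is chosen of maximal dimension: an irreducible summand not contained in W + W' would meet it
    in 0 and could be added to W'. *)
Lemma semisimple_complement W : semisimple_rep V -> stable_sub W ->
  exists W', [/\ stable_sub W', (W :&: W' = 0)%VS & (W + W' = fullv)%VS].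
Proof.
move=> [n [Wi [irr _ sumW]]] sW.
pose Q d := `[< exists W', [/\ stable_sub W', (W :&: W' = 0)%VS & \dim W' = d] >].
have Q0 : exists d, Q d.
  exists 0%N; apply/asboolP; exists 0%VS; split; rewrite ?dimv0 ?capv0 //.
  by move=> s v; rewrite memv0 => /eqP ->; rewrite linear0 mem0v.
have Qb d : Q d -> (d <= \dim {:V})%N.
  by move=> /asboolP[U [_ _ <-]]; apply/dimvS/subvf.
case: (ex_maxnP Q0 Qb) => d /asboolP[W' [sW' WW' dW']] dmax.
exists W'; split=> //; apply/eqP; rewrite eqEsubv subvf /= -sumW.
apply/subv_sumP => i _; apply: contrapT => /negP niW.
have [sWi Wi0 mWi] := irr i.
have cap0 : (Wi i :&: (W + W') = 0)%VS.
  have [//|cE] := mWi _ (stable_cap sWi (stable_add sW sW')) (capvSl _ _).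
  by case/negP: niW; rewrite -cE capvSr.
have : Q (\dim (W' + Wi i)%VS).
  apply/asboolP; exists (W' + Wi i)%VS; split=> //; first exact: stable_add.
  apply/eqP; rewrite -subv0; apply/subvP => w; rewrite memv_cap.
  case/andP=> wW /memv_addP[w' w'W' [x xWi Dw]].
  have : x \in (Wi i :&: (W + W'))%VS.
    rewrite memv_cap xWi /=; have -> : x = w - w' by rewrite Dw addrC addKr.
    by rewrite memv_add // memvN.
  rewrite cap0 memv0 => /eqP x0; rewrite x0 addr0 in Dw.
  by rewrite -WW' memv_cap wW Dw.
move/dmax; rewrite -dW' => le; case/negP: niW.
have /eqP DW : (W' == W' + Wi i)%VS by rewrite eqEdim addvSl.
by apply: subv_trans (addvSr W W'); rewrite DW addvSr.
Qed.

Lemma complement_semisimple :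
  (forall W, stable_sub W -> exists W',
     [/\ stable_sub W', (W :&: W' = 0)%VS & (W + W' = fullv)%VS]) ->
  semisimple_rep V.
Proof.
move=> cpl.
suff H d U : (\dim U <= d)%N -> stable_sub U ->
    exists (n : nat) (W : 'I_n -> {vspace V}), [/\ forall i, irreducible_sub (W i),
      \dim (\sum_i W i)%VS = (\sum_i \dim (W i))%N & (\sum_i W i)%VS = U].
  have [|n [W [irr dW sumW]]] := H _ fullv (leqnn _); first by move=> s v _; exact: memvf.
  by exists n, W; split=> //; apply/directvP.
elim: d U => [|d IH] U dU sU.
  exists 0%N, (fun=> 0%VS); rewrite !big_ord0 dimv0; split=> //; first by case.
  by apply/esym/eqP; rewrite -dimv_eq0 -leqn0.
have [U0|U0] := eqVneq U 0%VS.
  exists 0%N, (fun=> 0%VS); rewrite !big_ord0 dimv0; split=> //; by case.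
pose Q e := `[< exists W, [/\ stable_sub W, W <> 0%VS, (W <= U)%VS & \dim W = e] >].
have exQ : exists e, Q e.
  by exists (\dim U); apply/asboolP; exists U; split=> //; apply/eqP.
case: (ex_minnP exQ) => e /asboolP[W [sW W0 WU dW]] emin.
have irrW : irreducible_sub W.
  split=> // W1 sW1 W1W; have [W10|/eqP W10] := eqVneq W1 0%VS; [by left|right].
  apply/eqP; rewrite eqEdim W1W dW; apply: emin; apply/asboolP; exists W1.
  by split=> //; exact: subv_trans WU.
have [C' [sC WC WCf]] := cpl W sW.
pose U' := (U :&: C')%VS.
have WU' : (W :&: U' = 0)%VS.
  by apply/eqP; rewrite -subv0 -WC capvS // capvSr.
have UE : (W + U' = U)%VS.
  apply/eqP; rewrite eqEsubv subv_add WU capvSl /=; apply/subvP => u uU.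
  have : u \in (W + C')%VS by rewrite WCf memvf.
  case/memv_addP=> w wW [c cC Du]; have Dc : c = u - w by rewrite Du addrAC subrr add0r.
  by rewrite Du memv_add // memv_cap cC andbT Dc memvB // (subvP WU).
have dWU : \dim U = (\dim W + \dim U')%N.
  by rewrite -UE dimv_disjoint_sum.
have [||n [Wf [irr dWf sumWf]]] := IH U'; last 1 first.
- pose F (i : 'I_n.+1) := if unlift ord0 i is Some j then Wf j else W.
  exists n.+1, F; rewrite !big_ord_recl /F unlift_none.
  have E : (\sum_(i < n) (if unlift ord0 (lift ord0 i) is Some j then Wf j else W))%VS = U'.
    by rewrite -sumWf; apply: eq_bigr => i _; rewrite liftK.
  rewrite E UE; split=> //.
    by move=> i; case: unliftP => [j _|_].
  rewrite dWU -sumWf dWf; congr (_ + _)%N.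
  by apply: eq_bigr => i _; rewrite liftK.
- rewrite -ltnS; apply: leq_trans dU; rewrite dWU -[X in (X < _)%N]add0n ltn_add2r.
  by rewrite lt0n dimv_eq0; apply/eqP.
exact: stable_cap.
Qed.

End Complement.

(** * The Galois group of Q^ab inside that of Q *)

Lemma Qab_lift (t : gal_group Qbar) : (forall x, x \in in_Qab -> t x = x) ->
  exists n, Qab_gal n = t.
Proof.
move=> tfix; have tfix' (a : Qab) : gal_fun t (ac_emb Qab_closure a) = ac_emb Qab_closure a.
  exact/tfix/Qab_valP.
exists (@Galois Qab Qab_closure (gal_fun t) (gal_inv t) (gal_funK t) (gal_invK t) tfix').
exact: gal_ext.
Qed.

Lemma gal_commutator_Qab (s t : gal_group Qbar) : exists n,
  gal_mul s t = gal_mul (Qab_gal n) (gal_mul t s).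
Proof.
pose k := gal_mul (gal_mul s t) (gal_mul (gal_opp s) (gal_opp t)).
have [|n Dn] := @Qab_lift k.
  move=> x /in_QabP xab; rewrite /k /=.
  have := xab (gal_opp s) (gal_opp t); rewrite /= => ->.
  by rewrite !gal_invK.
by exists n; rewrite Dn; apply: gal_ext => x; rewrite /k /= !gal_funK.
Qed.

Lemma gal_conj_Qab (s : gal_group Qbar) n : exists n',
  gal_mul (Qab_gal n) s = gal_mul s (Qab_gal n').
Proof.
have [|n' Dn'] := @Qab_lift (gal_mul (gal_opp s) (gal_mul (Qab_gal n) s)).
  move=> x /in_QabP xab /=.
  have sx : s x \in in_Qab.
    apply/in_QabP => u v; have := xab u (gal_mul v s); rewrite /= => ->.
    by rewrite (xab s u).
  have := gal_fix n (Build_Qab sx); rewrite /= => ->.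
  by rewrite gal_funK.
exists n'; rewrite Dn'; apply: gal_ext => x /=.
by rewrite gal_invK.
Qed.

(** * Descent of complements from Q^ab to Q *)

Section MainRep.
Variables (l : nat) (hl : prime l) (rho : ladic_rep Qbar hl).
Local Notation V := (rep_space rho).
Local Notation r := (rep_act rho).

Definition Qab_equivariant (f : 'End(V)) :=
  forall n, (r (Qab_gal n) \o f = f \o r (Qab_gal n))%VF.

Lemma rep_actV s : (r s \o r (gal_opp s))%VF = \1%VF.
Proof. by rewrite -rep_actM gal_mulV rep_act1. Qed.

Lemma rep_actVl s : (r (gal_opp s) \o r s)%VF = \1%VF.
Proof. by rewrite -rep_actM gal_mulVl rep_act1. Qed.

Lemma rep_actK s v : r (gal_opp s) (r s v) = v.
Proof. by rewrite -comp_lfunE rep_actVl id_lfunE. Qed.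

Lemma rep_actKV s v : r s (r (gal_opp s) v) = v.
Proof. by rewrite -comp_lfunE rep_actV id_lfunE. Qed.

Lemma rep_actMv s t v : r (gal_mul s t) v = r s (r t v).
Proof. by rewrite rep_actM comp_lfunE. Qed.

Definition adj s (f : 'End(V)) : 'End(V) := (r s \o f \o r (gal_opp s))%VF.

Lemma adjE s f v : adj s f v = r s (f (r (gal_opp s) v)).
Proof. by rewrite /adj !comp_lfunE. Qed.

Fact adj_linear s : linear (adj s).
Proof.
move=> a f h; apply/lfunP => v; rewrite !(adjE, add_lfunE, scale_lfunE).
by rewrite linearD linearZ.
Qed.
HB.instance Definition _ s :=
  GRing.isLinear.Build (padic hl) 'End(V) 'End(V) *:%R (adj s) (adj_linear s).

Lemma adjM s t f : adj (gal_mul s t) f = adj s (adj t f).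
Proof.
apply/lfunP => v; rewrite !adjE rep_actMv; congr (r s (r t (f _))).
by rewrite -rep_actMv; congr (rep_act rho _ v); apply: gal_ext.
Qed.

Variable F : gal_group Qbar.
Hypothesis ssF : semisimple_auto (r F).
Hypothesis additive_trivial : forall c : gal_group Qbar -> padic hl,
  (forall s t, c (gal_mul s t) = c s + c t) ->
  (forall N, exists E : seq algC, forall t : gal_group Qbar, {in E, t =1 id} ->
     exists a, c t = Zp_Qp hl (l%:R ^+ N * a)) ->
  c F = 0 -> forall s, c s = 0.

Lemma adj_cont u N : exists E : seq algC, forall t : gal_group Qbar,
  {in E, t =1 id} -> forall i j, exists a,
  end_mx (adj t u - u) i j = Zp_Qp hl (l%:R ^+ N * a).
Proof.
pose int N x := exists a, x = Zp_Qp hl (l%:R ^+ N * a).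
have intD M x y : int M x -> int M y -> int M (x + y).
  by move=> [a ->] [b ->]; exists (a + b); rewrite mulrDr rmorphD.
have intM M x y : int M x -> int 0%N y -> int M (x * y).
  by move=> [a ->] [b ->]; exists (a * b); rewrite expr0 mul1r -rmorphM mulrA.
have int_sum (I : finType) M (f : I -> padic hl) :
    (forall i, int M (f i)) -> int M (\sum_i f i).
  move=> fi; apply: (big_ind (int M)) => //; [by exists 0; rewrite mulr0 rmorph0|exact: intD].
have lQ0 m : (l%:R ^+ m : padic hl) != 0.
  by rewrite -(rmorph_nat (Zp_Qp hl)) -rmorphXn tofrac_eq0 padic_natl_neq0.
pose U := end_mx u.
have [m mU] : exists m, forall i j, int 0%N (l%:R ^+ m * U i j).
  have mi i j : exists m, int 0%N (l%:R ^+ m * U i j).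
    by have [m [a Da]] := padic_frac (U i j); exists m, a; rewrite mul1r.
  pose mf i j := sval (cid (mi i j)).
  exists (\sum_i \sum_j mf i j)%N => i j; have Hm := svalP (cid (mi i j)).
  have [c Dc] : exists c, (\sum_i \sum_j mf i j = c + mf i j)%N.
    by rewrite (bigD1 i) //= (bigD1 j) //= -addnA addnC; eexists.
  rewrite Dc exprD -mulrA; case: Hm => a ->; exists (l%:R ^+ c * a).
  by rewrite expr0 !mul1r rmorphM rmorphXn rmorph_nat.
(* The additional precision m compensates the denominators of [u], which l^m clears. *)
have [E1 E1P] := rep_cont rho (gal_one Qbar) (N + m).
exists E1 => t tE.
have tE' : {in E1, gal_opp t =1 id}.
  by move=> x xE; rewrite /= -[in LHS](tE x xE) gal_funK.
pose R1 := end_mx (r t) - 1%:M; pose R2 := end_mx (r (gal_opp t)) - 1%:M.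
have R1i i j : int (N + m)%N (R1 i j).
  have [a Da] := E1P t tE i j; exists a; rewrite -Da.
  by rewrite rep_act1 end_mx1 /R1 !mxE.
have R2i i j : int (N + m)%N (R2 i j).
  have [a Da] := E1P (gal_opp t) tE' i j; exists a; rewrite -Da.
  by rewrite rep_act1 end_mx1 /R2 !mxE.
have D : end_mx (adj t u - u) = R2 *m (U *m end_mx (r t)) + U *m R1.
  rewrite end_mxB /adj !end_mx_comp -/U /R1 /R2 mulmxBl mulmxBr mul1mx mulmx1.
  by rewrite addrA subrK.
have rti i j : int 0%N (end_mx (r t) i j).
  have -> : end_mx (r t) i j = R1 i j + (1%:M : 'M[padic hl]_(\dim {:V})) i j.
    by rewrite /R1 !mxE subrK.
  apply: intD; last first.
    by rewrite mxE; exists (i == j)%:R; rewrite mul1r rmorph_nat.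
  by have [a ->] := R1i i j; exists (l%:R ^+ (N + m) * a); rewrite mul1r.
move=> i j; suff [a Da] : int (N + m)%N (l%:R ^+ m * end_mx (adj t u - u) i j).
  exists a; apply: (mulfI (lQ0 m)); rewrite Da addnC exprD -mulrA rmorphM.
  by rewrite rmorphXn rmorph_nat.
rewrite D mxE mulrDr; apply: (@intD (N + m)%N).
  rewrite mxE big_distrr; apply: (@int_sum _ (N + m)%N) => k /=.
  rewrite mulrCA; apply: (@intM (N + m)%N) => //.
  rewrite mxE big_distrr; apply: (@int_sum _ 0%N) => k' /=.
  by rewrite mulrA; apply: (@intM 0%N).
rewrite mxE big_distrr; apply: (@int_sum _ (N + m)%N) => k /=.
by rewrite mulrA mulrC; apply: (@intM (N + m)%N).
Qed.

Lemma adj_split u : (forall s t, adj t (adj s u - u) = adj s u - u) ->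
  forall s, adj s u = u.
Proof.
move=> cu; pose c s := adj s u - u.
have cM s t : c (gal_mul s t) = c s + c t.
  rewrite /c adjM; have -> : adj s (adj t u) = adj s u + (adj t u - u).
    by rewrite -[in LHS](subrK u (adj t u)) linearD /= cu addrC.
  by rewrite addrAC.
(* Here rho(F) u = u rho(F) + c(F) rho(F), and c(F), being fixed by conjugation, commutes with
   rho(F). *)
have cF : c F = 0.
  apply: (semisimple_commutator (u := u) ssF (rep_actV F)).
    apply/lfunP => v; rewrite !(add_lfunE, comp_lfunE) /c !(add_lfunE, opp_lfunE).
    by rewrite rep_actK addrC subrK.
  apply/lfunP => v; rewrite !comp_lfunE.
  have := cu F F; rewrite -/(c F) => /lfunP/(_ (r F v)).
  by rewrite adjE rep_actK => ->.
move=> s; apply/eqP; rewrite -subr_eq0; apply/eqP/end_mx_eq0/matrixP => i j.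
rewrite [RHS]mxE; apply: (additive_trivial (c := fun s => end_mx (c s) i j)).
- by move=> s1 t1; rewrite cM end_mxD mxE.
- move=> N; have [E EP] := adj_cont u N; exists E => t tE.
  by have [a Da] := EP t tE i j; exists a.
by rewrite cF -(subrr u) end_mxB subrr mxE.
Qed.

Hypothesis ssN : semisimple_rep (restrict_Qab rho).

Lemma stable_complement (W : {vspace V}) : stable_sub W ->
  exists W', [/\ stable_sub W', (W :&: W' = 0)%VS & (W + W' = fullv)%VS].
Proof.
move=> sW; have [W0|W0] := eqVneq W 0%VS.
  exists fullv; rewrite W0 cap0v add0v; split=> // s v _; exact: memvf.
have sWN : stable_sub (V := restrict_Qab rho) W by move=> n v; apply: sW.
have [W1 [sW1 WW1 WW1f]] := semisimple_complement ssN sWN.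
pose w0 := vpick W; have w0W : w0 \in W := memv_pick W.
have w00 : w0 != 0 by rewrite vpick0.
have [i wi] : exists i, coord (vbasis {:V}) i w0 != 0.
  apply: contrapT => H; case/negP: w00; rewrite (coord_vbasis (memvf w0)).
  rewrite big1 // => i _; have [->|wi] := eqVneq (coord (vbasis {:V}) i w0) 0.
    by rewrite scale0r.
  by case: H; exists i.
(* Projections onto W form only an affine space; it becomes linear by allowing any scalar c on W
   instead of 1. *)
pose Pd (f : 'End(V)) := [/\ Qab_equivariant f, (forall v, f v \in W) &
  exists c, forall w, w \in W -> f w = c *: w].
have [|a f h|U0 U0P] := @vspace_of_pred _ 'End(V) Pd.
- split=> [n|v|]; first by rewrite comp_lfun0r comp_lfun0l.
    by rewrite zero_lfunE mem0v.
  by exists 0 => w _; rewrite zero_lfunE scale0r.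
- move=> [eqf fW [c fc]] [eqh hW [d hd]]; split=> [n|v|].
  + by rewrite comp_lfunDr comp_lfunDl -comp_lfunZr -comp_lfunZl eqf eqh.
  + by rewrite add_lfunE scale_lfunE memvD ?memvZ.
  exists (a * c + d) => w wW.
  by rewrite add_lfunE scale_lfunE fc // hd // scalerA -scalerDl.
(* On [U0] this is the scalar c times a nonzero constant, hence invariant under conjugation. *)
pose ep (f : 'End(V)) : (padic hl)^o := coord (vbasis {:V}) i (f w0).
have epl : linear ep.
  by move=> a f h; rewrite /ep add_lfunE scale_lfunE linearD linearZ.
pose epM := GRing.isLinear.Build (padic hl) 'End(V) (padic hl)^o *:%R ep epl.
pose epL : {linear 'End(V) -> (padic hl)^o} := HB.pack ep epM.
pose T s : 'End('End(V)) := linfun (adj s).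
have TE s f : T s f = adj s f by rewrite lfunE.
have Tst s f : f \in U0 -> adj s f \in U0.
  move=> /U0P[eqf fW [c fc]]; apply/U0P; split=> [n|v|].
  + apply/lfunP => v; rewrite !comp_lfunE.
    have [n' Dn] := gal_conj_Qab s n.
    have Dn' x : r (Qab_gal n) (r s x) = r s (r (Qab_gal n') x).
      by rewrite -!rep_actMv Dn.
    rewrite Dn' -[r (Qab_gal n') (f _)]comp_lfunE eqf comp_lfunE; congr (r s (f _)).
    by rewrite -[LHS](rep_actK s) -Dn' rep_actKV.
  + by rewrite adjE sW.
  exists c => w wW; rewrite adjE (fc _ (sW (gal_opp s) w wW)).
  by rewrite linearZ /= rep_actKV.
have [|||||u [uU ue uT]] := @fixed_vector _ _ _ T U0 epL.
- by move=> s f fU; rewrite TE Tst.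
- move=> s t f fU; rewrite !TE -!adjM.
  (* Commutators lie in the Galois group of Q^ab, which acts trivially on equivariant
     endomorphisms. *)
  have [n Dn] := gal_commutator_Qab s t; rewrite Dn adjM.
  have /U0P[eqg _ _] := Tst (gal_mul t s) f fU.
  apply/lfunP => v; rewrite adjE -comp_lfunE eqg comp_lfunE rep_actKV //.
- move=> s f /U0P[eqf fW [c fc]]; rewrite TE /= /ep adjE (fc _ (sW (gal_opp s) w0 w0W)).
  by rewrite linearZ /= rep_actKV fc.
- move=> f fU cf s; rewrite TE; apply: adj_split => s1 t1.
  by have := cf s1 t1; rewrite !TE.
- exists (daddv_pi W W1).
    apply/U0P; split=> [n|v|]; last 1 first.
    + by exists 1 => w wW; rewrite scale1r daddv_pi_id.
    + apply/lfunP => v; rewrite !comp_lfunE.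
      have vE : daddv_pi W W1 v + daddv_pi W1 W v = v.
        by rewrite daddv_pi_add // WW1f memvf.
      have pW : r (Qab_gal n) (daddv_pi W W1 v) \in W.
        by apply: (sW (Qab_gal n)); exact: memv_pi.
      rewrite -[in RHS]vE !linearD /= (daddv_pi_id WW1 pW).
      suff -> : daddv_pi W W1 (r (Qab_gal n) (daddv_pi W1 W v)) = 0 by rewrite addr0.
      set x := r _ _; have xW1 : x \in W1 by apply: (sW1 n); exact: memv_pi.
      have xE : daddv_pi W W1 x + daddv_pi W1 W x = x.
        by rewrite daddv_pi_add // WW1f memvf.
      apply/eqP; rewrite -memv0 -WW1 memv_cap memv_pi /=.
      have -> : daddv_pi W W1 x = x - daddv_pi W1 W x by rewrite -[X in X - _]xE addrK.
      by rewrite memvB // memv_pi.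
    exact: memv_pi.
  by rewrite /= /ep daddv_pi_id.
have /U0P[_ uW [c uc]] := uU.
have c0 : c != 0.
  apply: contraNneq ue => c0; rewrite /= /ep uc // c0 scale0r linear0 //.
have us s v : u (r s v) = r s (u v).
  have := uT s; rewrite TE => /lfunP/(_ (r s v)); rewrite adjE rep_actK => <- //.
(* Up to the scalar c, [u] is a projection onto W commuting with the whole Galois group. *)
exists (lker u); split.
- by move=> s v; rewrite !memv_ker us => /eqP ->; rewrite linear0.
- apply/eqP; rewrite -subv0; apply/subvP => w; rewrite memv_cap memv_ker => /andP[wW].
  by rewrite uc // scaler_eq0 (negPf c0) memv0.
apply/eqP; rewrite eqEsubv subvf; apply/subvP => v _.
rewrite -[v](subrK (c^-1 *: u v)) addrC memv_add ?memvZ //.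
rewrite memv_ker linearB linearZ /= (uc (u v)) // scalerA mulVf // scale1r subrr //.
Qed.

Lemma semisimple_of_frobenius : semisimple_rep rho.
Proof. exact/complement_semisimple/stable_complement. Qed.

End MainRep.

(** * Restriction of geometric representations to Q^ab *)

Section GenericSystem.
Variables (K : fieldType) (n : nat) (Y : subproj K n) (l : nat).
Variables (G : Type) (g : G -> {rmorphism K -> K}).
Variable P1 : forall s (U : etale Y), Y (et_alg U \o g s) (et_pt U).
Variable P2 : forall s (U : etale Y), finite_type (et_alg U \o g s).
Variable P3 : forall s (U : etale Y),
  formally_etale Y (et_alg U \o g s) (et_pt U).

Definition gtwist s (U : etale Y) : etale Y :=
  Etale (@P1 s U) (@P2 s U) (@P3 s U).

(* [ladic_system] for an arbitrary subfunctor Y and an arbitrary family g of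
   automorphisms of K, with the proofs that enter the definition of the twists
   as parameters: this form can be transported along an equality of
   subfunctors. *)
Record gsystem := GSystem {
  gs_res : forall m, const_resolution Y (l ^ m);
  gs_red : forall m j, sheaf_hom (cr_obj (gs_res m.+1) j) (cr_obj (gs_res m) j);
  gs_gal : forall s m j U,
    {additive cr_obj (gs_res m) j U -> cr_obj (gs_res m) j (gtwist s U)};
  gs_red_diff : forall m j U z,
    cr_diff (gs_res m) j U (gs_red m j U z)
      = gs_red m j.+1 U (cr_diff (gs_res m.+1) j U z);
  gs_red_one : forall m U,
    gs_red m 0 U (cr_one (gs_res m.+1) U) = cr_one (gs_res m) U;
  gs_gal_nat : forall s m j U V (f : et_hom U V)
      (f' : et_hom (gtwist s U) (gtwist s V)), eh_fun f =1 eh_fun f' ->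
    forall z, gs_gal s m j U (res (cr_obj (gs_res m) j) f z)
                = res (cr_obj (gs_res m) j) f' (gs_gal s m j V z);
  gs_gal_diff : forall s m j U z,
    cr_diff (gs_res m) j (gtwist s U) (gs_gal s m j U z)
      = gs_gal s m j.+1 U (cr_diff (gs_res m) j U z);
  gs_gal_one : forall s m U,
    gs_gal s m 0 U (cr_one (gs_res m) U) = cr_one (gs_res m) (gtwist s U)
}.

Definition gcocycle (L : gsystem) i (z : forall m, cochain (gs_res L m) i) :=
  (forall m, cocycle (z m)) /\
  (forall m, coboundary (I := gs_res L m) (i := i)
     (fun U => gs_red L m i U (z m.+1 U) - z m U)).

Definition gcohomology (hl : prime l) i (V : vectType (padic hl))
    (act : G -> 'End(V)) :=
  exists (L : gsystem) (psi : (forall m, cochain (gs_res L m) i) -> V),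
  [/\ forall z z', gcocycle z -> gcocycle z' ->
        psi (fun m U => z m U + z' m U) = psi z + psi z',
      forall (a : padic_int hl) z, gcocycle z ->
        psi (fun m U => z m U *+ a m) = Zp_Qp hl a *: psi z,
      forall z, gcocycle z ->
        (psi z = 0 <->
         exists N, forall m, coboundary (I := gs_res L m) (i := i)
                               (fun U => z m U *+ l ^ N)),
      forall v : V, exists (N : nat) (z : forall m, cochain (gs_res L m) i),
        gcocycle z /\ l%:R ^+ N *: v = psi z &
      forall s z z', gcocycle z -> gcocycle z' ->
        (forall m U, z' m (gtwist s U) = gs_gal L s m i U (z m U)) ->
        psi z' = act s (psi z)].

End GenericSystem.

(** Once the equalities are substituted, the proofs inside the twists agree by proof irrelevance,
    and a system for G restricts along [h]. *)
Lemma gcohomology_transport (K : fieldType) n (Y Y' : subproj K n) l (hl : prime l)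
    (G G' : Type) (h : G' -> G) (g : G -> {rmorphism K -> K})
    (g' : G' -> {rmorphism K -> K}) P1 P2 P3 P1' P2' P3' i
    (V : vectType (padic hl)) (act : G -> 'End(V)) (act' : G' -> 'End(V)) :
  Y' = Y -> g' = g \o h -> act' = act \o h ->
  @gcohomology K n Y l G g P1 P2 P3 hl i V act ->
  @gcohomology K n Y' l G' g' P1' P2' P3' hl i V act'.
Proof.
move=> EY Eg Ea; subst Y' g' act'.
have -> : P1' = (fun s => @P1 (h s)) by apply: Prop_irrelevance.
have -> : P2' = (fun s => @P2 (h s)) by apply: Prop_irrelevance.
have -> : P3' = (fun s => @P3 (h s)) by apply: Prop_irrelevance.
case=> L [psi [H1 H2 H3 H4 H5]].
pose L' := @GSystem K n Y l G' (g \o h) (fun s => @P1 (h s)) (fun s => @P2 (h s))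
  (fun s => @P3 (h s)) (gs_res L) (gs_red L) (fun s => gs_gal L (h s))
  (@gs_red_diff _ _ _ _ _ _ _ _ _ L) (@gs_red_one _ _ _ _ _ _ _ _ _ L)
  (fun s => @gs_gal_nat _ _ _ _ _ _ _ _ _ L (h s))
  (fun s => @gs_gal_diff _ _ _ _ _ _ _ _ _ L (h s))
  (fun s => @gs_gal_one _ _ _ _ _ _ _ _ _ L (h s)).
exists L', psi; split; [exact: H1|exact: H2|exact: H3|exact: H4|].
by move=> s z z' cz cz' zz'; apply: (H5 (h s)).
Qed.

Lemma etale_cohomology_gen (k : fieldType) (C : alg_closure k) (X : proj_scheme k)
    l (hl : prime l) i (V : ladic_rep C hl) :
  is_etale_cohomology X i V <->
  @gcohomology C (ps_dim X) (geometric_fibre C X) l (gal_group C)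
    (fun s => gal_inv s) (@twist_ptP k C X) (@twist_finite k C X)
    (@twist_formal k C X) hl i V (rep_act V).
Proof.
split=> [[L [psi H]]|[L [psi H]]].
  pose L' := @GSystem C (ps_dim X) (geometric_fibre C X) l (gal_group C)
    (fun s => gal_inv s) (@twist_ptP k C X) (@twist_finite k C X)
    (@twist_formal k C X) (ls_res L) (ls_red L) (ls_gal L)
    (@ls_red_diff _ _ _ _ L) (@ls_red_one _ _ _ _ L) (@ls_gal_nat _ _ _ _ L)
    (@ls_gal_diff _ _ _ _ L) (@ls_gal_one _ _ _ _ L).
  by exists L', psi; exact: H.
pose L' := @LadicSystem k C X l (gs_res L) (gs_red L) (gs_gal L)
  (@gs_red_diff _ _ _ _ _ _ _ _ _ L) (@gs_red_one _ _ _ _ _ _ _ _ _ L)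
  (@gs_gal_nat _ _ _ _ _ _ _ _ _ L) (@gs_gal_diff _ _ _ _ _ _ _ _ _ L)
  (@gs_gal_one _ _ _ _ _ _ _ _ _ L).
by exists L', psi; exact: H.
Qed.

Section BaseChange.
Variables (k k' : fieldType) (b : {rmorphism k -> k'}).

Lemma perm_msupp_map n (p : {mpoly k[n]}) :
  perm_eq (msupp (map_mpoly b p)) (msupp p).
Proof.
apply: uniq_perm; rewrite ?msupp_uniq // => m.
by rewrite !mcoeff_msupp mcoeff_map_mpoly fmorph_eq0.
Qed.

Lemma mpoly_eval_map (A : comPzRingType) (i : k' -> A) n (p : {mpoly k[n]}) v :
  mpoly_eval i (map_mpoly b p) v = mpoly_eval (i \o b) p v.
Proof.
rewrite /mpoly_eval (perm_big _ (perm_msupp_map p)) /=.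
by apply: eq_bigr => m _; rewrite mcoeff_map_mpoly.
Qed.

Variable X : proj_scheme k.

Fact base_change_homog f : f \in map (map_mpoly b) (ps_eqs X) ->
  exists d : nat, f \is d.-homog.
Proof.
case/mapP=> p pX ->; have [d /dhomogP pd] := ps_homog pX.
by exists d; apply/dhomogP => m; rewrite (perm_mem (perm_msupp_map p)) => /pd.
Qed.

Definition base_change : proj_scheme k' := ProjScheme base_change_homog.

Lemma base_change_points (A : comPzRingType) (i : k' -> A) e :
  ps_points base_change A i e <-> ps_points X A (i \o b) e.
Proof.
split=> -[pe Xe]; split=> // f fX w.
  by rewrite -mpoly_eval_map; apply: Xe; exact: map_f.
by case/mapP: fX => p pX ->; rewrite mpoly_eval_map; apply: Xe.
Qed.

Lemma base_change_smooth : ps_smooth X -> ps_smooth base_change.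
Proof.
move=> sX B B0 i q sq e0 /base_change_points Xe0.
have [e /(base_change_points i) Xe se] := sX B B0 (i \o b) q sq e0 Xe0.
by exists e.
Qed.

End BaseChange.

Fact Qab_rat_zmod : zmod_morphism Qab_rat.
Proof. by move=> x y; apply: val_inj; rewrite /= rmorphB. Qed.
Fact Qab_rat_monoid : monoid_morphism Qab_rat.
Proof.
by split=> [|x y]; apply: val_inj; rewrite /= ?rmorph1 ?rmorphM.
Qed.
HB.instance Definition _ := GRing.isZmodMorphism.Build rat Qab Qab_rat Qab_rat_zmod.
HB.instance Definition _ :=
  GRing.isMonoidMorphism.Build rat Qab Qab_rat Qab_rat_monoid.

Lemma geometric_fibre_Qab (X : proj_scheme rat) :
  geometric_fibre Qab_closure (base_change Qab_rat X) = geometric_fibre Qbar X.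
Proof.
apply: functional_extensionality_dep => A; apply: funext => i; apply: funext => e.
apply: propext; rewrite /geometric_fibre base_change_points.
suff -> : (i \o ac_emb Qab_closure) \o Qab_rat = i \o ac_emb Qbar by [].
exact: funext.
Qed.

(** A scheme over Q and its base change to Q^ab have the same geometric fibre, so the same
    resolutions compute both cohomologies; the other constructions keep their linear maps. *)
Lemma from_geometry_restrict l (hl : prime l) (V : ladic_rep Qbar hl) :
  from_geometry V -> from_geometry (restrict_Qab V).
Proof.
elim=> {V}.
- move=> X i V sX /etale_cohomology_gen cX.
  apply: (@FG_cohomology _ _ _ _ (base_change Qab_rat X) i).
    exact: base_change_smooth.
  apply/etale_cohomology_gen; move: cX.
  apply: (gcohomology_transport (h := Qab_gal)) => //.
  exact: geometric_fibre_Qab.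
- by move=> V dV tV; apply: FG_unit => // s; apply: tV.
- move=> V1 V2 W _ g1 _ g2 [f1 [f2 [e1 e2 bf]]]; apply: (FG_sum g1 g2).
  by exists f1, f2; split=> // s v; [exact: e1 | exact: e2].
- move=> V1 V2 W _ g1 _ g2 [b [bb be bu]]; apply: (FG_tensor g1 g2).
  by exists b; split=> // s x y; exact: be.
- move=> V W _ g [d [bd de]]; apply: (FG_dual g).
  by exists d; split=> // s v w; exact: de.
- move=> V W f _ g fe fi.
  exact: (@FG_sub _ _ _ _ (restrict_Qab V) (restrict_Qab W) f g
            (fun s v => fe (Qab_gal s) v) fi).
move=> V W f _ g fe fs.
exact: (@FG_quotient _ _ _ _ (restrict_Qab V) (restrict_Qab W) f g
          (fun s v => fe (Qab_gal s) v) fs).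
Qed.

Lemma Qab_pchar l : l \notin [pchar Qab].
Proof. by rewrite -(fmorph_pchar (val : {rmorphism Qab -> algC})) pchar_num. Qed.

Theorem theorem4p6 :
  (forall (l : nat) (hl : prime l) (rho : ladic_rep Qbar hl),
     semisimple_rep (restrict_Qab rho) ->
     (exists (p : nat) (hp : prime p) (F : gal_group Qbar),
        [/\ p <> l, frobenius_at hp F & semisimple_auto (rep_act rho F)]) ->
     semisimple_rep rho)
  /\
  (S_statement Qab_closure ->
   forall (l : nat) (hl : prime l) (rho : ladic_rep Qbar hl),
     from_geometry rho ->
     (exists (p : nat) (hp : prime p),
        [/\ p <> l, unramified_at hp rho & semisimple_at hp rho]) ->
     semisimple_rep rho).
Proof.
have part1 (l : nat) (hl : prime l) (rho : ladic_rep Qbar hl) :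
    semisimple_rep (restrict_Qab rho) ->
    (exists (p : nat) (hp : prime p) (F : gal_group Qbar),
      [/\ p <> l, frobenius_at hp F & semisimple_auto (rep_act rho F)]) ->
    semisimple_rep rho.
  move=> ssN [p [hp [F [pl hF ssF]]]].
  apply: (semisimple_of_frobenius ssF _ ssN) => c cM cC cF.
  exact: (padic_character_eq0 hF pl cM cC cF).
split=> // SQ l hl rho geo [p [hp [pl _ [F hF ssF]]]].
apply: part1; last by exists p, hp, F.
by apply: SQ; [exact: Qab_pchar|exact: from_geometry_restrict].
Qed.
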